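(* The optimization problem $\mathcal P_1$, $$\max_{\mathcal A\subseteq\mathcal V} f(\mathcal A)\quad\text{s.t.}\quad \|\mathbf u_i^a\|\le\bar u\ \ \forall i\in\mathcal V,\qquad \sum_{i\in\mathcal A}c(i)\le\Omega,\qquad \int_0^{t_c}\theta(\tau)\,d\tau\le\bar g,$$ under the time-variant attack strategy $\theta(t)$ (deterministic, continuous and integrable in $t$), is NP-hard.
   Context: An instance of $\mathcal P_1$ consists of the following data. $\mathcal G=(\mathcal V,\mathcal E)$ is a connected undirected graph without self-loops, $\mathcal V=\{1,\dots,n\}$, with maximum degree $d_{\max}$ and Laplacian $L$; $A,B\in\mathbb R^{m\times m}$ are constant matrices, $\bar d\in(0,1/d_{\max})$, and $M=I_n\otimes A-\bar dL\otimes B\in\mathbb R^{mn\times mn}$, with $(A,B)$ controllable and $M$ Hurwitz stable. The attack-free global state $\mathbf x(t)\in\mathbb R^{mn}$ satisfies $\dot{\mathbf x}=M\mathbf x$. For a set $\mathcal A\subseteq\mathcal V$ of compromised agents with indicator vector $\mu^{\mathcal A}\in\{0,1\}^n$, the false data injected at agent $i$ is $\mathbf u_i^a(t)=\theta(t)\in\mathbb R^m$ if $i\in\mathcal A$ and $\mathbf 0$ otherwise, where $\theta$ is a given attack strategy, and the attacked state is $\mathbf x(\mu^{\mathcal A},t)=e^{Mt}\mathbf x(0)+\int_0^te^{M(t-\tau)}(\mu^{\mathcal A}\otimes\theta(\tau))\,d\tau$. The objective is the convergence error $f(\mathcal A)=\lim_{t\to t_c}\|\mathbf x(\mu^{\mathcal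 A},t)-\mathbf x(t)\|$ (Euclidean norm), where $t_c>0$ is a given time greater than the convergence time of the attack-free system. $c(i)\in\mathbb R_{\ge0}$ is the cost of compromising agent $i$, $\Omega\in\mathbb R_{\ge0}$ the total attack cost budget, $\bar u$ the upper bound on the false data, and $\bar g$ the upper bound on the attack energy (the integral inequality is read entrywise). *)

(* Defs.v *)
(* Part 1 fixes the complexity-theoretic notions (multi-tape Turing machines,
   NP, polynomial-time Turing reductions, NP-hard search problems), following
   Garey and Johnson, "Computers and Intractability", chapters 2 and 5.
   Part 2 states the attack-placement problem over the reals.
   Part 3 fixes how its finitely presented instances are written as bit
   strings; hardness on them is hardness for any larger class of instances. *)
From HB Require Import structures.
From mathcomp Require Import all_boot all_order all_algebra.
From mathcomp Require Import all_classical all_reals all_analysis.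
From mathcomp Require Import mxtens.
From mathcomp Require Import complex.

Set Implicit Arguments.
Unset Strict Implicit.
Unset Printing Implicit Defensive.

Import Order.TTheory GRing.Theory Num.Theory.
Import numFieldNormedType.Exports.

Local Open Scope classical_set_scope.
Local Open Scope ring_scope.

(** * Complexity *)

Notation bits := (seq bool).

(* Tape symbols are blank (None), 0 and 1. *)
Notation symbol := (option bool).

Variant move := MoveL | Stay | MoveR.

(* A two-way infinite tape, blank outside the stored part: [rgt] starts with
   the scanned cell, [lft] lists the cells to its left, nearest first. *)
Record tape := Tape { lft : seq symbol; rgt : seq symbol }.

Definition read (t : tape) : symbol := head None (rgt t).

Definition write (b : symbol) (t : tape) : tape :=
  Tape (lft t) (b :: behead (rgt t)).

Definition shift (d : move) (t : tape) : tape :=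
  match d with
  | MoveL => Tape (behead (lft t)) (head None (lft t) :: rgt t)
  | Stay => t
  | MoveR => Tape (read t :: lft t) (behead (rgt t))
  end.

Definition tape_of (w : bits) : tape := Tape [::] (map some w).

(* The word written from the scanned cell up to the next blank. *)
Fixpoint leading_word (s : seq symbol) : bits :=
  if s is Some b :: s' then b :: leading_word s' else [::].

(* A nondeterministic oracle machine with [ntapes.+2] tapes; the first one
   carries the input and the last one is the oracle tape.  In a state [q] with
   [query q = Some q'] the machine consults the oracle and goes to [q'];
   otherwise it may perform any of the actions listed by [delta], and it halts
   when there is none. *)
Record machine := Machine {
  ntapes : nat;
  state : finType;
  start : state;
  accepting : pred state;
  query : state -> option state;
  delta : state -> {ffun 'I_ntapes.+2 -> symbol} ->
          seq (state * {ffun 'I_ntapes.+2 -> symbol * move}) }.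

Definition oracle_free (M : machine) : Prop := forall q, @query M q = None.

Definition deterministic (M : machine) : Prop :=
  forall q r, (size (@delta M q r) <= 1)%N.

Record config (M : machine) := Config {
  cstate : state M;
  ctapes : {ffun 'I_(ntapes M).+2 -> tape} }.

Definition init (M : machine) (w : bits) : config M :=
  Config (start M) [ffun i => if i == ord0 then tape_of w else tape_of [::]].

Definition ask (orc : bits -> bits) (t : tape) : tape :=
  tape_of (orc (leading_word (rgt t))).

Definition act (k : nat) (a : {ffun 'I_k -> symbol * move})
    (ts : {ffun 'I_k -> tape}) : {ffun 'I_k -> tape} :=
  [ffun i => shift (a i).2 (write (a i).1 (ts i))].

Definition next (M : machine) (orc : bits -> bits) (c : config M) :
    seq (config M) :=
  if query (cstate c) is Some q then
    [:: Config q [ffun i => if i == ord_max then ask orc (ctapes c i)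
                            else ctapes c i]]
  else
    [seq Config qa.1 (act qa.2 (ctapes c))
       | qa <- delta (cstate c) [ffun i => read (ctapes c i)]].

(* Every computation from [c] halts after at most [n] steps. *)
Fixpoint halts_within (M : machine) (orc : bits -> bits) (n : nat)
    (c : config M) : bool :=
  if n is n'.+1 then all (halts_within orc n') (next orc c)
  else nilp (next orc c).

(* Some computation from [c] halts in an accepting state after at most [n]
   steps. *)
Fixpoint accepts_within (M : machine) (orc : bits -> bits) (n : nat)
    (c : config M) : bool :=
  (nilp (next orc c) && accepting (cstate c)) ||
  (if n is n'.+1 then has (accepts_within orc n') (next orc c) else false).

Definition decides_within (M : machine) (orc : bits -> bits) (p : {poly nat})
    (L : set bits) : Prop :=
  forall w : bits,
    halts_within orc p.[size w] (init M w) /\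
    (L w <-> accepts_within orc p.[size w] (init M w)).

Definition no_oracle (_ : bits) : bits := [::].

Definition NP (L : set bits) : Prop :=
  exists (M : machine) (p : {poly nat}),
    oracle_free M /\ decides_within M no_oracle p L.

(* A search problem: [S w y] means that [y] is a correct answer on input [w]. *)
Definition search_problem := bits -> bits -> Prop.

(* [orc] answers correctly every input that has an answer. *)
Definition solves (orc : bits -> bits) (S : search_problem) : Prop :=
  forall w, (exists y, S w y) -> S w (orc w).

Definition turing_reducible (L : set bits) (S : search_problem) : Prop :=
  exists (M : machine) (p : {poly nat}),
    deterministic M /\
    forall orc, solves orc S -> decides_within M orc p L.

Definition NP_hard (S : search_problem) : Prop :=
  forall L : set bits, NP L -> turing_reducible L S.

(** * The attack-placement problem *)

(* [K] is the type of numbers and [S] the type of the components of the attack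
   strategy. *)
Record instance (K S : Type) := Instance {
  nagents : nat;
  ndim : nat;
  adj : 'M[bool]_nagents;
  mxA : 'M[K]_ndim;
  mxB : 'M[K]_ndim;
  dbar : K;
  x0 : 'cV[K]_(nagents * ndim);
  cost : 'cV[K]_nagents;
  budget : K;
  ubar : K;
  gbar : 'cV[K]_ndim;
  strategy : 'cV[S]_ndim;
  tc : K }.

(* MathComp-Analysis equips matrices with the max norm. *)
Definition enorm (R : rcfType) (k : nat) (x : 'cV[R]_k) : R :=
  Num.sqrt (\sum_i x i 0 ^+ 2).

Definition expmx (R : realType) (k : nat) (X : 'M[R]_k) : 'M[R]_k :=
  \matrix_(i, j) limn (series (fun p => (X ^+ p) i j / p`!%:R)).

Section MatrixExponential.
Variables (R : realType) (k : nat) (X : 'M[R]_k).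

Let b := \sum_i \sum_j `|X i j|.

Let exprZmx (t : R) p : (t *: X) ^+ p = t ^+ p *: X ^+ p.
Proof.
elim: p => [|p IH]; first by rewrite !expr0 scale1r.
by rewrite !exprS IH -[LHS]/(_ *m _) -scalemxAl -scalemxAr scalerA.
Qed.

Let norm_expr_le p i j : `|(X ^+ p) i j| <= b ^+ p.
Proof.
have b_ge0 : 0 <= b by apply: sumr_ge0 => ? _; apply: sumr_ge0.
elim: p i j => [|p IH] i j.
  rewrite !expr0 -[1]/(1%:M) mxE.
  by case: (i == j); rewrite ?normr1 ?normr0.
rewrite exprS -[_ * _]/(_ *m _) mxE (le_trans (ler_norm_sum _ _ _))//.
rewrite exprS (@le_trans _ _ ((\sum_l `|X i l|) * b ^+ p))//.
  rewrite mulr_suml; apply: ler_sum => l _.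
  by rewrite normrM ler_wpM2l.
rewrite ler_wpM2r ?exprn_ge0// /b [leRHS](bigD1 i)//= lerDl.
by apply: sumr_ge0 => ? _; apply: sumr_ge0.
Qed.

Let coef q i j p : R := (X ^+ (p + q)) i j / p`!%:R.

Let cvg_coef q i j t : cvgn (pseries (coef q i j) t).
Proof.
apply: normed_cvg.
have b_ge0 : 0 <= b by apply: sumr_ge0 => ? _; apply: sumr_ge0.
apply: (@series_le_cvg _ _ (fun p => b ^+ q *: exp_coeff (b * `|t|) p)).
- by move=> p; rewrite normr_ge0.
- by move=> p; rewrite mulr_ge0 ?exprn_ge0// exp_coeff_ge0// mulr_ge0.
- move=> p; rewrite /coef /exp_coeff/= normrM normrM normfV normr_nat normrX.
  rewrite exprMn -[_ *: _]/(_ * _) mulrAC !mulrA -exprD addnC.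
  by rewrite ler_wpM2r ?invr_ge0// ler_wpM2r ?exprn_ge0// addnC.
- apply: is_cvg_seriesZ; exact: is_cvg_series_exp_coeff.
Qed.

Let diffs_coef q i j : pseries_diffs (coef q i j) = coef q.+1 i j.
Proof.
apply/funext => p; rewrite /pseries_diffs /coef factS natrM invfM addSnnS.
by rewrite mulrCA; congr (_ * _); rewrite mulrA divff ?mul1r// pnatr_eq0.
Qed.

Let expmxE (t : R) i j : expmx (t *: X) i j = limn (pseries (coef 0 i j) t).
Proof.
rewrite mxE /pseries; congr (limn (series _)); apply/funext => p.
by rewrite /coef /= exprZmx mxE addn0 -mulrA mulrC.
Qed.

Lemma expmx0 : expmx (0 : 'M[R]_k) = 1%:M.
Proof.
apply/matrixP => i j; rewrite mxE; apply: cvg_lim => //.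
rewrite -(cvg_shiftS); apply: cvg_near_cst; apply: nearW => p.
rewrite /series/= big_nat_recl//= big1 ?addr0 ?expr0 ?fact0 ?divr1//.
by move=> ? _; rewrite exprS mul0r mxE mul0r.
Qed.

Lemma is_derive_expmx (t : R) i j :
  is_derive t (1 : R) (fun s => expmx (s *: X) i j)
    ((X *m expmx (t *: X)) i j).
Proof.
rewrite (_ : (fun s => _) = (fun s => limn (pseries (coef 0 i j) s))); last first.
  by apply/funext => s; rewrite expmxE.
rewrite (_ : (_ *m _) i j = limn (pseries (pseries_diffs (coef 0 i j)) t)).
  apply: (@pseries_snd_diffs _ _ (`|t| + 1)); rewrite ?diffs_coef//.
  by rewrite [ltRHS]ger0_norm ?ltrDl// addr_ge0.
rewrite diffs_coef mxE; apply/esym/cvg_lim => //.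
rewrite (_ : pseries _ _ =
  (fun N => \sum_l X i l * pseries (coef 0 l j) t N)); last first.
  apply/funext => N; rewrite /pseries /series/=.
  under [RHS]eq_bigr do rewrite mulr_sumr.
  rewrite exchange_big/=; apply: eq_bigr => p _.
  rewrite /coef addn1 addn0 exprS -[X * X ^+ p]/(X *m X ^+ p) mxE !mulr_suml.
  by apply: eq_bigr => l _; rewrite !mulrA.
under eq_bigr do rewrite expmxE.
apply: (@cvg_big _ _ +%R); first exact: add_continuous.
by move=> l _; apply: cvgM; [exact: cvg_cst|exact: cvg_coef].
Qed.

End MatrixExponential.

Definition hurwitz (R : realType) (k : nat) (X : 'M[R]_k) : Prop :=
  forall z : complex.complex R,
    eigenvalue (map_mx (complex.real_complex R) X) z -> complex.Re z < 0.

Definition controllable (F : fieldType) (k : nat) (A B : 'M[F]_k) : Prop :=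
  \rank (\mxrow_(p < k) (A ^+ p *m B)) = k.

Section Problem.
Variables (R : realType) (I : instance R (R -> R)).

Let n := nagents I.
Let m := ndim I.
Let mu : {measure set _ -> \bar R} := @lebesgue_measure R.

Definition deg (i : 'I_n) : nat := #|[set j | adj I i j]%SET|.

Definition dmax : nat := \max_i deg i.

Definition laplacian : 'M[R]_n :=
  \matrix_(i, j) (if i == j then (deg i)%:R else - (adj I i j)%:R).

Definition mxM : 'M[R]_(n * m) :=
  tensmx (1%:M : 'M[R]_n) (mxA I) - dbar I *: tensmx laplacian (mxB I).

Definition theta (t : R) : 'cV[R]_m := \col_i strategy I i 0 t.

Definition indic (A : {set 'I_n}) : 'cV[R]_n := \col_i (i \in A)%:R.

Definition false_data (A : {set 'I_n}) (i : 'I_n) (t : R) : 'cV[R]_m :=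
  if i \in A then theta t else 0.

(* The solution of x' = M x with x(0) = x0; see [free_state0] and
   [is_derive_free_state]. *)
Definition free_state (t : R) : 'cV[R]_(n * m) := expmx (t *: mxM) *m x0 I.

Definition attacked_state (A : {set 'I_n}) (t : R) : 'cV[R]_(n * m) :=
  expmx (t *: mxM) *m x0 I +
  \col_k Rintegral mu `[0, t]
    (fun s => (expmx ((t - s) *: mxM) *m
               (tensmx (indic A) (theta s) : 'cV[R]_(n * m))) k 0).

Definition objective (A : {set 'I_n}) : R :=
  lim (enorm (attacked_state A t - free_state t) @[t --> (tc I)^']).

(* The time from which the attack-free system stays within [eps] of its limit
   0.  (Exact convergence in finite time is impossible for a linear system
   that does not start at 0.) *)
Definition convergence_time (eps : R) : R :=
  inf [set T | 0 <= T /\ forall t, T <= t -> enorm (free_state t) <= eps].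

Record well_formed (eps : R) : Prop := WellFormed {
  wf_nagents : (0 < n)%N;
  wf_ndim : (0 < m)%N;
  wf_adj_sym : symmetric (fun i j => adj I i j);
  wf_adj_irr : irreflexive (fun i j => adj I i j);
  wf_connected : forall i j, connect (fun i j => adj I i j) i j;
  wf_dbar : 0 < dbar I < dmax%:R^-1;
  wf_controllable : controllable (mxA I) (mxB I);
  wf_hurwitz : hurwitz mxM;
  wf_cost : forall i, 0 <= cost I i 0;
  wf_budget : 0 <= budget I;
  wf_tc_gt0 : 0 < tc I;
  wf_tc : convergence_time eps < tc I;
  wf_continuous : forall i, {within `[0, tc I], continuous (strategy I i 0)};
  wf_integrable : forall i,
    mu.-integrable `[0, tc I] (EFin \o strategy I i 0) }.

Definition feasible (A : {set 'I_n}) : Prop :=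
  [/\ forall i t, 0 <= t <= tc I -> enorm (false_data A i t) <= ubar I,
      \sum_(i in A) cost I i 0 <= budget I
    & forall j, Rintegral mu `[0, tc I] (strategy I j 0) <= gbar I j 0].

Definition optimal (A : {set 'I_n}) : Prop :=
  feasible A /\ forall A', feasible A' -> objective A' <= objective A.

End Problem.

Section FreeState.
Variables (R : realType) (I : instance R (R -> R)).

Lemma free_state0 : free_state I 0 = x0 I.
Proof. by rewrite /free_state scale0r expmx0 mul1mx. Qed.

Lemma is_derive_free_state (t : R) k :
  is_derive t (1 : R) (fun s => free_state I s k 0)
    ((mxM I *m free_state I t) k 0).
Proof.
rewrite (_ : (fun s => _) =
  \sum_l (fun s => expmx (s *: mxM I) k l * x0 I l 0)); last first.
  by apply/funext => s; rewrite mxE fct_sumE.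
rewrite /free_state mulmxA mxE; apply: is_derive_sum => l.
have h := is_derive_expmx (mxM I) t k l.
by apply: is_derive_eq; rewrite scaler0 add0r mulrC.
Qed.

End FreeState.

(** * Finite presentation *)

(* Numbers are rational and the components of the attack strategy are
   polynomials in t with rational coefficients. *)
Notation rat_instance := (instance rat {poly rat}).

Definition real_instance (R : realType) (I : rat_instance) :
    instance R (R -> R) :=
  Instance (adj I) (map_mx ratr (mxA I)) (map_mx ratr (mxB I))
    (ratr (dbar I)) (map_mx ratr (x0 I)) (map_mx ratr (cost I))
    (ratr (budget I)) (ratr (ubar I)) (map_mx ratr (gbar I))
    (map_mx (fun (p : {poly rat}) (t : R) => (map_poly ratr p).[t])
       (strategy I))
    (ratr (tc I)).

Definition enc_bool (b : bool) : bits := [:: b].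

Definition enc_seq (T : Type) (e : T -> bits) (s : seq T) : bits :=
  flatten [seq true :: e x | x <- s] ++ [:: false].

(* Little-endian binary digits; 0 is written as the single digit 0. *)
Definition digits (k : nat) : bits :=
  [seq odd (k %/ 2 ^ i) | i <- iota 0 (trunc_log 2 k).+1].

Definition enc_nat (k : nat) : bits := enc_seq enc_bool (digits k).

Definition enc_int (z : int) : bits :=
  match z with Posz k => false :: enc_nat k | Negz k => true :: enc_nat k end.

Definition enc_rat (q : rat) : bits := enc_int (numq q) ++ enc_int (denq q).

Definition enc_poly (p : {poly rat}) : bits := enc_seq enc_rat p.

Definition enc_mx (T : Type) (e : T -> bits) (k l : nat) (X : 'M[T]_(k, l)) :
    bits :=
  flatten [seq flatten [seq e (X i j) | j <- enum 'I_l] | i <- enum 'I_k].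

Definition encode (I : rat_instance) : bits :=
  enc_nat (nagents I) ++ enc_nat (ndim I) ++ enc_mx enc_bool (adj I) ++
  enc_mx enc_rat (mxA I) ++ enc_mx enc_rat (mxB I) ++ enc_rat (dbar I) ++
  enc_mx enc_rat (x0 I) ++ enc_mx enc_rat (cost I) ++ enc_rat (budget I) ++
  enc_rat (ubar I) ++ enc_mx enc_rat (gbar I) ++
  enc_mx enc_poly (strategy I) ++ enc_rat (tc I).

Definition encode_set (k : nat) (A : {set 'I_k}) : bits :=
  [seq i \in A | i <- enum 'I_k].

Definition prefix_free (T : Type) (e : T -> bits) : Prop :=
  forall x y s t, e x ++ s = e y ++ t -> x = y /\ s = t.

Lemma prefix_free_bool : prefix_free enc_bool.
Proof. by move=> x y s t [-> ->]. Qed.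

Lemma prefix_free_seq (T : Type) (e : T -> bits) :
  prefix_free e -> prefix_free (enc_seq e).
Proof.
move=> eP; elim=> [|x u IH] [|y v] s t //=; first by case.
rewrite /enc_seq/= -!catA => -[] /eP[-> h].
by have := IH v s t; rewrite /enc_seq -!catA => /(_ h)[-> ->].
Qed.

Lemma digits_inj : injective digits.
Proof.
move=> a b ab.
have sz : trunc_log 2 a = trunc_log 2 b.
  by have /(congr1 size) := ab; rewrite !size_map !size_iota => -[].
have bit i : (i <= trunc_log 2 a)%N -> odd (a %/ 2 ^ i)%N = odd (b %/ 2 ^ i)%N.
  move=> ia; have /(congr1 (nth false ^~ i)) := ab.
  by rewrite !(nth_map 0%N) ?size_iota -?sz ?ltnS// !nth_iota ?ltnS.
have small k : (k < 2 ^ (trunc_log 2 k).+1)%N by apply: trunc_log_ltn.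
suff E j : (j <= (trunc_log 2 a).+1)%N ->
    (a %/ 2 ^ ((trunc_log 2 a).+1 - j) = b %/ 2 ^ ((trunc_log 2 a).+1 - j))%N.
  by have := E _ (leqnn _); rewrite subnn expn0 !divn1.
elim: j => [_|j IH ja]; first by rewrite subn0 !divn_small// sz small.
have [i ia] : exists i, ((trunc_log 2 a).+1 - j = i.+1)%N.
  by exists ((trunc_log 2 a).+1 - j).-1%N; rewrite prednK// subn_gt0.
rewrite subnS ia/= -[LHS]odd_double_half -[RHS]odd_double_half.
have := IH (ltnW ja); rewrite ia expnSr !divnMA !divn2 => ->.
by rewrite bit// -ltnS -ia leq_subr.
Qed.

Lemma prefix_free_nat : prefix_free enc_nat.
Proof.
by move=> a b s t /(prefix_free_seq prefix_free_bool)[/digits_inj -> ->].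
Qed.

Lemma prefix_free_int : prefix_free enc_int.
Proof. by move=> [a|a] [b|b] s t // /(congr1 behead)/prefix_free_nat[-> ->]. Qed.

Lemma prefix_free_rat : prefix_free enc_rat.
Proof.
move=> a b s t; rewrite /enc_rat -!catA.
move=> /prefix_free_int[nE] /prefix_free_int[dE ->]; split=> //.
by rewrite -[a]divq_num_den -[b]divq_num_den nE dE.
Qed.

Lemma prefix_free_poly : prefix_free enc_poly.
Proof.
by move=> p q s t /(prefix_free_seq prefix_free_rat)[pq ->]; split=> //;
  exact: val_inj.
Qed.

Lemma prefix_free_mx (T : Type) (e : T -> bits) k l :
  prefix_free e -> prefix_free (@enc_mx T e k l).
Proof.
move=> eP X Y s t.
have famE (J : eqType) (d d' : J -> bits) (r : seq J) (Q : J -> Prop) :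
    (forall j u v, d j ++ u = d' j ++ v -> Q j /\ u = v) ->
    forall u v, flatten (map d r) ++ u = flatten (map d' r) ++ v ->
      (forall j, j \in r -> Q j) /\ u = v.
  move=> dP; elim: r => //= j r IH u v; rewrite -!catA => /dP[Qj] /IH[Qr ->].
  by split=> // i; rewrite inE => /predU1P[->|/Qr].
move=> /(famE _ _ _ _ (fun i => forall j, X i j = Y i j))[].
  move=> i u v /(famE _ _ _ _ (fun j => X i j = Y i j))[].
    by move=> j u' v' /eP.
  by move=> XY ->; split=> // j; apply: XY; rewrite mem_enum.
by move=> XY ->; split=> //; apply/matrixP => i j; apply: XY; rewrite mem_enum.
Qed.

Lemma encode_inj : injective encode.
Proof.
case=> n m ad A B d x c Om ub gb th T [n' m' ad' A' B' d' x' c' Om' ub' gb' th' T'].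
rewrite /encode/= => /prefix_free_nat[En]; move: ad' x' c'; rewrite -{n'}En.
move=> ad' x' c' /prefix_free_nat[Em]; move: A' B' x' gb' th'; rewrite -{m'}Em.
move=> A' B' x' gb' th' /(prefix_free_mx prefix_free_bool)[->].
do 2!move=> /(prefix_free_mx prefix_free_rat)[->].
move=> /prefix_free_rat[->].
do 2!move=> /(prefix_free_mx prefix_free_rat)[->].
do 2!move=> /prefix_free_rat[->].
move=> /(prefix_free_mx prefix_free_rat)[->].
move=> /(prefix_free_mx prefix_free_poly)[->].
by rewrite -[enc_rat T]cats0 -[enc_rat T']cats0 => /prefix_free_rat[->].
Qed.

Lemma encode_set_inj k : injective (@encode_set k).
Proof.
move=> A B /eq_in_map AB; apply/setP => i.
by apply: AB; rewrite mem_enum.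
Qed.

(* Given a well-formed instance, find an optimal set of compromised agents. *)
Definition attack_placement (R : realType) (eps : R) : search_problem :=
  fun w y => exists I : rat_instance,
    [/\ w = encode I, well_formed (real_instance R I) eps
      & exists2 A : {set 'I_(nagents I)},
          y = encode_set A & optimal (I := real_instance R I) A].

(* Main.v *)
(* Cook-Levin, with the tableau encoded directly as a placement problem.

   Fix a nondeterministic machine M deciding L in time p.  A run of M on w is
   written as an H x H grid of cells (H > p(|w|)), one row per time step; since
   tapes are centred at the heads, all constraints relate equal or adjacent
   rows and columns.  A pair (position, possible cell) is a vertex, conflicting
   pairs are edges, and runs are the independent sets with one vertex per
   position.  One extra vertex, the escape, may replace the final cell, so that
   such a set always exists; M accepts iff there is one avoiding the escape.

   Each vertex is doubled by a filler, too expensive to be compromised, which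
   is adjacent to exactly the vertices the original is not adjacent to.  This
   makes all degrees equal, except that the escape is given one neighbour less.
   With cost 1 per vertex and budget H^2, optimal placements A maximize |A|,
   then the number of edges leaving A: this is the second order term of the
   convergence error, because for M = - alpha I + gamma L with tiny alpha and
   gamma,
     |int_0^1 exp(sM) chi_A ds|^2 = |A| + <chi_A, M chi_A> + O(|M|^2).
   So an optimal A is an independent set with H^2 vertices, and contains the
   escape, which is agent 0, iff M rejects w: one query decides L. *)
Require Import Defs.
From mathcomp Require Import all_boot all_order all_algebra.
From mathcomp Require Import all_classical all_reals all_analysis.
From HB Require Import structures.
From mathcomp Require Import mxtens complex.
From mathcomp Require Import zify ring lra.
Import Defs.

Set Implicit Arguments.
Unset Strict Implicit.
Unset Printing Implicit Defensive.

Local Open Scope nat_scope.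

(** * Stack programs and their Turing machines *)

(** Hardness needs an actual deterministic machine that writes the instance in polynomial time.
    Tapes are handled once, by a compiler for a small stack language; above it sits a language of
    emitters whose only loops run over a register, so that a time bound follows by recursion on the
    syntax. The simulated machine is fixed, so its cell alphabet and conflict table are constants of
    the emitter; the input enters only through its length and through lookups of single symbols.

    The oracle returns a set and not its value, so the optimal cardinality must be the same whether
    or not the machine accepts; the escape achieves this and leaves the decision in one bit.

    Independence and avoidance of the escape are both enforced by the second order term. An edge
    inside [A] costs 2 there and the missing neighbour of the escape costs 1, so the latter only
    breaks ties between independent sets.

    Three scales must separate: [n ^ 2 * gamma] lies below [alpha], which makes the system Hurwitz
    and puts cardinality first, and [n ^ 6 * alpha ^ 2] lies below [gamma]. Powers of two with
    exponents linear in [n] do this and still have short encodings. *)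

Definition stacks := nat -> bits.

Definition upd (s : stacks) (i : nat) (x : bits) : stacks :=
  fun j => if j == i then x else s j.

Inductive cmd :=
| Skip
| Push of nat & bool
| Pop of nat
| Seq of cmd & cmd
| Case of nat & cmd & cmd & cmd
| While of nat & cmd.

(* [exec c s t s']: from [s], [c] ends in [s'] after at most [t] steps. *)
Inductive exec : cmd -> stacks -> nat -> stacks -> Prop :=
| ExecLe c s t u s' : exec c s t s' -> t <= u -> exec c s u s'
| ExecSkip s : exec Skip s 0 s
| ExecPush i b s : exec (Push i b) s 2 (upd s i (b :: s i))
| ExecPop i s : exec (Pop i) s 1 (upd s i (behead (s i)))
| ExecSeq c d s1 s2 s3 t u :
    exec c s1 t s2 -> exec d s2 u s3 -> exec (Seq c d) s1 (t + u) s3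
| ExecCase i c0 c1 c2 s t s' :
    exec (if s i is b :: _ then if b then c2 else c1 else c0) s t s' ->
    exec (Case i c0 c1 c2) s t.+2 s'
| ExecWhileNil i c s : s i = [::] -> exec (While i c) s 1 s
| ExecWhileCons i c s1 s2 s3 t u :
    s1 i != [::] -> exec c s1 t s2 -> exec (While i c) s2 u s3 ->
    exec (While i c) s1 (t + u).+2 s3.

Fixpoint maxreg (c : cmd) : nat :=
  match c with
  | Skip => 0
  | Push i _ | Pop i => i
  | Seq c d => maxn (maxreg c) (maxreg d)
  | Case i c0 c1 c2 =>
      maxn i (maxn (maxreg c0) (maxn (maxreg c1) (maxreg c2)))
  | While i c => maxn i (maxreg c)
  end.

Variant instr :=
| IMove of nat & option symbol & move
| IJump of nat & nat & nat & nat
| IAsk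
| IHalt of bool.

Fixpoint len (c : cmd) : nat :=
  match c with
  | Skip => 0
  | Push _ _ => 2
  | Pop _ => 1
  | Seq c d => len c + len d
  | Case _ c0 c1 c2 => len c0 + len c1 + len c2 + 3
  | While _ c => (len c).+2
  end.

(** [b] is the absolute address of the first instruction. A jump with three equal targets is
    unconditional; the last branch of [Case] falls through to the common exit. *)
Fixpoint compile (c : cmd) (b : nat) : seq instr :=
  match c with
  | Skip => [::]
  | Push i x => [:: IMove i None MoveL; IMove i (Some (Some x)) Stay]
  | Pop i => [:: IMove i (Some None) MoveR]
  | Seq c d => compile c b ++ compile d (b + len c)
  | Case i c0 c1 c2 =>
      let e := b + len (Case i c0 c1 c2) in
      let b1 := b + len c0 + 2 in
      let b2 := b1 + len c1 + 1 in
      IJump i b.+1 b1 b2 :: compile c0 b.+1 ++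
      IJump 0 e e e :: compile c1 b1 ++
      IJump 0 e e e :: compile c2 b2
  | While i c =>
      IJump i (b + (len c).+2) b.+1 b.+1 :: compile c b.+1 ++ [:: IJump 0 b b b]
  end.

Lemma size_compile c b : size (compile c b) = len c.
Proof.
elim: c b => //= [c IHc d IHd|i c0 IH0 c1 IH1 c2 IH2|i c IH] b;
  rewrite ?size_cat /= ?size_cat /= ?IHc ?IHd ?IH0 ?IH1 ?IH2 ?IH /=; lia.
Qed.

(** * The machine of an instruction list, and correctness of the compiler *)

Section Machine.
Variables (code : seq instr) (R : nat) (R_gt0 : 0 < R).

Let st := 'I_(size code).+1.
Let k := R.+2.

(* Stack 1 lives on the oracle tape, which is the last one. *)
Definition tp (i : nat) : 'I_k := if i == 1 then ord_max else inord i.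

Lemma tp_inj i j : i <= R -> j <= R -> tp i = tp j -> i = j.
Proof.
rewrite /tp => iR jR; case: eqVneq => [->|i1]; case: eqVneq => [->|j1] //;
  move/(congr1 val) => /=; rewrite ?inordK /k; lia.
Qed.

Definition at_pc (q : st) : instr := nth (IHalt false) code q.

Definition stay (r : {ffun 'I_k -> symbol}) : {ffun 'I_k -> symbol * move} :=
  [ffun j => (r j, Stay)].

Definition code_delta (q : st) (r : {ffun 'I_k -> symbol}) :
    seq (st * {ffun 'I_k -> symbol * move}) :=
  match at_pc q with
  | IMove i w d =>
      [:: (inord q.+1, [ffun j => if j == tp i then (odflt (r j) w, d)
                                  else (r j, Stay)])]
  | IJump i l0 l1 l2 =>
      [:: (inord (if r (tp i) is Some b then if b then l2 else l1 else l0),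
           stay r)]
  | _ => [::]
  end.

Definition code_machine : machine :=
  @Machine R st ord0 (fun q => if at_pc q is IHalt b then b else false)
    (fun q => if at_pc q is IAsk then Some (inord q.+1) else None) code_delta.

Lemma code_machine_det : deterministic code_machine.
Proof. by move=> q r /=; rewrite /code_delta; case: at_pc. Qed.

Variable orc : bits -> bits.
Implicit Types (c : config code_machine) (s : stacks).

(** The head is on the top of the stack. Visited blank cells stay in the lists, so any number of
    blanks is tolerated on both sides. *)
Definition rep_tape (t : tape) (x : bits) : Prop :=
  nseq (size (lft t)) None = lft t /\
  exists m, rgt t = map some x ++ nseq m None.

Definition rep (ts : {ffun 'I_k -> tape}) s : Prop :=
  forall i, i <= R -> rep_tape (ts (tp i)) (s i).

Fixpoint steps (n : nat) c c' : Prop :=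
  if n is n'.+1 then exists2 c1, next orc c = [:: c1] & steps n' c1 c'
  else c = c'.

Lemma steps_add n m c1 c2 c3 :
  steps n c1 c2 -> steps m c2 c3 -> steps (n + m) c1 c3.
Proof.
elim: n c1 => [|n IH] c1 /=; first by move=> ->.
by move=> [c nx sc] sm; exists c => //; apply: IH.
Qed.

(** Every [next] along the chain is a singleton, so one run settles both halting and acceptance, for
    every larger time bound as well. *)
Lemma steps_halt n m c c' :
  steps n c c' -> nilp (next orc c') -> n <= m ->
  halts_within orc m c /\ accepts_within orc m c = accepting (cstate c').
Proof.
elim: n m c => [|n IH] [|m] c //=.
- by move=> -> nl _; rewrite nl orbF.
- move=> -> nl _; move: (nl) => /nilP ->/=.
  by rewrite orbF.
- move=> [c1 nx sc] nl nm; rewrite nx /= andbT orbF.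
  exact: IH.
Qed.

Definition pc c : nat := cstate c : st.

Lemma read_rep t x : rep_tape t x -> read t = ohead x.
Proof.
by case=> _ [m]; rewrite /read => ->; case: x => //=; case: m.
Qed.

Lemma rep_stay t x : rep_tape t x -> rep_tape (shift Stay (write (read t) t)) x.
Proof.
case=> l [m e]; split=> //; rewrite /write/= /read e.
case: x {e} => [|b x] /=; last by exists m.
by case: m => [|m]; [exists 1|exists m.+1].
Qed.

Lemma act_stay ts s : rep ts s -> rep (act (stay [ffun i => read (ts i)]) ts) s.
Proof. by move=> rs i iR; rewrite !ffunE/=; apply/rep_stay/rs. Qed.

Definition code_at (b : nat) (l : seq instr) : Prop :=
  take (size l) (drop b code) = l.

Lemma code_at_cat b l1 l2 :
  code_at b (l1 ++ l2) <-> code_at b l1 /\ code_at (b + size l1) l2.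
Proof.
rewrite /code_at addnC -drop_drop; set C := drop b code; split.
  move=> h; split; last first.
    have /(congr1 (drop (size l1))) := h.
    by rewrite drop_size_cat// size_cat take_drop addnC.
  have /(congr1 (take (size l1))) := h.
  by rewrite take_size_cat// size_cat take_takel// leq_addr.
by case=> h1 h2; rewrite size_cat takeD h1 h2.
Qed.

Lemma code_at_cons b x l :
  code_at b (x :: l) <->
  (b < size code /\ nth (IHalt false) code b = x) /\ code_at b.+1 l.
Proof.
rewrite -[x :: l]cat1s code_at_cat /= addn1; split=> -[h1 h2]; split=> //.
  move: h1; rewrite /code_at /=; have [bs|bs] := ltnP b (size code).
    by rewrite (drop_nth (IHalt false) bs) /= take0 => -[->].
  by rewrite drop_oversize.
by case: h1 => bs e; rewrite /code_at (drop_nth (IHalt false) bs) /= take0 e.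
Qed.

Lemma step_jump c s i l0 l1 l2 :
  rep (ctapes c) s -> at_pc (cstate c) = IJump i l0 l1 l2 -> i <= R ->
  l0 <= size code -> l1 <= size code -> l2 <= size code ->
  exists c', [/\ steps 1 c c',
    pc c' = (if s i is b :: _ then if b then l2 else l1 else l0)
    & rep (ctapes c') s].
Proof.
move=> rs ci iR h0 h1 h2.
exists (Config (M := code_machine) (inord (if s i is b :: _ then if b then l2 else l1 else l0) : st)
   (act (stay [ffun i => read (ctapes c i)]) (ctapes c))).
split; last exact: act_stay.
  exists (Config (M := code_machine) (inord (if s i is b :: _ then if b then l2 else l1 else l0) : st)
     (act (stay [ffun i => read (ctapes c i)]) (ctapes c))) => //.
  rewrite /next /= ci /code_delta ci /= ffunE (read_rep (rs _ iR)).
  by case: (s i) => [|[] ?].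
by rewrite /pc /= inordK//; case: (s i) => [|[] ?]; rewrite ltnS.
Qed.

Lemma step_move c i w d :
  at_pc (cstate c) = IMove i w d -> pc c < size code ->
  exists c', [/\ steps 1 c c', pc c' = (pc c).+1
    & forall j, ctapes c' j =
        if j == tp i then shift d (write (odflt (read (ctapes c j)) w) (ctapes c j))
        else shift Stay (write (read (ctapes c j)) (ctapes c j))].
Proof.
move=> ci pcs.
exists (Config (M := code_machine) (inord (pc c).+1 : st)
   (act [ffun j => if j == tp i then (odflt (read (ctapes c j)) w, d)
                   else (read (ctapes c j), Stay)] (ctapes c))).
split.
- eexists; last reflexivity.
  rewrite /next /= ci /code_delta ci /=; congr [:: Config _ _].
  by apply/ffunP => j; rewrite !ffunE; case: ifP.
- by rewrite /pc /= inordK// ltnS.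
- by move=> j; rewrite /= !ffunE; case: ifP.
Qed.

(** An action writes before it moves, so a push takes two: move left while rewriting the old top,
    then write the new one. *)
Lemma step_push c s i b :
  rep (ctapes c) s -> i <= R ->
  code_at (pc c) [:: IMove i None MoveL; IMove i (Some (Some b)) Stay] ->
  exists c', [/\ steps 2 c c', pc c' = pc c + 2
    & rep (ctapes c') (upd s i (b :: s i))].
Proof.
move=> rs iR /code_at_cons[[p1 e1]] /code_at_cons[[p2 e2] _].
have [c1 [s1 q1 t1]] := step_move e1 p1.
rewrite -q1 in p2 e2.
have [c2 [s2 q2 t2]] := step_move e2 p2.
exists c2; split; first exact: (steps_add s1 s2).
  by rewrite q2 q1 addn2.
move=> j jR; rewrite t2 t1 /upd.
have [->|ji] := eqVneq j i.
  rewrite !eqxx /=; have [l [m e]] := rs _ iR.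
  rewrite /rep_tape /= e; split; last first.
    rewrite (read_rep (rs _ iR)); case: (s i) {e} => [|x y] /=; last by exists m.
    by case: m => [|m]; [exists 1|exists m.+1].
  by rewrite -l; case: (size (lft _)) => [|n] /=; rewrite ?size_nseq.
have -> : tp j == tp i = false.
  by apply/negP => /eqP /(tp_inj jR iR) /eqP; apply/negP.
by do 2!apply: rep_stay; apply: rs.
Qed.

Lemma step_pop c s i :
  rep (ctapes c) s -> i <= R ->
  code_at (pc c) [:: IMove i (Some None) MoveR] ->
  exists c', [/\ steps 1 c c', pc c' = pc c + 1
    & rep (ctapes c') (upd s i (behead (s i)))].
Proof.
move=> rs iR /code_at_cons[[p1 e1] _].
have [c1 [s1 q1 t1]] := step_move e1 p1.
exists c1; split=> //; first by rewrite q1 addn1.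
move=> j jR; rewrite t1 /upd.
have [->|ji] := eqVneq j i.
  rewrite !eqxx /=; have [l [m e]] := rs _ iR.
  rewrite /rep_tape /= e; split; first by rewrite l.
  by case: (s i) => [|x y] /=; [exists m.-1; case: m {e}|exists m].
have -> : tp j == tp i = false.
  by apply/negP => /eqP /(tp_inj jR iR) /eqP; apply/negP.
by apply: rep_stay; apply: rs.
Qed.

Lemma code_at_le b l : code_at b l -> 0 < size l -> b + size l <= size code.
Proof.
rewrite /code_at => /(congr1 size); rewrite size_take size_drop.
case: ifP => h e; case: l h e => //= x l; lia.
Qed.

Lemma code_at_head b x l (q : st) :
  code_at b (x :: l) -> q = b :> nat -> at_pc q = x.
Proof. by move=> /code_at_cons[[_ <-] _] <-. Qed.

(** Induction on the derivation of [exec] rather than on the command, so that the remaining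
    iterations of a loop come with a hypothesis of their own. *)
Lemma compile_correct (c : cmd) s t s' :
  exec c s t s' -> maxreg c <= R -> forall x : config code_machine,
  code_at (pc x) (compile c (pc x)) -> rep (ctapes x) s ->
  exists n x', [/\ n <= t, steps n x x', pc x' = pc x + len c
    & rep (ctapes x') s'].
Proof.
elim=> {c s t s'}.
- move=> c s t u s' _ IH tu cR x cx rx.
  have [n [x' [nt sx px rx']]] := IH cR x cx rx.
  by exists n, x'; split=> //; apply: leq_trans tu.
- by move=> s _ x _ rx; exists 0, x; rewrite addn0.
- move=> i b s iR x cx rx.
  by have [x' [sx px rx']] := step_push rx iR cx; exists 2, x'.
- move=> i s iR x cx rx.
  by have [x' [sx px rx']] := step_pop rx iR cx; exists 1, x'.
- move=> c d s1 s2 s3 t u _ IHc _ IHd /=; rewrite geq_max => /andP[cR dR] x.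
  move=> /code_at_cat[emit_cmd cd] rx.
  have [n [y [nt sy py ry]]] := IHc cR x emit_cmd rx.
  rewrite size_compile -py in cd.
  have [m [z [mu sz pz rz]]] := IHd dR y cd ry.
  exists (n + m), z; split=> //; first exact: leq_add.
    exact: steps_add sz.
  by rewrite pz py addnA.
- move=> i c0 c1 c2 s t s' _ IH /=.
  rewrite !geq_max => /andP[iR /and3P[R0 R1 R2]] x cx rx.
  have sz : pc x + (len c0 + len c1 + len c2 + 3) <= size code.
    move/code_at_le: cx => /(_ isT); apply: leq_trans.
    rewrite /= !size_cat /= !size_cat /= !size_compile; lia.
  have ex := code_at_head cx (erefl _).
  case/code_at_cons: cx => _ /code_at_cat[cc0] /code_at_cons[[_ j0]].
  move=> /code_at_cat[cc1] /code_at_cons[[_ j1] cc2].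
  rewrite !size_compile (_ : ((pc x).+1 + len c0).+1 = pc x + len c0 + 2)
    in j0 cc1 cc2 j1; last lia.
  rewrite -[(pc x + len c0 + 2 + len c1).+1]addn1 in cc2.
  have [|||y [sy py ry]] := step_jump rx ex iR; try lia.
  set e := pc x + (len c0 + len c1 + len c2 + 3) in j0 j1.
  have final (z : config code_machine) : rep (ctapes z) s' ->
      nth (IHalt false) code (pc z) = IJump 0 e e e ->
      exists z', [/\ steps 1 z z', pc z' = e & rep (ctapes z') s'].
    move=> rz ez; have [] := step_jump rz ez => // z' [sz' pz' rz'].
    by exists z'; split=> //; rewrite pz'; case: (s' 0) => [|[]].
  move: IH py; case: (s i) => [|[] l] IH py.
  + have := IH R0 y; rewrite py => /(_ cc0 ry) [n [z [nt sz' pz rz]]].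
    have [|z' [sz'' pz' rz']] := final z rz.
      by rewrite pz -j0; congr (nth _ _ _); lia.
    exists (1 + n + 1), z'; split=> //; first lia.
    by do 2?apply: steps_add; eauto.
  + have := IH R2 y; rewrite py.
    move=> /(_ cc2 ry) [n [z [nt sz' pz rz]]].
    exists (1 + n), z; split=> //; [lia|exact: steps_add sz'|].
    rewrite pz /e; lia.
  + have := IH R1 y; rewrite py.
    move=> /(_ cc1 ry) [n [z [nt sz' pz rz]]].
    have [|z' [sz'' pz' rz']] := final z rz; first by rewrite pz.
    exists (1 + n + 1), z'; split=> //; first lia.
    by do 2?apply: steps_add; eauto.
- move=> i c s si /=; rewrite geq_max => /andP[iR cR] x cx rx.
  have sz : pc x + (len c).+2 <= size code.
    move/code_at_le: cx => /(_ isT); apply: leq_trans.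
    rewrite /= !size_cat /= !size_compile; lia.
  have ex := code_at_head cx (erefl _).
  have [|||y [sy py ry]] := step_jump rx ex iR; try lia.
  by exists 1, y; split=> //; rewrite py si.
- move=> i c s1 s2 s3 t u si _ IHc _ IHw /=; rewrite geq_max => /andP[iR cR] x cx rx.
  have sz : pc x + (len c).+2 <= size code.
    move/code_at_le: cx => /(_ isT); apply: leq_trans.
    rewrite /= !size_cat /= !size_compile; lia.
  have ex := code_at_head cx (erefl _).
  have [|||y [sy py ry]] := step_jump rx ex iR; try lia.
  have {}py : pc y = (pc x).+1 by rewrite py; case: (s1 i) si => [|[]].
  have /code_at_cons[_ /code_at_cat[emit_cmd /code_at_cons[[_ jb] _]]] := cx.
  rewrite -py size_compile in emit_cmd jb.
  have [n [z [nt sz' pz rz]]] := IHc cR y emit_cmd ry.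
  rewrite -pz in jb.
  have [||||x' [sx px' rx']] := step_jump rz jb; try lia.
  have {}px' : pc x' = pc x by rewrite px'; case: (s2 0) => [|[]].
  have := IHw _ x'; rewrite px' /= geq_max iR cR => /(_ isT cx rx').
  move=> [m [v [mu sv pv rv]]].
  exists (1 + n + (1 + m)), v; split=> //; first lia.
  by do 3?apply: steps_add; eauto.
Qed.

End Machine.

(** * Unary and binary arithmetic on stacks *)

Definition drain (i j : nat) : cmd := While i (Seq (Pop i) (Push j true)).

Definition clear (i : nat) : cmd := While i (Pop i).

(** Reading a stack destroys it: the unary number passes through scratch stack 2 and is rebuilt on
    both [a] and [b]. *)
Definition copy (a b : nat) : cmd :=
  Seq (drain a 2) (While 2 (Seq (Pop 2) (Seq (Push a true) (Push b true)))).

Fixpoint pushes (i : nat) (l : bits) : cmd :=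
  if l is b :: l' then Seq (Push i b) (pushes i l') else Skip.

Lemma exec_eq c s t u s1 s2 :
  exec c s t s1 -> t <= u -> s1 =1 s2 -> exec c s u s2.
Proof. by move=> ex tu /funext <-; apply: ExecLe tu. Qed.

Lemma exec_eql c s0 s t s1 : s0 =1 s -> exec c s0 t s1 -> exec c s t s1.
Proof. by move=> /funext ->. Qed.

Ltac upd_tac :=
  let j := fresh in intro j; rewrite /upd /=;
  repeat (case: eqVneq => ? //=); subst;
  rewrite ?cats0 //=; try congruence; try lia.

Lemma nseq_rcons (n : nat) (x : bits) :
  nseq n true ++ true :: x = nseq n.+1 true ++ x.
Proof. by elim: n => //= n ->. Qed.

Lemma exec_drain i j s n : i != j -> s i = nseq n true ->
  exec (drain i j) s (5 * n + 1) (upd (upd s i [::]) j (nseq n true ++ s j)).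
Proof.
elim: n s => [|n IH] s ij si.
  apply: exec_eq (ExecWhileNil _ _) _ _ => //; by upd_tac.
apply: exec_eq.
- apply: ExecWhileCons; first by rewrite si.
    by apply: ExecSeq; [apply: ExecPop|apply: ExecPush].
  by apply: IH => //; rewrite /upd (negPf ij) eqxx si.
- lia.
- move=> k; rewrite /upd eqxx (eq_sym j i) (negPf ij) /= nseq_rcons.
  by case: eqVneq => // kj; case: eqVneq.
Qed.

Lemma exec_clear i s : exec (clear i) s (3 * size (s i) + 1) (upd s i [::]).
Proof.
move e: (s i) => x; elim: x s e => [|b x IH] s e.
  by apply: exec_eq (ExecWhileNil _ _) _ _ => //; upd_tac.
apply: exec_eq.
- apply: ExecWhileCons; [by rewrite e|exact: ExecPop|].
  by apply: IH; rewrite /upd eqxx e.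
- by rewrite /=; lia.
- by upd_tac.
Qed.

Lemma exec_copy a b s n : a != 2 -> b != 2 -> a != b -> s 2 = [::] ->
  s a = nseq n true ->
  exec (copy a b) s (12 * n + 2) (upd s b (nseq n true ++ s b)).
Proof.
move=> a2 b2 ab s2 sa.
have loop m s' : s' 2 = nseq m true ->
    exec (While 2 (Seq (Pop 2) (Seq (Push a true) (Push b true)))) s' (7 * m + 1)
      (upd (upd (upd s' 2 [::]) a (nseq m true ++ s' a)) b (nseq m true ++ s' b)).
  elim: m s' => [|m IH] s' e.
    by apply: exec_eq (ExecWhileNil _ _) _ _ => //; upd_tac.
  apply: exec_eq.
  - apply: ExecWhileCons; first by rewrite e.
      by apply: ExecSeq; [exact: ExecPop|apply: ExecSeq; exact: ExecPush].
    by apply: IH; rewrite /upd /= 2!(eq_sym 2) (negPf a2) (negPf b2) e.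
  - lia.
  - move=> k; rewrite /upd !eqxx (negPf a2) (negPf b2) (negPf ab) (eq_sym b a).
    rewrite (negPf ab) !nseq_rcons.
    by case: eqVneq => // kb; case: eqVneq => // ka; case: eqVneq.
apply: exec_eq.
- apply: ExecSeq; first exact: (exec_drain a2 sa).
  by apply: (loop n); rewrite /upd /= s2 cats0.
- lia.
- move=> k; rewrite /upd !eqxx (negPf a2) (negPf b2) (eq_sym b a) (negPf ab).
  rewrite cats0; case: eqVneq => // kb; case: eqVneq => [->|ka] //.
  by case: eqVneq => // ->.
Qed.

Lemma exec_pushes i l s :
  exec (pushes i l) s (2 * size l) (upd s i (rev l ++ s i)).
Proof.
elim: l s => [|b l IH] s.
  by apply: exec_eq (ExecSkip _) _ _ => //; upd_tac.
apply: exec_eq; first by apply: ExecSeq; [exact: ExecPush|exact: IH].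
- by rewrite /=; lia.
- move=> k; rewrite /upd eqxx rev_cons cat_rcons.
  by case: eqVneq.
Qed.

(* Stacks 2 to 7 are scratch and empty between commands; register [a] of the
   environment is kept in unary on stack [8 + a]. *)
Definition store (rho : seq nat) (w o : bits) : stacks := fun j =>
  if j == 0 then w else if j == 1 then o else if j < 8 then [::]
  else nseq (nth 0 rho (j - 8)) true.

Lemma store_reg rho w o a : store rho w o (8 + a) = nseq (nth 0 rho a) true.
Proof. by rewrite /store addKn. Qed.

Lemma store_rcons rho w o n :
  store (rcons rho n) w o = upd (store rho w o) (8 + size rho) (nseq n true).
Proof.
apply/funext => j; rewrite /store /upd nth_rcons.
case: eqVneq => [->|j0]; first by case: eqVneq => //; lia.
case: eqVneq => [->|j1]; first by case: eqVneq => //; lia.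
case: ltnP => j8; first by case: eqVneq => //; lia.
case: (eqVneq j (8 + size rho)) => [->|jr]; first by rewrite addKn ltnn eqxx.
case: ltnP => // jr'; rewrite nth_default//.
by case: eqVneq => // h; lia.
Qed.

(** Consumes the unary number on stack 3, leaving its half on stack 4 and its parity on stack 5. *)
Definition halve_loop : cmd :=
  While 3 (Seq (Pop 3) (Case 3 (Push 5 true) (Seq (Pop 3) (Push 4 true))
                                (Seq (Pop 3) (Push 4 true)))).

Definition digit_loop : cmd :=
  While 3 (Seq halve_loop
    (Seq (Case 5 (Push 6 false) Skip (Seq (Pop 5) (Push 6 true)))
         (drain 4 3))).

Definition digit_out : cmd :=
  While 6 (Case 6 Skip (Seq (Pop 6) (pushes 1 [:: false; true]))
                       (Seq (Pop 6) (pushes 1 [:: true; true]))).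

(** Differs from [digits] only at 0, which gets no digit; this matches a halving loop that stops at
    0. *)
Definition bin (k : nat) : bits :=
  [seq odd (k %/ 2 ^ i) | i <- iota 0 (if k == 0 then 0 else (trunc_log 2 k).+1)].

Lemma bin_digits k : 0 < k -> bin k = digits k.
Proof. by case: k. Qed.

Lemma binE k : 0 < k -> bin k = odd k :: bin k./2.
Proof.
move=> k0; rewrite /bin gtn_eqF //= divn1; congr (_ :: _).
have [k1|k1] := leqP k 1.
  have -> : k = 1 by lia.
  by rewrite trunc_log1.
have -> : k./2 == 0 = false by rewrite -divn2; lia.
have -> : trunc_log 2 k = (trunc_log 2 k./2).+1 by rewrite trunc_log2S.
rewrite -[1]addn0 iotaDl -map_comp; apply: eq_map => i /=.
by rewrite add1n expnS divnMA divn2.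
Qed.

Lemma exec_halve n s : s 3 = nseq n true ->
  exec halve_loop s (10 * n + 1)
    (upd (upd (upd s 3 [::]) 4 (nseq n./2 true ++ s 4)) 5
       (nseq (odd n) true ++ s 5)).
Proof.
have [m nm] := ubnP n; elim: m n nm s => // m IH [|[|n]] nm s s3.
- by apply: exec_eq (ExecWhileNil _ _) _ _ => //; upd_tac.
- apply: exec_eq.
  + apply: ExecWhileCons; first by rewrite s3.
      apply: ExecSeq; first exact: ExecPop.
      by apply: ExecCase; rewrite {1}/upd /= s3 /=; exact: ExecPush.
    by apply: ExecWhileNil; rewrite /upd /= ?s3.
  + by [].
  + by rewrite ?s3; upd_tac.
- apply: exec_eq.
  + apply: ExecWhileCons; first by rewrite s3.
      apply: ExecSeq; first exact: ExecPop.
      apply: ExecCase; rewrite {1}/upd /= s3 /=.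
      by apply: ExecSeq; [exact: ExecPop|exact: ExecPush].
    by apply: (IH n); [lia|rewrite /upd /= ?s3].
  + lia.
  + move=> j; rewrite /upd /= negbK nseq_rcons.
    by do 3!case: eqVneq => //= ?.
Qed.

(** Digits are found least significant first, so the most significant one ends on top of stack 6.
    Moving them to the output stack restores the little-endian order. *)
Lemma exec_digits n s : s 3 = nseq n true -> s 4 = [::] -> s 5 = [::] ->
  exec digit_loop s (n * (20 * n + 20) + 1)
    (upd (upd s 3 [::]) 6 (rev (bin n) ++ s 6)).
Proof.
have [m nm] := ubnP n; elim: m n nm s => // m IH [|n] nm s s3 s4 s5.
- by apply: exec_eq (ExecWhileNil _ _) _ _ => //; upd_tac.
- have nn : n.+1./2 <= n by rewrite -divn2; lia.
  apply: exec_eq.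
  + apply: ExecWhileCons; first by rewrite s3.
      apply: ExecSeq; first exact: (exec_halve s3).
      apply: ExecSeq.
        apply: (@ExecCase _ _ _ _ _ 3 (upd (upd (upd s 3 [::]) 4 (nseq n.+1./2 true)) 6 (odd n.+1 :: s 6))).
        rewrite {1}/upd eqxx s5 cats0.
        case: (odd n.+1) => /=.
          apply: exec_eq; first by apply: ExecSeq; [exact: ExecPop|exact: ExecPush].
            by [].
          rewrite ?s4 ?s5; upd_tac.
        apply: exec_eq; first exact: ExecPush.
          by [].
        rewrite ?s4 ?s5; upd_tac.
      by apply: (@exec_drain 4 3 _ n.+1./2); rewrite /upd //=.
    apply: (IH n.+1./2); rewrite /upd ?cats0 //=; lia.
  + have : n.+1./2 * (20 * n.+1./2 + 20) <= n * (20 * n + 20).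
      by apply: leq_mul => //; lia.
    lia.
  + rewrite (binE (ltn0Sn n)) rev_cons cat_rcons => j; rewrite /upd /=.
    by do 5?case: eqVneq => //= ?; subst.
Qed.

Lemma exec_digit_out s :
  exec digit_out s (9 * size (s 6) + 1)
    (upd (upd s 6 [::]) 1 (flatten [seq true :: enc_bool b | b <- rev (s 6)] ++ s 1)).
Proof.
move e: (s 6) => x; elim: x s e => [|b x IH] s s6.
  by apply: exec_eq (ExecWhileNil _ _) _ _ => //; upd_tac.
apply: exec_eq.
- apply: ExecWhileCons; first by rewrite s6.
    apply: (@ExecCase _ _ _ _ _ 5 (upd (upd s 6 x) 1 (true :: b :: s 1))).
    rewrite s6; case: b {s6} (s6) => s6.
      apply: exec_eq; first by apply: ExecSeq; [exact: ExecPop|exact: exec_pushes].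
        by [].
      rewrite ?s6; upd_tac.
    apply: exec_eq; first by apply: ExecSeq; [exact: ExecPop|exact: exec_pushes].
      by [].
    rewrite ?s6; upd_tac.
  by apply: IH; rewrite /upd.
- rewrite /=; lia.
- move=> j; rewrite /upd /= rev_cons map_rcons flatten_rcons -catA /=.
  by do 3?case: eqVneq => //= ?; subst.
Qed.

(** Truncated subtraction in both directions at once: with stack 5 empty at the start, the numbers
    are equal exactly when stacks 4 and 5 both end empty. *)
Definition compare_loop : cmd :=
  While 3 (Seq (Pop 3) (Case 4 (Push 5 true) (Pop 4) (Pop 4))).

Lemma exec_compare n m s : s 3 = nseq n true -> s 4 = nseq m true ->
  exec compare_loop s (7 * n + 1)
    (upd (upd (upd s 3 [::]) 4 (nseq (m - n) true)) 5 (nseq (n - m) true ++ s 5)).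
Proof.
elim: n m s => [|n IH] m s s3 s4.
  apply: exec_eq (ExecWhileNil _ _) _ _ => //.
  by rewrite subn0; upd_tac.
apply: exec_eq.
- apply: ExecWhileCons; first by rewrite s3.
    apply: ExecSeq; first exact: ExecPop.
    apply: (@ExecCase _ _ _ _ _ 2 (upd (upd (upd s 3 (nseq n true)) 4 (nseq m.-1 true)) 5
      (nseq (m == 0) true ++ s 5))).
    rewrite {1}/upd /= s4; case: m s4 => [|m] s4 /=.
      apply: exec_eq; first exact: ExecPush.
        by [].
      by rewrite ?s3; upd_tac.
    apply: exec_eq; first exact: ExecPop.
      by [].
    by rewrite ?s3 ?s4; upd_tac; rewrite s4.
  by apply: (IH m.-1); rewrite /upd.
- lia.
- move=> j; rewrite /upd /=; case: m s4 => [|m] s4 /=.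
    rewrite subn0 ?sub0n ?nseq_rcons.
    by do 3?case: eqVneq => //= ?.
  by rewrite !subSS; do 3?case: eqVneq => //= ?.
Qed.

(** Access to the input at a position held in unary: the prefix is parked, reversed, on stack 4, and
    [unskip_loop] puts it back. *)
Definition skip_loop : cmd :=
  While 3 (Seq (Pop 3)
    (Case 0 Skip (Seq (Pop 0) (Push 4 false)) (Seq (Pop 0) (Push 4 true)))).

Lemma exec_skip n s : s 3 = nseq n true ->
  exec skip_loop s (8 * n + 1)
    (upd (upd (upd s 3 [::]) 0 (drop n (s 0))) 4 (rev (take n (s 0)) ++ s 4)).
Proof.
elim: n s => [|n IH] s s3.
  apply: exec_eq (ExecWhileNil _ _) _ _ => //.
  by rewrite drop0 take0; upd_tac.
apply: exec_eq.
- apply: ExecWhileCons; first by rewrite s3.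
    apply: ExecSeq; first exact: ExecPop.
    apply: (@ExecCase _ _ _ _ _ 3 (upd (upd (upd s 3 (nseq n true)) 0 (behead (s 0))) 4
      (take 1 (s 0) ++ s 4))).
    rewrite {1}/upd /=; case s0: (s 0) => [|b x] /=.
      apply: exec_eq; first exact: ExecSkip.
        by [].
      by rewrite ?s3; upd_tac.
    case: b s0 => s0.
      apply: exec_eq; first by apply: ExecSeq; [exact: ExecPop|exact: ExecPush].
        by [].
      by rewrite ?s3; upd_tac; rewrite ?s0 ?take0.
    apply: exec_eq; first by apply: ExecSeq; [exact: ExecPop|exact: ExecPush].
      by [].
    by rewrite ?s3; upd_tac; rewrite ?s0 ?take0.
  by apply: IH; rewrite /upd.
- lia.
- move=> j; rewrite /upd /=; case: (s 0) => [|b x] /=.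
    by do 3?case: eqVneq => //= ?.
  by rewrite take0 rev_cons cat_rcons; do 3?case: eqVneq => //= ?.
Qed.

Definition unskip_loop (i j : nat) : cmd :=
  While i (Case i Skip (Seq (Pop i) (Push j false)) (Seq (Pop i) (Push j true))).

Lemma exec_unskip i j s : i != j ->
  exec (unskip_loop i j) s (7 * size (s i) + 1)
    (upd (upd s i [::]) j (rev (s i) ++ s j)).
Proof.
move=> ij; move e: (s i) => x; elim: x s e => [|b x IH] s si.
  by apply: exec_eq (ExecWhileNil _ _) _ _ => //; upd_tac.
apply: exec_eq.
- apply: ExecWhileCons; first by rewrite si.
    apply: (@ExecCase _ _ _ _ _ 3 (upd (upd s i x) j (b :: s j))).
    rewrite si; case: b {si} (si) => si.
      apply: exec_eq; first by apply: ExecSeq; [exact: ExecPop|exact: ExecPush].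
        by [].
      move=> k; rewrite /upd si (eq_sym j i) (negPf ij).
      by do 2?case: eqVneq.
    apply: exec_eq; first by apply: ExecSeq; [exact: ExecPop|exact: ExecPush].
      by [].
    move=> k; rewrite /upd si (eq_sym j i) (negPf ij).
    by do 2?case: eqVneq.
  by apply: IH; rewrite /upd eqxx (negPf ij).
- rewrite /=; lia.
- move=> k; rewrite /upd eqxx rev_cons cat_rcons.
  by case: (k == j); case: (k == i).
Qed.

(** * Emitters *)

(* Emitters: programs that only print.  Registers are numbered in the order of
   their introduction: [EFor] and [ELet] bind the next free one. *)
Inductive emitter :=
| EBits of bits
| ECat of emitter & emitter
| EFor of nat & emitter
| EIfEq of nat & nat & nat & emitter & emitter
| ELet of nat & nat & nat & emitter
| ENat of nat
| EIn of nat & emitter & emitter & emitter.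

Fixpoint out (c : emitter) (w : bits) (rho : seq nat) : bits :=
  match c with
  | EBits l => l
  | ECat c d => out c w rho ++ out d w rho
  | EFor e c => flatten [seq out c w (rcons rho k) | k <- iota 0 (nth 0 rho e)]
  | EIfEq a b m c d =>
      if nth 0 rho a == nth 0 rho b + m then out c w rho else out d w rho
  | ELet a b m c => out c w (rcons rho (nth 0 rho a * nth 0 rho b + m))
  | ENat a => enc_seq enc_bool (bin (nth 0 rho a))
  | EIn a c0 c1 c2 =>
      if drop (nth 0 rho a) w is b :: _ then
        if b then out c2 w rho else out c1 w rho
      else out c0 w rho
  end.

Fixpoint scoped (c : emitter) (l : nat) : bool :=
  match c with
  | EBits _ => true
  | ECat c d => scoped c l && scoped d l
  | EFor e c => (e < l) && scoped c l.+1
  | EIfEq a b m c d => [&& a < l, b < l, scoped c l & scoped d l]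
  | ELet a b m c => [&& a < l, b < l & scoped c l.+1]
  | ENat a => a < l
  | EIn a c0 c1 c2 => [&& a < l, scoped c0 l, scoped c1 l & scoped c2 l]
  end.

(* The output is a stack, so it is produced from its end. *)
Fixpoint emit_cmd (c : emitter) (l : nat) : cmd :=
  match c with
  | EBits x => pushes 1 (rev x)
  | ECat c d => Seq (emit_cmd d l) (emit_cmd c l)
  | EFor e c =>
      Seq (copy (8 + e) (8 + l)) (While (8 + l) (Seq (Pop (8 + l)) (emit_cmd c l.+1)))
  | EIfEq a b m c d =>
      Seq (copy (8 + a) 3) (Seq (copy (8 + b) 4) (Seq (pushes 4 (nseq m true))
      (Seq compare_loop
        (let no := Seq (clear 4) (Seq (clear 5) (emit_cmd d l)) in
         Case 5 (Case 4 (emit_cmd c l) no no) no no))))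
  | ELet a b m c =>
      Seq (copy (8 + a) 3)
      (Seq (While 3 (Seq (Pop 3) (copy (8 + b) (8 + l))))
      (Seq (pushes (8 + l) (nseq m true)) (Seq (emit_cmd c l.+1) (clear (8 + l)))))
  | ENat a =>
      Seq (copy (8 + a) 3) (Seq (Push 1 false) (Seq digit_loop digit_out))
  | EIn a c0 c1 c2 =>
      Seq (copy (8 + a) 3) (Seq skip_loop
        (let back := unskip_loop 4 0 in
         Case 0 (Seq back (emit_cmd c0 l)) (Seq back (emit_cmd c1 l))
           (Seq back (emit_cmd c2 l))))
  end.

(** [B] bounds all registers and the input length. Only [ELet] enlarges it, by a polynomial, and the
    nesting of [ELet] is fixed by the syntax. *)
Fixpoint print_time (c : emitter) (B : nat) : nat :=
  match c with
  | EBits x => 2 * size x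
  | ECat c d => print_time c B + print_time d B
  | EFor e c => 13 * B + 3 + B * (print_time c B + 3)
  | EIfEq a b m c d => 50 * B + 20 * m + 50 + print_time c B + print_time d B
  | ELet a b m c =>
      12 * B + 5 + B * (12 * B + 5) + 2 * m + print_time c (B * B + m + B) +
      3 * (B * B + m) + 2
  | ENat a => 12 * B + 10 + B * (20 * B + 20) + 9 * B + 2
  | EIn a c0 c1 c2 =>
      50 * B + 50 + print_time c0 B + print_time c1 B + print_time c2 B
  end.

Lemma size_bin k : size (bin k) <= k.
Proof.
rewrite size_map size_iota; case: eqVneq => // k0.
apply: leq_trans (ltn_expl _ (isT : 1 < 2)) _.
by apply: trunc_logP; rewrite ?lt0n.
Qed.

Lemma nth_le B rho a : all (fun x => x <= B) rho -> nth 0 rho a <= B.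
Proof.
move=> /allP h; have [ar|ar] := ltnP a (size rho); last by rewrite nth_default.
exact/h/mem_nth.
Qed.

Lemma store_scratch rho w o i : 1 < i < 8 -> store rho w o i = [::].
Proof. by case: i => [|[|[|[|[|[|[|[|i]]]]]]]]. Qed.

Ltac store_side := try (by rewrite /= store_scratch); try (by rewrite /= store_reg); try lia.

Lemma emit_cmd_correct c w o rho B : scoped c (size rho) -> all (fun x => x <= B) rho ->
  size w <= B ->
  exec (emit_cmd c (size rho)) (store rho w o) (print_time c B)
    (store rho w (out c w rho ++ o)).
Proof.
elim: c o rho B => [x|c IHc d IHd|e c IH|a b m c IHc d IHd|a b m c IH|a
  |a c0 IH0 c1 IH1 c2 IH2] o rho B /=.
- move=> _ _ _; apply: exec_eq; first exact: exec_pushes.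
    by rewrite size_rev.
  by rewrite revK => j; rewrite /upd /store; case: eqVneq => // ->.
- move=> /andP[wc wd] rB wB; rewrite addnC -catA; apply: ExecSeq; first exact: IHd.
  exact: IHc.
- move=> /andP[er wc] rB wB.
  have eB := nth_le e rB.
  set r := 8 + size rho; set n := nth 0 rho e in eB *.
  (* The counter of the loop is also the bound register. It is decremented before the body, so the
     indices run downwards to 0, the order in which a stack output has to be written. *)
  have loop k o' : k <= n ->
      exec (While r (Seq (Pop r) (emit_cmd c (size rho).+1))) (store (rcons rho k) w o')
        (k * (print_time c B + 3) + 1)
        (store rho w (flatten [seq out c w (rcons rho k) | k <- iota 0 k] ++ o')).
    elim: k o' => [|k IHk] o' kn.
      apply: exec_eq (ExecWhileNil _ _) _ _ => //.
        by rewrite /r store_reg nth_rcons ltnn eqxx.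
      rewrite store_rcons => j; rewrite /upd; case: eqVneq => // ->.
      by rewrite store_reg nth_default.
    apply: exec_eq.
    + apply: ExecWhileCons.
      * by rewrite /r store_reg nth_rcons ltnn eqxx.
      * apply: ExecSeq; first exact: ExecPop.
        apply: (@exec_eql _ (store (rcons rho k) w o')).
          by rewrite !store_rcons => j; rewrite /upd /r !eqxx; case: eqVneq.
        rewrite -(size_rcons rho k); apply: (IH _ _ B) => //; first by rewrite size_rcons.
        by rewrite all_rcons rB andbT; lia.
      * by apply: IHk; lia.
    + lia.
    + by rewrite -addn1 iotaD map_cat flatten_cat /= cats0 catA.
  apply: exec_eq.
  + apply: ExecSeq.
      by apply: (@exec_copy _ _ _ n); rewrite ?/r; store_side.
    apply: (@exec_eql _ (store (rcons rho n) w o)); last exact: loop.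
    rewrite store_rcons => j; rewrite /upd; case: eqVneq => // _.
    by rewrite store_reg nth_default// cats0.
  + have := leq_mul eB (leqnn (print_time c B + 3)); lia.
  + by [].
- move=> /and4P[ar br wc wd] rB wB.
  have aB := nth_le a rB; have bB := nth_le b rB.
  set x := nth 0 rho a in aB *; set y := nth 0 rho b in bB *.
  set no := Seq (clear 4) (Seq (clear 5) (emit_cmd d (size rho))).
  (* A failed comparison leaves remainders on stacks 4 and 5, which must go before the state is a
     [store] again. *)
  have doesno p q : p <= y + m -> q <= x ->
      exec no (upd (upd (store rho w o) 4 (nseq p true)) 5 (nseq q true))
        (3 * (y + m) + 3 * x + 2 + print_time d B) (store rho w (out d w rho ++ o)).
    move=> py qx; apply: exec_eq.
    - apply: ExecSeq; first exact: exec_clear.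
      apply: ExecSeq; first exact: exec_clear.
      apply: (@exec_eql _ (store rho w o)); last exact: (IHd _ _ B).
      upd_tac.
    - rewrite /upd /= !size_nseq; lia.
    - by [].
  apply: exec_eq.
  + apply: ExecSeq.
      by apply: (@exec_copy _ _ _ x); store_side.
    apply: ExecSeq.
      by apply: (@exec_copy _ _ _ y); rewrite /upd; store_side.
    apply: ExecSeq; first exact: exec_pushes.
    apply: ExecSeq.
      apply: (@exec_compare x (y + m)); rewrite /upd /= ?store_scratch// ?cats0//.
      by rewrite rev_nseq -nseqD addnC.
    apply: (@exec_eql _ (upd (upd (store rho w o) 4 (nseq (y + m - x) true)) 5 (nseq (x - (y + m)) true))).
      by upd_tac.
    apply: (@ExecCase _ _ _ _ _ (3 * (y + m) + 3 * x + 4 + print_time c B + print_time d B)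
       (store rho w ((if x == y + m then out c w rho else out d w rho) ++ o))).
    rewrite {1}/upd /=; case: (ltngtP x (y + m)) => xy.
    * have xy0 : x - (y + m) = 0 by lia.
      rewrite xy0.
      apply: exec_eq.
      - apply: ExecCase; rewrite {1}/upd /=.
        case e: (y + m - x) => [|p]; first lia.
        by rewrite /= -[true :: _]/(nseq p.+1 true); apply: (doesno _ 0); lia.
      - lia.
      - by [].
    * case e: (x - (y + m)) => [|p]; first lia.
      rewrite /= -[true :: _]/(nseq p.+1 true).
      apply: exec_eq; first (by apply: doesno; lia); [lia|by []].
    * have xy0 : x - (y + m) = 0 by lia.
      have yx0 : y + m - x = 0 by lia.
      rewrite xy0 yx0 /=.
      apply: exec_eq.
      - apply: ExecCase; rewrite {1}/upd /=.
        apply: (@exec_eql _ (store rho w o)); last exact: (IHc _ _ B).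
        by upd_tac.
      - lia.
      - by [].
  + rewrite size_nseq; lia.
  + by [].
- move=> /and3P[ar br wc] rB wB.
  have aB := nth_le a rB; have bB := nth_le b rB.
  set x := nth 0 rho a in aB *; set y := nth 0 rho b in bB *.
  set r := 8 + size rho.
  have loop k z : exec (While 3 (Seq (Pop 3) (copy (8 + b) r)))
      (upd (store (rcons rho z) w o) 3 (nseq k true)) (k * (12 * B + 5) + 1)
      (store (rcons rho (k * y + z)) w o).
    elim: k z => [|k IHk] z.
      apply: exec_eq (ExecWhileNil _ _) _ _ => //.
      by move=> j; rewrite /upd; case: eqVneq => // ->.
    apply: exec_eq.
    + apply: ExecWhileCons; first by [].
      * apply: ExecSeq; first exact: ExecPop.
        by apply: (@exec_copy _ _ _ y); rewrite /upd ?/r; store_side;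
          rewrite /= store_reg nth_rcons br.
      apply: (@exec_eql _ (upd (store (rcons rho (y + z)) w o) 3 (nseq k true))).
        rewrite !store_rcons => j; rewrite /upd /r !eqxx.
        case: eqVneq => [->|j3]; first by case: eqVneq => //; lia.
        by case: eqVneq => // _; rewrite -nseqD.
      exact: IHk.
    + have : 12 * y <= 12 * B by lia.
      lia.
    + by rewrite mulSn -addnA addnCA.
  have xyB : x * y <= B * B by apply: leq_mul.
  apply: exec_eq.
  + apply: ExecSeq.
      by apply: (@exec_copy _ _ _ x); store_side.
    apply: ExecSeq.
      apply: (@exec_eql _ (upd (store (rcons rho 0) w o) 3 (nseq x true))); last exact: loop.
      rewrite (store_scratch _ _ _ (isT : 1 < 3 < 8)) cats0 store_rcons => j; rewrite /upd.
      case: eqVneq => // _; case: eqVneq => // ->.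
      by rewrite store_reg nth_default.
    apply: ExecSeq; first exact: exec_pushes.
    apply: ExecSeq.
      apply: (@exec_eql _ (store (rcons rho (x * y + m)) w o)).
        rewrite addn0 !store_rcons => j; rewrite /upd /r eqxx.
        by case: eqVneq => // _; rewrite rev_nseq -nseqD addnC.
      rewrite -(size_rcons rho (x * y + m)).
      apply: (IH _ _ (B * B + m + B)); rewrite ?size_rcons//; last lia.
      rewrite all_rcons; apply/andP; split; first lia.
      by apply: sub_all rB => z zB; lia.
    exact: exec_clear.
  + rewrite size_nseq store_reg nth_rcons ltnn eqxx size_nseq.
    have := leq_mul aB (leqnn (12 * B + 5)); lia.
  + rewrite store_rcons => j; rewrite /upd /r; case: eqVneq => // ->.
    by rewrite store_reg nth_default.
- move=> ar rB wB.
  have aB := nth_le a rB; set x := nth 0 rho a in aB *.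
  apply: exec_eq.
  + apply: ExecSeq.
      by apply: (@exec_copy _ _ _ x); store_side.
    apply: ExecSeq; first exact: ExecPush.
    apply: ExecSeq.
      apply: (@exec_digits x); rewrite /upd /= ?store_scratch//.
      by rewrite cats0.
    exact: exec_digit_out.
  + rewrite /upd /= ?store_scratch// ?cats0 size_rev.
    have := size_bin x; have := leq_mul aB (_ : 20 * x + 20 <= 20 * B + 20); lia.
  + rewrite /enc_seq -catA; upd_tac; rewrite /store /= ?revK -?catA //=;
      do 2?[case: eqVneq => ? //]; subst; try discriminate.
- move=> /and4P[ar w0 w1 w2] rB wB.
  have aB := nth_le a rB; set x := nth 0 rho a in aB *.
  have back : exec (unskip_loop 4 0)
      (upd (upd (store rho w o) 0 (drop x w)) 4 (rev (take x w))) (7 * B + 1)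
      (store rho w o).
    apply: exec_eq; first exact: exec_unskip.
      rewrite /upd /= size_rev size_take_min; lia.
    by upd_tac; rewrite ?revK ?cat_take_drop.
  apply: exec_eq.
  + apply: ExecSeq.
      by apply: (@exec_copy _ _ _ x); store_side.
    apply: ExecSeq.
      apply: (@exec_skip x); rewrite /upd /= ?store_scratch//.
      by rewrite cats0.
    apply: (@exec_eql _ (upd (upd (store rho w o) 0 (drop x w)) 4 (rev (take x w)))).
      by upd_tac.
    apply: (@ExecCase _ _ _ _ _ (7 * B + 1 + (print_time c0 B + print_time c1 B + print_time c2 B))
      (store rho w ((if drop x w is b :: _ then
          if b then out c2 w rho else out c1 w rho else out c0 w rho) ++ o))).
    rewrite {1}/upd /=; case: (drop x w) back => [|[] v] bk.
    * apply: exec_eq; first by apply: ExecSeq; [exact: bk|exact: (IH0 _ _ B)].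
        lia.
      by [].
    * apply: exec_eq; first by apply: ExecSeq; [exact: bk|exact: (IH2 _ _ B)].
        lia.
      by [].
    * apply: exec_eq; first by apply: ExecSeq; [exact: bk|exact: (IH1 _ _ B)].
        lia.
      by [].
  + lia.
  + by [].
Qed.

(** * Polynomially bounded functions *)

Definition polyb (f : nat -> nat) : Prop := exists K, forall x, f x <= (x + 2) ^ K.

Lemma polyb_le f g : (forall x, f x <= g x) -> polyb g -> polyb f.
Proof. by move=> fg [K gK]; exists K => x; apply: leq_trans (gK x). Qed.

Lemma polyb_cst n : polyb (fun=> n).
Proof.
by exists n => x; apply/ltnW/ltn_expl; rewrite addn2.
Qed.

Lemma polyb_id : polyb id.
Proof. by exists 1 => x; rewrite expn1 leq_addr. Qed.

Lemma polybD f g : polyb f -> polyb g -> polyb (fun x => f x + g x).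
Proof.
move=> [a fa] [b gb]; exists (a + b).+1 => x.
rewrite expnS mulnDl; have x2 : 0 < x + 2 by rewrite addn2.
have : (x + 2) ^ a <= (x + 2) ^ (a + b) by rewrite leq_pexp2l// leq_addr.
have : (x + 2) ^ b <= (x + 2) ^ (a + b) by rewrite leq_pexp2l// leq_addl.
have := fa x; have := gb x; lia.
Qed.

Lemma polybM f g : polyb f -> polyb g -> polyb (fun x => f x * g x).
Proof.
by move=> [a fa] [b gb]; exists (a + b) => x; rewrite expnD leq_mul.
Qed.

Lemma polyb_comp f g : polyb f -> polyb g -> polyb (fun x => f (g x)).
Proof.
move=> [a fa] /polybD /(_ (polyb_cst 2)) [b gb]; exists (b * a) => x.
apply: leq_trans (fa _) _; rewrite expnM.
by case: a {fa} => // a; rewrite leq_exp2r.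
Qed.

Lemma polyb_poly f : polyb f -> exists p : {poly nat}, forall x, f x <= p.[x]%R.
Proof.
move=> [K fK]; exists (('X + 2%:P) ^+ K)%R => x.
apply: leq_trans (fK x) _.
rewrite poly.horner_exp poly.hornerD poly.hornerX poly.hornerC.
by elim: K {fK} => // K IH; rewrite expnS GRing.exprS leq_mul.
Qed.

Ltac polyb_tac := repeat first
  [assumption | exact: polyb_cst | exact: polyb_id | apply: polybD | apply: polybM].

Lemma polyb_print_time c : polyb (print_time c).
Proof.
elim: c => [x|c IHc d IHd|e c IH|a b m c IHc d IHd|a b m c IH|a
  |a c0 IH0 c1 IH1 c2 IH2] /=; polyb_tac.
by apply: (polyb_comp IH); polyb_tac.
Qed.

(** Stack 8, that is register 0, receives the input length in unary. Stack 9, register 1, stays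
    empty and later serves as the constant 0. *)
Definition count_loop : cmd :=
  While 0 (Seq (Push 8 true)
    (Case 0 Skip (Seq (Pop 0) (Push 4 false)) (Seq (Pop 0) (Push 4 true)))).

Lemma exec_count s : exec count_loop s (9 * size (s 0) + 1)
  (upd (upd (upd s 0 [::]) 8 (nseq (size (s 0)) true ++ s 8)) 4 (rev (s 0) ++ s 4)).
Proof.
move e: (s 0) => x; elim: x s e => [|b x IH] s s0.
  by apply: exec_eq (ExecWhileNil _ _) _ _ => //; upd_tac.
apply: exec_eq.
- apply: ExecWhileCons; first by rewrite s0.
    apply: ExecSeq; first exact: ExecPush.
    apply: (@ExecCase _ _ _ _ _ 3 (upd (upd (upd s 0 x) 8 (true :: s 8)) 4 (b :: s 4))).
    rewrite {1}/upd /= s0; case: b {s0} (s0) => s0;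
    (apply: exec_eq; first by apply: ExecSeq; [exact: ExecPop|exact: ExecPush]);
    by [|upd_tac; rewrite s0].
  by apply: IH.
- rewrite /=; lia.
- by rewrite rev_cons cat_rcons /=; upd_tac; rewrite nseq_rcons.
Qed.

Definition setup : cmd := Seq count_loop (unskip_loop 4 0).

Lemma exec_setup w : exec setup (fun i => if i == 0 then w else [::])
  (16 * size w + 2) (store [:: size w; 0] w [::]).
Proof.
apply: exec_eq.
- by apply: ExecSeq; [exact: exec_count|exact: exec_unskip].
- rewrite /upd /= cats0 size_rev; lia.
- move=> j; rewrite /upd /store /= !cats0 revK.
  by case: j => [|[|[|[|[|[|[|[|[|[|j]]]]]]]]]] //=; rewrite ?nth_nil ?cats0.
Qed.

(** * Reductions that print one query and read one bit *)

Section Reduction.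
Variables (c : emitter) (scoped_c : scoped c 2).

Let prog := Seq setup (emit_cmd c 2).
Let R := maxn 8 (maxreg prog).
Let P := len prog.
(** The answer replaces the query on stack 1. Only a first bit [false] leads to the accepting halt;
    an empty answer is rejected like [true]. *)
Let code := compile prog 0 ++
  [:: IAsk; IJump 1 P.+2 P.+3 P.+2; IHalt false; IHalt true].

Definition printed (w : bits) : bits := out c w [:: size w; 0].

Let size_code : size code = P + 4.
Proof. by rewrite size_cat size_compile. Qed.

Let M := code_machine code R.

Lemma leading_word_rep (x : bits) m : leading_word (map some x ++ nseq m None) = x.
Proof. by elim: x => [|b x /= ->] //; case: m. Qed.

Lemma run_correct (orc : bits -> bits) w : exists n c',
  [/\ n <= 16 * size w + print_time c (size w) + 4,
      steps orc n (init M w) c', nilp (next orc c')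
    & accepting (cstate c') = (if orc (printed w) is b :: _ then ~~ b else false)].
Proof.
have R0 : 0 < R by rewrite leq_max.
have ex : exec prog (fun i => if i == 0 then w else [::])
    (16 * size w + 2 + print_time c (size w)) (store [:: size w; 0] w (printed w)).
  apply: ExecSeq; first exact: exec_setup.
  rewrite -[printed w]cats0.
  by apply: (@emit_cmd_correct c w [::] [:: size w; 0]); rewrite //= leqnn.
have := compile_correct (code := code) R0 orc ex (leq_maxr _ _).
move=> /(_ (init M w)) [|i iR|n [x [nt sx px rx]]].
- rewrite -[pc _]/(0) /code_at drop0.
  by rewrite take_size_cat.
- rewrite /init /rep_tape /= ffunE /tp; case: (eqVneq i 1) => [->|i1] /=.
    by split=> //; exists 0.
  rewrite -val_eqE /= inordK; last by rewrite ltnS ltnW.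
  by case: eqVneq => _; split=> //; exists 0; rewrite cats0.
have {}px : pc x = P by rewrite px -[pc (init M w)]/(0).
have nthc j : nth (IHalt false) code (P + j) =
    nth (IHalt false) [:: IAsk; IJump 1 P.+2 P.+3 P.+2; IHalt false; IHalt true] j.
  by rewrite nth_cat size_compile ltnNge leq_addr addKn.
have ax : at_pc (cstate x) = IAsk.
  by rewrite /at_pc -/(pc x) px -[P]addn0 nthc.
pose y : config M := Config (inord P.+1 : state M)
  [ffun i => if i == ord_max then ask orc (ctapes x i) else ctapes x i].
have sy : steps orc 1 x y.
  by exists y => //; rewrite /next /= ax -/(pc x) px.
have py : pc y = P.+1 by apply: inordK; rewrite size_code; lia.
(* The head of the oracle tape is on the top of stack 1, so the word submitted is the whole
   stack. *)
have ry : rep (ctapes y) (upd (store [:: size w; 0] w (printed w)) 1 (orc (printed w))).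
  move=> i iR; rewrite /upd ffunE.
  have -> : (tp R i == ord_max) = (i == 1).
    apply/eqP/eqP => [|->]; last by rewrite /tp.
    by rewrite -[ord_max]/(tp R 1); apply: tp_inj.
  case: eqVneq => [->|i1]; last exact: rx.
  have [_ [m e]] := rx 1 R0; rewrite /ask /= e leading_word_rep.
  by split=> //; exists 0; rewrite cats0.
have jy : at_pc (cstate y) = IJump 1 P.+2 P.+3 P.+2.
  by have := nthc 1; rewrite addn1 /at_pc -/(pc y) py => ->.
have [|||z [sz pz _]] := step_jump orc ry jy R0; rewrite ?size_code; try lia.
exists (n + (1 + 1)), z; split.
- lia.
- by do 2?apply: steps_add; eauto.
- rewrite /next /= /code_delta /at_pc -/(pc z) pz /upd /=.
  by have := nthc 2; have := nthc 3; rewrite addn2 addn3;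
    case: (orc _) => [|[] ?] e3 e2; rewrite ?e2 ?e3.
- rewrite /= /at_pc -/(pc z) pz /upd /=.
  by have := nthc 2; have := nthc 3; rewrite addn2 addn3;
    case: (orc _) => [|[] ?] e3 e2; rewrite ?e2 ?e3.
Qed.

(** An oracle that solves [S] is reliable only on inputs that have an answer; the first hypothesis
    guarantees this for every query. *)
Lemma turing_reducible_printed (L : set bits) (S : search_problem) :
  (forall w, exists y, S (printed w) y) ->
  (forall w y, S (printed w) y -> L w <-> exists y', y = false :: y') ->
  turing_reducible L S.
Proof.
move=> ex corr.
have [p pP] : exists p : {poly nat}, forall x,
    16 * x + print_time c x + 4 <= p.[x]%R.
  by apply: polyb_poly; polyb_tac; exact: polyb_print_time.
exists M, p; split; first exact: code_machine_det.
move=> orc sol w.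
have [n [c' [nt sn nl acc]]] := run_correct orc w.
have [h a] := steps_halt sn nl (leq_trans nt (pP _)).
split=> //; rewrite a acc (corr _ _ (sol _ (ex w))).
by split=> [[y' ->]|] //; case: (orc _) => [|[] y] // _; exists y.
Qed.

End Reduction.

(** * Tableaux *)

Definition move_code (d : move) : option bool :=
  match d with MoveL => None | Stay => Some false | MoveR => Some true end.

Definition move_decode (x : option bool) : move :=
  match x with None => MoveL | Some b => if b then MoveR else Stay end.

Lemma move_codeK : cancel move_code move_decode. Proof. by case. Qed.

HB.instance Definition _ := Finite.copy move (can_type move_codeK).

Lemma nth_lft_move d b t i : nth None (lft (shift d (write b t))) i =
  match d with
  | MoveL => nth None (lft t) i.+1
  | Stay => nth None (lft t) i
  | MoveR => if i is i'.+1 then nth None (lft t) i' else b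
  end.
Proof. by case: d i => [||] [|i] //=; rewrite nth_behead. Qed.

Lemma nth_rgt_move d b t i : nth None (rgt (shift d (write b t))) i =
  match d with
  | MoveL => if i is i'.+1 then if i' is 0 then b else nth None (rgt t) i'
             else nth None (lft t) 0
  | Stay => if i is 0 then b else nth None (rgt t) i
  | MoveR => nth None (rgt t) i.+1
  end.
Proof. by case: d i => [||] [|[|i]] //=; rewrite ?nth_behead ?nth0. Qed.

(** Relative position reduced to four classes (equal, one more, one less, other), which turns the
    conflict relation into a finite table. *)
Definition diff_class (a b : nat) : nat :=
  if a == b then 0 else if a == b + 1 then 1 else if b == a + 1 then 2 else 3.

Lemma diff_classxx a : diff_class a a = 0. Proof. by rewrite /diff_class eqxx. Qed.

Lemma diff_classSn a : diff_class a.+1 a = 1.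
Proof. by rewrite /diff_class addn1 eqxx gtn_eqF. Qed.

Lemma diff_classnS a : diff_class a a.+1 = 2.
Proof. by rewrite /diff_class !addn1 eqxx ltn_eqF // ltn_eqF. Qed.

Definition swap_class (c : nat) : nat := if c == 1 then 2 else if c == 2 then 1 else c.

Lemma diff_class_swap a b : diff_class b a = swap_class (diff_class a b).
Proof.
rewrite /diff_class /swap_class.
have [_|] := eqVneq a b; first by [].
by move=> ab; case E1: (a == b + 1); case E2: (b == a + 1) => //=; lia.
Qed.

Section Tableau.
Variables (M : machine) (noquery : oracle_free M).

Let k := (ntapes M).+2.
Definition symbols := {ffun 'I_k -> symbol}.
Definition action := (state M * {ffun 'I_k -> symbol * move})%type.

(* The cell of the tableau at column [i] of some time step: whether [i = 0],
   the state, the action chosen at that time step, and the [i]-th symbols of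
   [lft] and [rgt] on each tape. *)
Definition cell := (bool * (state M * action) * (symbols * symbols))%type.

Implicit Types v : cell.

Definition col0 v : bool := v.1.1.
Definition cst v : state M := v.1.2.1.
Definition cact v : action := v.1.2.2.
Definition clft v : symbols := v.2.1.
Definition crgt v : symbols := v.2.2.

Definition idle (q : state M) (r : symbols) : action :=
  (q, [ffun j => (r j, Stay)]).

(** A halted machine idles by rewriting what it reads, so every run extends to the fixed number of
    rows. *)
Definition legal (q : state M) (a : action) (r : symbols) : bool :=
  if nilp (delta q r) then a == idle q r else a \in delta q r.

Definition compat_row v v' : bool := v.1.2 == v'.1.2.

(* [v'] is one time step later than [v], in the same column, the next one or
   the previous one. *)
Definition compat_same v v' : bool :=
  (cst v' == (cact v).1) && [forall j : 'I_k,
    let: (b, d) := (cact v).2 j in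
    match d with
    | Stay => (clft v' j == clft v j) &&
              (crgt v' j == if col0 v then b else crgt v j)
    | MoveR => col0 v ==> (clft v' j == b)
    | MoveL => col0 v ==> (crgt v' j == clft v j)
    end].

(** With the head kept at column 0, a move shifts the tape instead: entries of the growing half go
    one column up, which is checked here, and those of the shrinking half one column down, checked
    in [compat_left]. *)
Definition compat_right v v' : bool := [forall j : 'I_k,
    let: (b, d) := (cact v).2 j in
    match d with
    | Stay => true
    | MoveR => clft v' j == clft v j
    | MoveL => crgt v' j == if col0 v then b else crgt v j
    end].

Definition compat_left v v' : bool := [forall j : 'I_k,
    match ((cact v).2 j).2 with
    | Stay => true
    | MoveR => crgt v' j == crgt v j
    | MoveL => clft v' j == clft v j
    end].

(* Rows are numbered backwards in time.  The value [None] is the escape,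
   allowed only in row 0 and column 0, where it stands for an accepting end. *)
Definition conflict (cy ci : nat) (d d' : option cell) : bool :=
  match d, d' with
  | Some v, Some v' =>
      match cy, ci with
      | 0, 0 => v != v'
      | 0, 1 | 0, 2 => ~~ compat_row v v'
      | 1, 0 => ~~ compat_same v v'
      | 1, 1 => ~~ compat_left v v'
      | 1, 2 => ~~ compat_right v v'
      | 2, 0 => ~~ compat_same v' v
      | 2, 1 => ~~ compat_right v' v
      | 2, 2 => ~~ compat_left v' v
      | _, _ => false
      end
  | _, _ => (cy == 0) && (ci == 0) && (d != d')
  end.

Definition allowed (y0 i0 : bool) (inp : option symbol) (d : option cell) : bool :=
  if d is Some v then
    [&& col0 v == i0,
        i0 ==> legal (cst v) (cact v) (crgt v),
        y0 && i0 ==> accepting (cst v) && nilp (delta (cst v) (crgt v)) &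
        if inp is Some b then
          [&& cst v == start M, clft v == [ffun=> None] &
              crgt v == [ffun j => if j == ord0 then b else None]]
        else true]
  else y0 && i0.

Lemma conflict_sym cy ci d d' : cy < 4 -> ci < 4 ->
  conflict (swap_class cy) (swap_class ci) d' d = conflict cy ci d d'.
Proof.
case: d d' => [v|] [v'|]; case: cy => [|[|[|[|]]]] //; case: ci => [|[|[|[|]]]] //= _ _;
  rewrite /compat_row //; congr (~~ _); exact: eq_sym.
Qed.

Lemma conflictxx d : conflict 0 0 d d = false.
Proof. by case: d => [v|] //=; rewrite eqxx. Qed.

Lemma conflict00 d d' : conflict 0 0 d d' = (d != d').
Proof. by case: d d' => [v|] [v'|] //=. Qed.

Definition input_at (H : nat) (w : bits) (y i : nat) : option symbol :=
  if H == y + 1 then Some (onth w i) else None.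

Definition solution (H : nat) (w : bits) (asg : nat -> nat -> option cell) : Prop :=
  (forall y i, y < H -> i < H ->
     allowed (y == 0) (i == 0) (input_at H w y i) (asg y i)) /\
  (forall y i y' i', y < H -> i < H -> y' < H -> i' < H ->
     conflict (diff_class y y') (diff_class i i') (asg y i) (asg y' i') = false).

Local Notation next := (Defs.next no_oracle).

Lemma nextE (c : config M) : next c =
  [seq Config qa.1 (act qa.2 (ctapes c))
     | qa <- delta (cstate c) [ffun i => read (ctapes c i)]].
Proof. by rewrite /Defs.next noquery. Qed.

Lemma nilp_next (c : config M) :
  nilp (next c) = nilp (delta (cstate c) [ffun i => read (ctapes c i)]).
Proof. by rewrite nextE /nilp size_map. Qed.

(** * Solutions without the escape yield accepting computations *)

Section Soundness.
Variables (H : nat) (w : bits) (asg : nat -> nat -> cell).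
Hypothesis sol : solution H w (fun y i => Some (asg y i)).

Let alw y i (yH : y < H) (iH : i < H) := sol.1 y i yH iH.
Let nconf := sol.2.

(** Only columns up to [y] are compared. An entry may come from the next column of the earlier row,
    so the known window loses one column per step, and row [y] has exactly [y] steps left. *)
Definition agrees (y : nat) (c : config M) : Prop :=
  cstate c = cst (asg y 0) /\ forall i j, i <= y ->
    nth None (lft (ctapes c j)) i = clft (asg y i) j /\
    nth None (rgt (ctapes c j)) i = crgt (asg y i) j.

Lemma sol_col0 y i : y < H -> i < H -> col0 (asg y i) = (i == 0).
Proof. by move=> yH iH; have /and4P[/eqP] := alw yH iH. Qed.

Lemma sol_row y i : y < H -> i < H -> (asg y i).1.2 = (asg y 0).1.2.
Proof.
move=> yH; elim: i => // i IH iH; rewrite -IH; last by lia.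
have := nconf yH iH yH (ltnW iH).
by rewrite diff_classxx diff_classSn => /negbFE/eqP.
Qed.

Lemma sol_act y i : y < H -> i < H -> cact (asg y i) = cact (asg y 0).
Proof. by move=> yH iH; rewrite /cact sol_row. Qed.

Lemma sol_same y i : y.+1 < H -> i < H -> compat_same (asg y.+1 i) (asg y i).
Proof.
move=> yH iH; have := nconf yH iH (ltnW yH) iH.
by rewrite diff_classxx diff_classSn => /negbFE.
Qed.

Lemma sol_right y i : y.+1 < H -> i.+1 < H ->
  compat_right (asg y.+1 i) (asg y i.+1).
Proof.
move=> yH iH; have := nconf yH (ltnW iH) (ltnW yH) iH.
by rewrite diff_classSn diff_classnS => /negbFE.
Qed.

Lemma sol_left y i : y.+1 < H -> i.+1 < H ->
  compat_left (asg y.+1 i.+1) (asg y i).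
Proof.
move=> yH iH; have := nconf yH iH (ltnW yH) (ltnW iH).
by rewrite !diff_classSn => /negbFE.
Qed.

Lemma agrees_step y c : y.+1 < H -> agrees y.+1 c ->
  agrees y (Config (cact (asg y.+1 0)).1 (act (cact (asg y.+1 0)).2 (ctapes c))).
Proof.
move=> yH [qc tc]; have H0 : 0 < H by lia.
split=> /= [|i j iy]; first by have /andP[/eqP ->] := sol_same yH H0.
have iH : i < H by lia.
rewrite ffunE nth_lft_move nth_rgt_move.
have /andP[_ /forallP/(_ j)] := sol_same yH iH.
have iH' : i.+1 < H by lia.
have /forallP/(_ j) := sol_left yH iH'.
rewrite !sol_act //.
have hR : 0 < i -> let: (b, d) := (cact (asg y.+1 0)).2 j in
    match d with
    | Stay => true
    | MoveR => clft (asg y i) j == clft (asg y.+1 i.-1) j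
    | MoveL => crgt (asg y i) j == if i.-1 == 0 then b else crgt (asg y.+1 i.-1) j
    end.
  case: i iy iH {iH'} => // i iy iH _.
  have /forallP/(_ j) := sol_right yH iH.
  by rewrite sol_act ?sol_col0 //; lia.
rewrite sol_col0 //.
have [tl tr] := tc i j (leqW iy); have [tl' tr'] := tc i.+1 j iy.
have hprev : 0 < i -> nth None (lft (ctapes c j)) i.-1 = clft (asg y.+1 i.-1) j /\
    nth None (rgt (ctapes c j)) i.-1 = crgt (asg y.+1 i.-1) j.
  by move=> i0; apply: tc; lia.
have [tl0 _] := tc 0 j isT.
case: ((cact _).2 j) hR => b [] /= hR hl hs.
- split; first by rewrite tl' (eqP hl).
  case: i {iy iH iH' tl tr tl' tr' hl} hs hR hprev => [|i] /= hs hR hprev.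
    by rewrite tl0 (eqP hs).
  by rewrite (eqP (hR isT)); have := (hprev isT).2; case: (i).
- by have /andP[/eqP -> /eqP ->] := hs; rewrite tl;
  case: i {iy iH iH' hs hR hprev tl tl' tr' hl} tr.
- split; last by rewrite tr' (eqP hl).
  case: i {iy iH iH' tl tr tl' tr' hl} hs hR hprev => [|i] /= hs hR hprev.
    by rewrite (eqP hs).
  by rewrite (eqP (hR isT)); have [-> _] := hprev isT.
Qed.

Lemma agrees_read y c : agrees y c -> [ffun i => read (ctapes c i)] = crgt (asg y 0).
Proof.
move=> [_ h]; apply/ffunP => j; rewrite ffunE -(h 0 j isT).2.
by rewrite /read nth0.
Qed.

(** If the machine has already halted, legality forces the idle action, so the same configuration
    agrees with the next row and acceptance is inherited from row 0. *)
Lemma agrees_accepts y c : y < H -> agrees y c -> accepts_within no_oracle y c.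
Proof.
elim: y c => [|y IH] c yH ag.
  have H0 : 0 < H by lia.
  have /and4P[_ _ /= /andP[ac nl] _] := alw yH H0.
  by rewrite /= nilp_next (agrees_read ag) ag.1 nl ac.
have H0 : 0 < H by lia.
have /and4P[_ /= lg _ _] := alw yH H0.
have ag' := agrees_step yH ag; have {}IH c' := IH c' (ltnW yH).
rewrite /= nextE (agrees_read ag) ag.1.
move: lg; rewrite /legal; case: ifP => [dn /eqP ea|_ ad]; last first.
  apply/orP; right; rewrite has_map; apply/hasP.
  by exists (cact (asg y.+1 0)) => //; exact: IH.
have nc : next c = [::] by apply/nilP; rewrite nilp_next (agrees_read ag) ag.1.
have agc : agrees y c.
  case: ag' => /= qs ts; split; first by rewrite -qs ea ag.1.
  move=> i j iy; have := ts i j iy; rewrite ea ffunE /= ffunE /=.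
  move=> -[-> <-]; split=> //.
  by case: i {iy} => [|i]; rewrite ?(ag.2 0 j isT).2 //= nth_behead.
have := IH _ agc; rewrite (nilP dn) /=.
have -> : accepts_within no_oracle y c = accepting (cstate c).
  by case: (y) => [|n] /=; rewrite nc /= orbF.
by rewrite ag.1 => ->.
Qed.
End Soundness.

Lemma sound H w asg : 0 < H -> solution H w (fun y i => Some (asg y i)) ->
  accepts_within no_oracle H.-1 (init M w).
Proof.
move=> H0 sol; apply: (agrees_accepts sol); first by rewrite prednK.
have row i : i < H -> [&& cst (asg H.-1 i) == start M,
    clft (asg H.-1 i) == [ffun=> None] &
    crgt (asg H.-1 i) == [ffun j => if j == ord0 then onth w i else None]].
  move=> iH; have H1 : H.-1 < H by rewrite prednK.
  by have /and4P[_ _ _] := sol.1 _ _ H1 iH; rewrite /input_at addn1 prednK// eqxx.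
split=> [|i j iH]; first by have /andP[/eqP] := row 0 H0.
have iH' : i < H by lia.
have /and3P[_ /eqP -> /eqP ->] := row i iH'.
rewrite !ffunE; case: ifP => _ /=; rewrite nth_nil; split=> //.
by rewrite onthE.
Qed.

(** * Runs of the machine fill the tableau *)

Section Completeness.
Variables (H : nat) (w : bits).
Variables (cs : nat -> config M) (acts : nat -> action).

Definition reads (c : config M) : symbols := [ffun j => read (ctapes c j)].

Definition succ (a : action) (c : config M) : config M :=
  if nilp (delta (cstate c) (reads c)) then c
  else Config a.1 (act a.2 (ctapes c)).

Definition run_from (c : config M) : Prop :=
  cs 0 = c /\ forall t, legal (cstate (cs t)) (acts t) (reads (cs t)) /\
    cs t.+1 = succ (acts t) (cs t).

Definition run_cell (t i : nat) : cell :=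
  ((i == 0, (cstate (cs t), acts t)),
   ([ffun j => nth None (lft (ctapes (cs t) j)) i],
    [ffun j => nth None (rgt (ctapes (cs t) j)) i])).

Hypothesis cs_run : run_from (init M w).

Lemma reads_run_cell t : crgt (run_cell t 0) = reads (cs t).
Proof. by apply/ffunP => j; rewrite !ffunE nth0. Qed.

(** Stated on entries rather than on tapes: idling may change the list that represents a tape, by an
    explicit blank, but no entry of it. *)
Lemma run_succ t : cstate (cs t.+1) = (acts t).1 /\ forall j i,
  nth None (lft (ctapes (cs t.+1) j)) i =
    nth None (lft (shift ((acts t).2 j).2 (write ((acts t).2 j).1 (ctapes (cs t) j)))) i /\
  nth None (rgt (ctapes (cs t.+1) j)) i =
    nth None (rgt (shift ((acts t).2 j).2 (write ((acts t).2 j).1 (ctapes (cs t) j)))) i.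
Proof.
have [lg ->] := cs_run.2 t; rewrite /succ.
move: lg; rewrite /legal; case: ifP => [_ /eqP ->|_ _]; last first.
  by split=> // j i; rewrite /= ffunE.
split=> // j i; rewrite /= !ffunE /=; split=> //.
by case: i => [|i]; rewrite /= ?nth_behead // /read nth0.
Qed.

Lemma run_same t i : compat_same (run_cell t i) (run_cell t.+1 i).
Proof.
have [hs h] := run_succ t; rewrite /compat_same {1}/cst /= hs eqxx /=.
apply/forallP => j; have [] := h j i; rewrite nth_lft_move nth_rgt_move.
rewrite /run_cell /cact /clft /crgt /col0 /= !ffunE.
by case: ((acts t).2 j) => b [] /= hl hr; rewrite ?hl ?hr ?eqxx //;
  case: i {hl hr} => [|i] /=; rewrite ?eqxx.
Qed.

Lemma run_right t i : compat_right (run_cell t i) (run_cell t.+1 i.+1).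
Proof.
have [_ h] := run_succ t.
apply/forallP => j; have [] := h j i.+1; rewrite nth_lft_move nth_rgt_move.
rewrite /run_cell /cact /clft /crgt /col0 /= !ffunE.
by case: ((acts t).2 j) => b [] //= hl hr; rewrite ?hl ?hr //;
  case: i {hl hr} => [|i] /=; rewrite ?eqxx.
Qed.

Lemma run_left t i : compat_left (run_cell t i.+1) (run_cell t.+1 i).
Proof.
have [_ h] := run_succ t.
apply/forallP => j; have [] := h j i; rewrite nth_lft_move nth_rgt_move.
rewrite /run_cell /cact /clft /crgt /col0 /= !ffunE.
by case: ((acts t).2 j) => b [] //= hl hr; rewrite ?hl ?hr.
Qed.

Definition run_asg (y i : nat) : cell := run_cell (H.-1 - y) i.

Lemma run_no_conflict y i y' i' : y < H -> y' < H ->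
  conflict (diff_class y y') (diff_class i i')
    (Some (run_asg y i)) (Some (run_asg y' i')) = false.
Proof.
have main u j j' : u.+1 < H ->
    conflict 1 (diff_class j j') (Some (run_asg u.+1 j)) (Some (run_asg u j')) = false.
  move=> uH; rewrite /run_asg.
  have -> : H.-1 - u = (H.-1 - u.+1).+1 by lia.
  rewrite /diff_class; case: eqVneq => [->|_] /=; first by rewrite run_same.
  case: eqVneq => [->|_] /=; first by rewrite addn1 run_left.
  by case: eqVneq => [->|_] //=; rewrite addn1 run_right.
move=> yH yH'; rewrite {1}/diff_class; case: eqVneq => [->|_] /=.
  have rowE : compat_row (run_asg y' i) (run_asg y' i') by rewrite /compat_row /= eqxx.
  rewrite /diff_class; case: eqVneq => [->|_]; first by rewrite eqxx.
  by case: (i == i' + 1); case: (i' == i + 1); rewrite /= ?rowE.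
case: eqVneq => [e|_]; first by subst y; rewrite addn1 in yH *; exact: main.
case: eqVneq => [e|_] //; subst y'; rewrite addn1 in yH' *.
(* Class 2 is class 1 with the two cells exchanged. *)
rewrite -[LHS]/(conflict 2 _ (Some _) (Some _)) -[2]/(swap_class 1).
rewrite (diff_class_swap i' i) conflict_sym //.
  exact: main.
by rewrite /diff_class; do 3?case: ifP.
Qed.

Lemma run_allowed y i : y < H -> i < H ->
  ((y == 0) && (i == 0) ==> accepting (cstate (cs H.-1)) && nilp (next (cs H.-1)))%B ->
  allowed (y == 0) (i == 0) (input_at H w y i) (Some (run_asg y i)).
Proof.
move=> yH iH acc; rewrite /allowed; apply/and4P; split; first exact: eqxx.
- apply/implyP => /eqP i0; rewrite /run_asg i0 reads_run_cell.
  by have [] := cs_run.2 (H.-1 - y).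
- apply/implyP => /andP[/eqP y0 /eqP i0]; move: acc; rewrite y0 i0 /run_asg.
  by rewrite reads_run_cell subn0 nilp_next.
- rewrite /input_at; case: eqVneq => // Hy.
  have -> : run_asg y i = run_cell 0 i by rewrite /run_asg Hy addn1 subnn.
  rewrite /run_cell cs_run.1 /cst /clft /crgt /= eqxx /=; apply/andP; split.
    by apply/eqP/ffunP => j; rewrite !ffunE; case: ifP => _; rewrite nth_nil.
  by apply/eqP/ffunP => j; rewrite !ffunE; case: ifP => _ /=; rewrite ?nth_nil ?onthE.
Qed.

End Completeness.

Lemma run_exists (c : config M) : exists cs acts, run_from cs acts c.
Proof.
pose pick (c : config M) : action :=
  if delta (cstate c) (reads c) is a :: _ then a else idle (cstate c) (reads c).
pose cs t := iter t (fun c => succ (pick c) c) c.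
exists cs, (fun t => pick (cs t)); split=> // t; split=> //.
rewrite /legal /pick; case: (delta _ _) => [|a l] /=; first exact: eqxx.
exact: mem_head.
Qed.

(** The computation may halt early; idling carries its last configuration to time exactly [n]. *)
Lemma accepting_run n (c : config M) : accepts_within no_oracle n c ->
  exists cs acts, run_from cs acts c /\
    accepting (cstate (cs n)) && nilp (next (cs n)).
Proof.
have now m c' : nilp (next c') && accepting (cstate c') ->
    exists cs acts, run_from cs acts c' /\
    accepting (cstate (cs m)) && nilp (next (cs m)).
  move=> /andP[nl ac]; have [cs [acts [c0 r]]] := run_exists c'.
  exists cs, acts; split=> //; suff -> : cs m = c' by rewrite ac.
  elim: m => // m IH; have [_ ->] := r m.
  by rewrite /succ IH; move: nl; rewrite nilp_next => ->.
elim: n c => [|n IH] c /=; first by rewrite orbF; exact: now.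
case/orP; first exact: now.
rewrite nextE has_map => /hasP[a ad /= /IH [cs [acts [[c0 r] acc]]]].
exists (fun t => if t is t'.+1 then cs t' else c).
exists (fun t => if t is t'.+1 then acts t' else a).
split=> //; split=> // -[|t] //; split.
  by rewrite /legal; case: ifP => // /nilP e; rewrite e in ad.
by rewrite c0 /succ; case: ifP => // /nilP e; rewrite e in ad.
Qed.

Lemma complete H w : 0 < H -> accepts_within no_oracle H.-1 (init M w) ->
  exists asg, solution H w (fun y i => Some (asg y i)).
Proof.
move=> H0 /accepting_run [cs [acts [r acc]]]; exists (run_asg H cs acts).
split=> *; first by apply: (run_allowed r) => //; rewrite acc implybT.
exact: (run_no_conflict r).
Qed.

(** An arbitrary run can violate only the acceptance test in row 0, column 0. Replacing that cell by
    [None] removes the test, and [None] conflicts with nothing at another position. *)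
Lemma escape H w : 0 < H -> exists asg, solution H w asg /\ asg 0 0 = None.
Proof.
move=> H0; have [cs [acts r]] := run_exists (init M w).
exists (fun y i => if (y == 0) && (i == 0) then None else Some (run_asg H cs acts y i)).
split=> //; split=> [y i yH iH|y i y' i' yH iH yH' iH'].
  case: ifP => [/andP[-> ->]//|h]; apply: (run_allowed r) => //.
  by rewrite h.
have far a b c d : (a == 0) && (b == 0) != (c == 0) && (d == 0) ->
    (diff_class a c == 0) && (diff_class b d == 0) = false.
  rewrite /diff_class; case: (eqVneq a c) => [->|_]; last by do 2?case: ifP.
  by case: (eqVneq b d) => [->|_]; [rewrite eqxx|do 2?case: ifP].
case: ifP => h; case: ifP => h' /=.
- by rewrite andbF.
- by rewrite far // h h'.
- by rewrite far // h h'.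
- exact: (run_no_conflict r).
Qed.

End Tableau.

Import Order.TTheory GRing.Theory Num.Theory.
Import numFieldNormedType.Exports.

Local Open Scope classical_set_scope.
Local Open Scope ring_scope.

(** * The convergence error of a placement *)

Section Integral.
Variable R : realType.
Let mu : {measure set _ -> \bar R} := @lebesgue_measure R.

Lemma is_derive_cont (f : R -> R) (x d : R) :
  is_derive x (1 : R) f d -> {for x, continuous f}.
Proof.
by move=> h; apply: differentiable_continuous; apply/derivable1_diffP; case: h.
Qed.

Lemma is_derive_rev (G : R -> R) (t s d : R) : is_derive (t - s) (1 : R) G d ->
  is_derive s (1 : R) (fun s => G (t - s)) (- d).
Proof.
move=> h; have h1 : is_derive s (1 : R) (fun s : R => t - s) (- 1).
  by apply: is_derive_eq; rewrite add0r mul1r.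
have := @is_derive1_comp _ G (fun s => t - s) s _ _ h h1.
by rewrite mulrN1.
Qed.

(** The fundamental theorem of calculus for the antiderivative [s |-> - G (t - s)]. *)
Lemma Rintegral_rev (G g : R -> R) (t : R) : 0 < t ->
  (forall s : R, is_derive s (1 : R) G (g s)) ->
  (forall s : R, {for s, continuous g}) ->
  Rintegral mu `[0, t] (fun s => g (t - s)) = G t - G 0.
Proof.
move=> t0 dG cg.
have dF (s : R) : is_derive s (1 : R) (fun s => - G (t - s)) (g (t - s)).
  have := is_deriveN (is_derive_rev (dG (t - s))).
  by rewrite opprK.
rewrite /Rintegral (@continuous_FTC2 _ _ (fun s => - G (t - s)))//.
- by rewrite /= subrr subr0 opprK addrC.
- apply: continuous_subspaceT => s.
  apply: (@continuous_comp _ _ _ (fun s : R => t - s) g); last exact: cg.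
  by apply: cvgB; [exact: cvg_cst|exact: cvg_id].
- split=> [s _||]; first by case: (dF s).
    apply: cvg_at_right_filter; exact: (is_derive_cont (dF 0)).
  apply: cvg_at_left_filter; exact: (is_derive_cont (dF t)).
- by move=> s _; rewrite derive1E; case: (dF s).
Qed.

End Integral.

(** * The integral of the matrix exponential and its first order expansion *)

Section ExpIntegral.
Variables (R : realType) (k : nat) (X : 'M[R]_k).

(** The entrywise 1-norm: its powers bound all entries of the powers of [X]. *)
Definition mxsum : R := \sum_i \sum_j `|X i j|.
Let b := mxsum.

Lemma mxsum_ge0 : 0 <= b.
Proof. by apply: sumr_ge0 => ? _; apply: sumr_ge0. Qed.

Lemma norm_mxexp_le p i j : `|(X ^+ p) i j| <= b ^+ p.
Proof.
have b0 := mxsum_ge0; elim: p i j => [|p IH] i j.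
  rewrite !expr0 -[1]/(1%:M) mxE.
  by case: (i == j); rewrite ?normr1 ?normr0.
rewrite exprS -[_ * _]/(_ *m _) mxE (le_trans (ler_norm_sum _ _ _))// exprS.
rewrite (@le_trans _ _ ((\sum_l `|X i l|) * b ^+ p))//.
  by rewrite mulr_suml ler_sum// => l _; rewrite normrM ler_wpM2l.
rewrite ler_wpM2r ?exprn_ge0// /b /mxsum [leRHS](bigD1 i)//= lerDl.
by apply: sumr_ge0 => ? _; apply: sumr_ge0.
Qed.

Lemma cvg_pseries_exp (c : nat -> R) (C B t : R) : 0 <= C -> 0 <= B ->
  (forall p, `|c p| <= C * (B ^+ p / p`!%:R)) -> cvgn (pseries c t).
Proof.
move=> C0 B0 cB; apply: normed_cvg.
apply: (@series_le_cvg _ _ (fun p => C *: exp_coeff (B * `|t|) p)).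
- by move=> p; rewrite normr_ge0.
- by move=> p; rewrite mulr_ge0// exp_coeff_ge0// mulr_ge0.
- move=> p; rewrite /exp_coeff/= normrM normrX.
  have := ler_wpM2r (exprn_ge0 p (normr_ge0 t)) (cB p).
  by rewrite exprMn -[_ *: _]/(_ * _) -!mulrA (mulrC (p`!%:R^-1)).
- apply: is_cvg_seriesZ; exact: is_cvg_series_exp_coeff.
Qed.

Let ecoef i j p : R := (X ^+ p) i j / p`!%:R.

Let icoef i j p : R := if p is q.+1 then (X ^+ q) i j / p`!%:R else 0.

(* The entries of [\int_0^t exp (s X) ds]. *)
Definition iexpmx (t : R) : 'M[R]_k := \matrix_(i, j) limn (pseries (icoef i j) t).

Let expmxE (t : R) i j : expmx (t *: X) i j = limn (pseries (ecoef i j) t).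
Proof.
have exprZ p : (t *: X) ^+ p = t ^+ p *: X ^+ p.
  elim: p => [|p IH]; first by rewrite !expr0 scale1r.
  by rewrite !exprS IH -[LHS]/(_ *m _) -scalemxAl -scalemxAr scalerA.
rewrite mxE /pseries; congr (limn (series _)); apply/funext => p.
by rewrite /ecoef /= exprZ mxE -mulrA mulrC.
Qed.

Let diffs_icoef i j : pseries_diffs (icoef i j) = ecoef i j.
Proof.
apply/funext => p; rewrite /pseries_diffs /icoef /ecoef factS natrM invfM.
by rewrite mulrCA; congr (_ * _); rewrite mulrA divff ?mul1r // pnatr_eq0.
Qed.

(** The coefficient of index [p] in [icoef] contains [X ^+ p.-1]; a base at least 1 allows the bound
    [B ^+ p]. *)
Let B := 1 + b.

Let B_ge1 : 1 <= B. Proof. by rewrite lerDl mxsum_ge0. Qed.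

Let leB p i j : `|(X ^+ p) i j| <= B ^+ p.
Proof.
by rewrite (le_trans (norm_mxexp_le p i j))// lerXn2r ?nnegrE ?mxsum_ge0 ?lerDr//
  (le_trans ler01).
Qed.

Let fact_ge0 p : 0 <= (p`!%:R : R)^-1. Proof. by rewrite invr_ge0. Qed.

Let cvg_icoef i j t : cvgn (pseries (icoef i j) t).
Proof.
apply: (@cvg_pseries_exp _ 1 B) => //; first exact: le_trans ler01 _.
case=> [|p]; rewrite /icoef mul1r ?normr0 ?mulr_ge0//.
rewrite normrM normfV normr_nat ler_wpM2r//.
by rewrite (le_trans (leB p i j))// exprS ler_peMl// exprn_ge0// (le_trans ler01).
Qed.

Let cvg_ecoef i j t : cvgn (pseries (ecoef i j) t).
Proof.
apply: (@cvg_pseries_exp _ 1 B) => //; first exact: le_trans ler01 _.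
by move=> p; rewrite /ecoef mul1r normrM normfV normr_nat ler_wpM2r.
Qed.

Let cvg_decoef i j t : cvgn (pseries (pseries_diffs (ecoef i j)) t).
Proof.
have B0 : 0 <= B by exact: le_trans ler01 _.
apply: (@cvg_pseries_exp _ B B) => // p.
rewrite /pseries_diffs /ecoef factS natrM invfM mulrCA.
rewrite [p.+1%:R * _]mulrA divff ?mul1r ?pnatr_eq0//.
by rewrite normrM normfV normr_nat mulrA -exprS ler_wpM2r.
Qed.

Lemma is_derive_iexpmx (t : R) i j :
  is_derive t (1 : R) (fun s => iexpmx s i j) (expmx (t *: X) i j).
Proof.
rewrite (_ : (fun s => _) = (fun s => limn (pseries (icoef i j) s))); last first.
  by apply/funext => s; rewrite mxE.
rewrite expmxE -diffs_icoef.
apply: (@pseries_snd_diffs _ _ (`|t| + 1)); rewrite ?diffs_icoef//.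
by rewrite [ltRHS]ger0_norm ?ltrDl// addr_ge0.
Qed.

Lemma iexpmx0 i j : iexpmx 0 i j = 0.
Proof.
rewrite mxE; apply: cvg_lim => //; apply: cvg_near_cst; apply: nearW => p.
rewrite /pseries /series /= big1// => -[|q] _; first by rewrite mul0r.
by rewrite exprS mul0r mulr0.
Qed.

(** The series is [1 + X / 2 + X ^ 2 / 6 + ...]. From the quadratic term on, the entries are at most
    [b ^ 2 / 2] times a geometric series of ratio 1/2. *)
Lemma iexpmx1_le i j : b <= 2^-1 ->
  `|iexpmx 1 i j - (i == j)%:R - X i j / 2| <= b ^+ 2.
Proof.
move=> b2; have b0 := mxsum_ge0.
pose S n := pseries (icoef i j) 1 n.
have SS n : S n.+1 = S n + icoef i j n.
  by rewrite /S /pseries /series /= big_nat_recr //= expr1n mulr1.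
pose m := (i == j)%:R + X i j / 2.
have S3 : S 3 = m.
  rewrite !SS /S /pseries /series /= big_geq // /icoef /m expr0 expr1.
  have E1 : (1 : 'M[R]_k) i j = (i == j)%:R by rewrite -[1]/(1%:M) mxE.
  by rewrite E1 -[1`!]/1%N -[(1 + 1)%R`!]/2%N !add0r divr1.
have main n : `|S n.+3 - m| <= b ^+ 2 * (1 - 2^-1 ^+ n).
  elim: n => [|n IH]; first by rewrite S3 subrr normr0 expr0 subrr mulr0.
  rewrite SS addrAC (le_trans (ler_normD _ _))//.
  have : `|icoef i j n.+3| <= b ^+ 2 * (2^-1 ^+ n / 2).
    rewrite /icoef normrM normfV normr_nat.
    rewrite (@le_trans _ _ (b ^+ n.+2 / 2))//.
      apply: ler_pM => //; rewrite ?norm_mxexp_le//.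
      rewrite lef_pV2 ?posrE ?ltr0n ?fact_gt0// ler_nat.
      by rewrite factS (leq_trans _ (leq_pmulr _ _)) ?fact_gt0.
    rewrite -addn2 exprD (mulrC (b ^+ n)) -mulrA.
    rewrite ler_wpM2l ?exprn_ge0// ler_wpM2r ?invr_ge0//.
    by rewrite lerXn2r ?nnegrE// invr_ge0.
  move=> h; apply: le_trans (lerD IH h) _.
  by rewrite -mulrDr ler_wpM2l ?exprn_ge0// exprS; lra.
have bound n : (3 <= n)%N -> m - b ^+ 2 <= S n <= m + b ^+ 2.
  move=> /subnK <-; rewrite addn3 -ler_distl.
  by rewrite (le_trans (main _))// -[leRHS]mulr1 ler_wpM2l ?exprn_ge0//.
rewrite -addrA -opprD -/m mxE ler_distl; apply/andP; split.
  apply: limr_ge; first exact: cvg_icoef.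
  by exists 3%N => // n /= n3; have /andP[] := bound n n3.
apply: limr_le; first exact: cvg_icoef.
by exists 3%N => // n /= n3; have /andP[] := bound n n3.
Qed.

Lemma Rintegral_expmx (t : R) (v : 'cV[R]_k) i : 0 < t ->
  Rintegral (@lebesgue_measure R) `[0, t]
    (fun s => (expmx ((t - s) *: X) *m v) i 0) = (iexpmx t *m v) i 0.
Proof.
move=> t0.
rewrite [LHS](@Rintegral_rev _ (fun s => (iexpmx s *m v) i 0)
  (fun s => (expmx (s *: X) *m v) i 0))//.
- rewrite [X in _ - X](_ : _ = 0) ?subr0// mxE big1// => j _.
  by rewrite iexpmx0 mul0r.
- move=> s; rewrite (_ : (fun s => _) = \sum_j (fun s => iexpmx s i j * v j 0)); last first.
    by apply/funext => u; rewrite mxE fct_sumE.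
  rewrite mxE; apply: is_derive_sum => j.
  have h := is_derive_iexpmx s i j.
  by apply: is_derive_eq; rewrite scaler0 add0r mulrC.
- move=> s.
  suff h : is_derive s (1 : R) (fun s => (expmx (s *: X) *m v) i 0)
      (\sum_j (X *m expmx (s *: X)) i j * v j 0) by exact: is_derive_cont h.
  rewrite (_ : (fun s => _) = \sum_j (fun s => expmx (s *: X) i j * v j 0)); last first.
    by apply/funext => u; rewrite mxE fct_sumE.
  apply: is_derive_sum => j.
  have h := is_derive_expmx X s i j.
  by apply: is_derive_eq; rewrite scaler0 add0r mulrC.
Qed.

Lemma iexpmx_cont (v : 'cV[R]_k) i (t : R) :
  {for t, continuous (fun s => (iexpmx s *m v) i 0)}.
Proof.
suff h : is_derive t (1 : R) (fun s => (iexpmx s *m v) i 0)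
    (\sum_j (expmx (t *: X)) i j * v j 0) by exact: is_derive_cont h.
rewrite (_ : (fun s => _) = \sum_j (fun s => iexpmx s i j * v j 0)); last first.
  by apply/funext => u; rewrite mxE fct_sumE.
apply: is_derive_sum => j.
have h := is_derive_iexpmx t i j.
by apply: is_derive_eq; rewrite scaler0 add0r mulrC.
Qed.

Lemma enorm_iexpmx_cvg (v : 'cV[R]_k) :
  enorm (iexpmx t *m v) @[t --> (1 : R)^'] --> enorm (iexpmx 1 *m v).
Proof.
apply: cvg_within_filter.
apply: (@continuous_comp _ _ _ (fun t => \sum_i (iexpmx t *m v) i 0 ^+ 2) Num.sqrt);
  last exact: sqrt_continuous.
apply: (@cvg_big _ _ +%R) => [|i _]; first exact: add_continuous.
by apply: cvgM; exact: iexpmx_cont.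
Qed.

End ExpIntegral.

(** With [u = v + y] and [y = X v / 2 + r], the 2 of the cross term cancels the 1/2 of the series
    and leaves [v * X v]. The rest, [2 v r + y ^ 2], is of order [b ^ 2], since [k * b <= 1/2] gives
    [|y| <= b]. *)
Lemma iexpmx_sq_le (R : realType) (k : nat) (X : 'M[R]_k) (v : 'cV[R]_k) :
  (0 < k)%N -> k%:R * mxsum X <= 2^-1 -> (forall i, `|v i 0| <= 1) ->
  `|\sum_i (iexpmx X 1 *m v) i 0 ^+ 2 -
    (\sum_i v i 0 ^+ 2 + \sum_i v i 0 * (X *m v) i 0)|
  <= 3 * k%:R ^+ 2 * mxsum X ^+ 2.
Proof.
move=> k0 kb v1; set b := mxsum X in kb *.
have b0 : 0 <= b by apply: mxsum_ge0.
have k1 : 1 <= k%:R :> R by rewrite ler1n.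
have b2 : b <= 2^-1 by rewrite (le_trans _ kb)// ler_peMl.
pose r i := (iexpmx X 1 *m v) i 0 - v i 0 - (X *m v) i 0 / 2.
have rE i : `|r i| <= k%:R * b ^+ 2.
  have -> : r i = \sum_j (iexpmx X 1 i j - (i == j)%:R - X i j / 2) * v j 0.
    rewrite /r !mxE (_ : v i 0 = \sum_j (i == j)%:R * v j 0); last first.
      rewrite (bigD1 i)//= eqxx mul1r big1 ?addr0// => j /negPf ji.
      by rewrite eq_sym ji mul0r.
    rewrite mulr_suml -!sumrB; apply: eq_bigr => j _; lra.
  rewrite (le_trans (ler_norm_sum _ _ _))//.
  rewrite (@le_trans _ _ (\sum_(j < k) b ^+ 2))//; last first.
    by rewrite sumr_const card_ord mulr_natl.
  apply: ler_sum => j _; rewrite normrM -[leRHS]mulr1 ler_pM//.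
  exact: iexpmx1_le.
have XvE i : `|(X *m v) i 0| <= b.
  rewrite mxE (le_trans (ler_norm_sum _ _ _))// /b /mxsum [leRHS](bigD1 i)//=.
  rewrite (@le_trans _ _ (\sum_j `|X i j|))//.
    by apply: ler_sum => j _; rewrite normrM ler_piMr.
  by rewrite lerDl; apply: sumr_ge0 => ? _; apply: sumr_ge0.
rewrite -big_split/= -sumrB (le_trans (ler_norm_sum _ _ _))//.
rewrite (@le_trans _ _ (\sum_(j < k) (3 * k%:R * b ^+ 2)))//; last first.
  by rewrite sumr_const card_ord -mulr_natl expr2; lra.
apply: ler_sum => i _; set u := (iexpmx X 1 *m v) i 0.
set y := (X *m v) i 0 / 2 + r i.
have uE : u = v i 0 + y by rewrite /y /r /u; lra.
have yb : `|y| <= b.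
  have h := le_trans (ler_normD ((X *m v) i 0 / 2) (r i)) _.
  rewrite /y h//.
  have : `|(X *m v) i 0 / 2| <= b / 2.
    by rewrite normrM (ger0_norm (_ : 0 <= 2^-1)) ?invr_ge0// ler_wpM2r ?invr_ge0.
  have : k%:R * b ^+ 2 <= b / 2 by rewrite expr2 mulrA mulrC ler_wpM2l.
  have := rE i; lra.
have -> : u ^+ 2 - (v i 0 ^+ 2 + v i 0 * (X *m v) i 0) =
    2 * v i 0 * r i + y ^+ 2.
  by rewrite uE /y; field.
apply: le_trans (ler_normD _ _) _.
have : `|2 * v i 0 * r i| <= 2 * (1 * (k%:R * b ^+ 2)).
  by rewrite -mulrA normrM ger0_norm// ler_wpM2l// normrM ler_pM.
have : `|y ^+ 2| <= b ^+ 2 by rewrite normrX lerXn2r ?nnegrE.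
have : b ^+ 2 <= k%:R * b ^+ 2 by rewrite ler_peMl ?exprn_ge0.
by rewrite mul1r -[3 * _ * _]mulrA; lra.
Qed.

(** The unit of the later estimates: each factor [n] is paid for by one factor [t = 2 ^ -n]. *)
Lemma pow2_inv_le (R : realFieldType) (n : nat) :
  let t : R := 2^-1 ^+ n in 0 < t /\ n%:R * t <= 1.
Proof.
move=> t; have t0 : 0 < t by rewrite exprn_gt0// invr_gt0.
split=> //; rewrite /t exprVn ler_pdivrMr ?exprn_gt0// mul1r.
by rewrite -natrX ler_nat ltnW// ltn_expl.
Qed.

(** * Stability of small perturbations of a negative multiple of the identity *)

Lemma Re_sum (R : rcfType) (I : finType) (F : I -> R[i]) :
  complex.Re (\sum_i F i) = \sum_i complex.Re (F i).
Proof. by apply: (big_morph (@complex.Re R)) => // -[a b] [c d]. Qed.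

Lemma Im_sum (R : rcfType) (I : finType) (F : I -> R[i]) :
  complex.Im (\sum_i F i) = \sum_i complex.Im (F i).
Proof. by apply: (big_morph (@complex.Im R)) => // -[a b] [c d]. Qed.

(** By [|x y| <= (x ^ 2 + y ^ 2) / 2], a perturbation of [- a I] with entries at most [c] adds at
    most [k * c] times the squared norm. *)
Lemma quad_dominant (R : realFieldType) (k : nat) (X : 'M[R]_k) (a c : R)
    (x : 'I_k -> R) :
  (forall i j, `|X i j + a * (i == j)%:R| <= c) ->
  \sum_j (\sum_i x i * X i j) * x j <= (k%:R * c - a) * \sum_i x i ^+ 2.
Proof.
move=> Xc; set S := \sum_i x i ^+ 2.
have -> : \sum_j (\sum_i x i * X i j) * x j =
    \sum_j \sum_i x i * (X i j + a * (i == j)%:R) * x j - a * S.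
  rewrite /S mulr_sumr -sumrB; apply: eq_bigr => j _.
  have -> : \sum_i x i * (X i j + a * (i == j)%:R) * x j =
      \sum_i x i * X i j * x j + a * x j ^+ 2.
    under eq_bigr do rewrite mulrDr mulrDl.
    rewrite big_split /=; congr (_ + _).
    rewrite (bigD1 j) //= eqxx big1 ?addr0 => [|i /negPf ->]; last by rewrite !(mulr0, mul0r).
    by rewrite mulr1 expr2; ring.
  by rewrite mulr_suml addrK.
rewrite mulrBl lerD2r.
have cross i j : x i * (X i j + a * (i == j)%:R) * x j <= c / 2 * (x i ^+ 2 + x j ^+ 2).
  have c0 : 0 <= c by apply: le_trans (Xc i j).
  have h : `|x i * x j| <= (x i ^+ 2 + x j ^+ 2) / 2.
    rewrite ler_norml; apply/andP; split.
      by have := sqr_ge0 (x i + x j); rewrite sqrrD; lra.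
    by have := sqr_ge0 (x i - x j); rewrite sqrrB; lra.
  apply: le_trans (ler_norm _) _; rewrite mulrAC normrM mulrC.
  have := ler_pM (normr_ge0 _) (normr_ge0 _) (Xc i j) h.
  by move=> /le_trans; apply; lra.
apply: (@le_trans _ _ (\sum_(j < k) \sum_(i < k) c / 2 * (x i ^+ 2 + x j ^+ 2))).
  by apply: ler_sum => j _; apply: ler_sum.
have -> : \sum_(j < k) \sum_(i < k) c / 2 * (x i ^+ 2 + x j ^+ 2) =
    \sum_(j < k) (c / 2 * S + c / 2 * (k%:R * x j ^+ 2)).
  apply: eq_bigr => j _; rewrite -mulr_sumr big_split /= sumr_const card_ord.
  by rewrite mulrDr -[_ *+ k]mulr_natl.
rewrite big_split /= sumr_const card_ord -mulr_sumr -mulr_sumr -/S -mulr_natl.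
by rewrite le_eqVlt; apply/orP; left; apply/eqP; field.
Qed.

(** For a left eigenvector with real part [x] and imaginary part [y], the terms in [Im z] cancel
    when the quadratic forms at [x] and [y] are added, leaving [Re z] times a positive squared
    norm. *)
Lemma hurwitz_dominant (R : realType) (k : nat) (X : 'M[R]_k) (a c : R) :
  (forall i j, `|X i j + a * (i == j)%:R| <= c) -> k%:R * c < a -> hurwitz X.
Proof.
move=> Xc ca z /eigenvalueP[v vX v0].
pose x i := complex.Re (v 0 i); pose y i := complex.Im (v 0 i).
have Rer (w : R[i]) (r : R) : complex.Re (w * complex.real_complex R r) = complex.Re w * r.
  by case: w => p q /=; rewrite mulr0 subr0.
have Imr (w : R[i]) (r : R) : complex.Im (w * complex.real_complex R r) = complex.Im w * r.
  by case: w => p q /=; rewrite mulr0 add0r.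
have eR j : \sum_i x i * X i j = complex.Re z * x j - complex.Im z * y j.
  have /(congr1 (fun u : 'rV__ => complex.Re (u 0 j))) := vX.
  rewrite !mxE Re_sum; under eq_bigr do rewrite mxE Rer.
  by move=> ->; rewrite /x /y; case: (z) (v 0 j) => p q [r s].
have eI j : \sum_i y i * X i j = complex.Re z * y j + complex.Im z * x j.
  have /(congr1 (fun u : 'rV__ => complex.Im (u 0 j))) := vX.
  rewrite !mxE Im_sum; under eq_bigr do rewrite mxE Imr.
  by move=> ->; rewrite /x /y; case: (z) (v 0 j) => p q [r s].
have := lerD (quad_dominant x Xc) (quad_dominant y Xc).
under eq_bigr do rewrite eR; under [X in _ + X <= _]eq_bigr do rewrite eI.
rewrite -big_split /= -mulrDr -big_split /=.
have -> : \sum_j ((complex.Re z * x j - complex.Im z * y j) * x j +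
     (complex.Re z * y j + complex.Im z * x j) * y j) =
   complex.Re z * \sum_j (x j ^+ 2 + y j ^+ 2).
  by rewrite mulr_sumr; apply: eq_bigr => j _; ring.
set S := \sum_j _ => h.
have S0 : 0 < S.
  have [j vj] : exists j, v 0 j != 0.
    apply/existsP; apply: contraR v0 => /existsPn h0.
    by apply/eqP/rowP => j; rewrite mxE; apply/eqP; rewrite -[_ == _]negbK h0.
  rewrite /S (bigD1 j) //= ltr_wpDr ?sumr_ge0 // => [i _|].
    by rewrite addr_ge0 ?sqr_ge0.
  rewrite lt_neqAle addr_ge0 ?sqr_ge0 // andbT eq_sym paddr_eq0 ?sqr_ge0 //.
  rewrite !sqrf_eq0; apply: contra vj; rewrite /x /y.
  by rewrite eq_complex.
by move: h; rewrite ler_pM2r // => /le_lt_trans; apply; rewrite subr_lt0.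
Qed.

(* The error in [iexpmx_sq_le] is O(n ^ 6 * alpha ^ 2); it has to stay below
   gamma, the weight of one edge of the cut. *)
Definition alpha (n : nat) : rat := (2 ^+ (8 * n + 10))^-1.
Definition gamma (n : nat) : rat := (2 ^+ (10 * n + 12))^-1.

(** Agents have dimension 1. [B = -1] gives the Laplacian a positive sign, so that cut edges
    increase the error. The strategy is the constant 1, which meets both bounds with equality, and
    the initial state is 0. *)
Definition placement (n : nat) (adj : 'M[bool]_n) (cost : 'cV[rat]_n)
    (om : rat) : rat_instance :=
  @Instance _ _ n 1 adj (const_mx (- alpha n)) (const_mx (-1)) (gamma n)
    (const_mx 0) cost om 1 (const_mx 1) (const_mx 1) 1.

(** * The objective of a placement up to second order *)

Section Placement.
Variables (R : realType) (n : nat) (ad : 'M[bool]_n) (cs : 'cV[rat]_n) (om : rat).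
Hypotheses (n_gt0 : (0 < n)%N) (ad_sym : symmetric (fun i j => ad i j)).
Hypothesis ad_irr : irreflexive (fun i j => ad i j).

Let I := real_instance R (placement ad cs om).

Let al : R := ratr (alpha n).
Let ga : R := ratr (gamma n).
Let t : R := 2^-1 ^+ n.

Let t_gt0 : 0 < t. Proof. by have [] := pow2_inv_le R n. Qed.
Let nt_le1 : n%:R * t <= 1. Proof. by have [] := pow2_inv_le R n. Qed.

Let alE : al = t ^+ 8 / 1024.
Proof.
rewrite /al /alpha fmorphV rmorphXn /= ratr_nat exprD invfM.
rewrite -!exprVn mulnC exprM; congr (_ * _).
by rewrite exprVn -natrX.
Qed.

Let gaE : ga = t ^+ 10 / 4096.
Proof.
rewrite /ga /gamma fmorphV rmorphXn /= ratr_nat exprD invfM.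
rewrite -!exprVn mulnC exprM; congr (_ * _).
by rewrite exprVn -natrX.
Qed.

Definition nbrs (i : 'I_n) : nat := #|[set j | ad i j]%SET|.
Definition degsum (A : {set 'I_n}) : nat := (\sum_(i in A) nbrs i)%N.
(** Counts ordered pairs, so an edge inside [A] counts twice and [degsum A - inner A] is the number
    of edges leaving [A]. *)
Definition inner (A : {set 'I_n}) : nat := (\sum_(i in A) \sum_(j in A) ad i j)%N.

Let lap : 'M[R]_n := laplacian I.

Lemma placement_mxM (i j : 'I_n) (z z' : 'I_1) :
  mxM I (mxtens_index (i, z)) (mxtens_index (j, z')) =
  ga * lap i j - al * (i == j)%:R.
Proof.
rewrite /mxM [LHS]mxE tensmxE [X in _ + X]mxE [X in - X]mxE tensmxE.
rewrite -[dbar I]/ga -[laplacian I]/lap; set l := lap i j.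
rewrite !mxE rmorphN rmorphN /= rmorph1 -/al; lra.
Qed.
Lemma sum_tens1 (V : nmodType) (F : 'I_(n * 1) -> V) :
  \sum_k F k = \sum_i F (mxtens_index (i, ord0 : 'I_1)).
Proof.
rewrite (reindex (@mxtens_index n 1)) /=; last first.
  by exists (@mxtens_unindex n 1) => k _; rewrite ?mxtens_indexK ?mxtens_unindexK.
rewrite (eq_bigr (fun p => F (mxtens_index (p.1, p.2)))); last by case.
rewrite -(pair_bigA _ (fun i (z : 'I_1) => F (mxtens_index (i, z)))) /=.
by apply: eq_bigr => i _; rewrite big_ord1.
Qed.

Let chi (A : {set 'I_n}) : 'cV[R]_(n * 1) :=
  \col_k ((mxtens_unindex k).1 \in A)%:R.

Let chiE A (i : 'I_n) (z : 'I_1) : chi A (mxtens_index (i, z)) 0 = (i \in A)%:R.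
Proof. by rewrite mxE mxtens_indexK. Qed.

Lemma strategy1 (s : R) i : strategy I i 0 s = 1.
Proof. by rewrite !mxE rmorph1 hornerC. Qed.

Lemma tens_indic (A : {set 'I_n}) (s : R) :
  (tensmx (indic (I := I) A) (theta I s) : 'cV[R]_(n * 1)) = chi A.
Proof. by apply/matrixP => k l; rewrite !mxE rmorph1 hornerC mulr1. Qed.

(** The free motion cancels in the difference, and times close to 1 are positive, where the integral
    formula applies. *)
Lemma objectiveE (A : {set 'I_n}) :
  objective (I := I) A = enorm (iexpmx (mxM I) 1 *m chi A).
Proof.
apply: cvg_lim => //; rewrite [tc I](_ : _ = 1); last by rewrite /= rmorph1.
apply: cvg_trans; last exact: (@enorm_iexpmx_cvg _ _ (mxM I) (chi A)).
apply: near_eq_cvg; apply: nbhs_dnbhs; near=> s.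
have s0 : 0 < s by near: s; apply: lt_nbhsr.
congr enorm; rewrite /attacked_state /free_state addrAC subrr add0r.
apply/colP => k; rewrite [RHS]mxE -(Rintegral_expmx (mxM I) (chi A) k s0).
by congr (Rintegral _ _ _); apply/funext => u; rewrite tens_indic.
Unshelve. all: by end_near. Qed.

Let lapE i j : lap i j = if i == j then (nbrs i)%:R else - (ad i j)%:R.
Proof. by rewrite mxE. Qed.

Let al_gt0 : 0 < al.
Proof. by rewrite alE; apply: divr_gt0; [exact: exprn_gt0|rewrite ltr0n]. Qed.

Let ga_gt0 : 0 < ga.
Proof. by rewrite gaE; apply: divr_gt0; [exact: exprn_gt0|rewrite ltr0n]. Qed.

(** The exponents 8 and 10 differ by 2, which pays for [n ^ 2]. *)
Let ga_al : n%:R ^+ 2 * ga <= al / 4.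
Proof.
rewrite gaE alE.
have : (n%:R * t) ^+ 2 * t ^+ 8 <= 1 * t ^+ 8.
  apply: ler_wpM2r; first exact/exprn_ge0/ltW.
  by apply: exprn_ile1 => //; apply: mulr_ge0 => //; apply: ltW.
have -> : (n%:R * t) ^+ 2 * t ^+ 8 = n%:R ^+ 2 * t ^+ 10 by ring.
lra.
Qed.

Let ga_al1 : n%:R * ga <= al / 4.
Proof.
apply: le_trans ga_al; apply: ler_wpM2r; first exact: ltW.
by rewrite expr2 ler_peMl ?ler1n.
Qed.

Let nbrs_le i : (nbrs i <= n)%N.
Proof. by rewrite (leq_trans (max_card _)) ?card_ord. Qed.

Let mxM_le k l : `|mxM I k l| <= 2 * al.
Proof.
rewrite -[k]mxtens_unindexK -[l]mxtens_unindexK.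
case: (mxtens_unindex k) (mxtens_unindex l) => i z [j z'].
rewrite placement_mxM; apply: le_trans (ler_normB _ _) _.
rewrite (normrM ga) (normrM al) (gtr0_norm ga_gt0) (gtr0_norm al_gt0).
have : `|lap i j| <= n%:R.
  rewrite lapE; case: ifP => _; first by rewrite normr_nat ler_nat.
  rewrite normrN normr_nat; case: (ad i j) => //=; by rewrite ler1n.
move=> /(ler_wpM2l (ltW ga_gt0)).
have : al * `|(i == j)%:R| <= al.
  by rewrite normr_nat; case: (i == j); rewrite ?mulr1 ?mulr0 // ltW.
have := ga_al1; have := al_gt0; lra.
Qed.

Let mxsum_le : mxsum (mxM I) <= n%:R ^+ 2 * (2 * al).
Proof.
rewrite /mxsum (@le_trans _ _ (\sum_(k < n * 1) \sum_(l < n * 1) (2 * al)))//.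
  by apply: ler_sum => k _; apply: ler_sum => l _; exact: mxM_le.
rewrite !sumr_const !card_ord muln1 -!mulrnA -[_ *+ _]mulr_natl natrM expr2.
by rewrite lexx.
Qed.

Definition value (A : {set 'I_n}) : R :=
  #|A|%:R * (1 - al) + ga * ((degsum A)%:R - (inner A)%:R).

Lemma quadratic_form (A : {set 'I_n}) :
  \sum_k chi A k 0 ^+ 2 + \sum_k chi A k 0 * (mxM I *m chi A) k 0 = value A.
Proof.
rewrite !sum_tens1.
under eq_bigr do rewrite chiE expr2 -natrM mulnb andbb.
under [X in _ + X]eq_bigr do rewrite chiE mxE sum_tens1.
have mulb (i : 'I_n) (x : R) : (i \in A)%:R * x = if i \in A then x else 0.
  by case: (i \in A); rewrite ?mul1r ?mul0r.
have -> : \sum_i (i \in A)%:R = #|A|%:R :> R.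
  by rewrite -sum1_card natr_sum [RHS]big_mkcond; apply: eq_bigr => i _; case: (i \in A).
have -> : \sum_(i < n) (i \in A)%:R *
      (\sum_(j < n) mxM I (mxtens_index (i, ord0)) (mxtens_index (j, ord0)) *
         chi A (mxtens_index (j, ord0)) 0) =
    \sum_(i in A) (ga * (nbrs i)%:R - al - ga * (\sum_(j in A) ad i j)%N%:R).
  rewrite [RHS]big_mkcond; apply: eq_bigr => i _; rewrite mulb.
  case: ifP => // iA.
  rewrite (bigD1 i) //= chiE iA mulr1 placement_mxM lapE eqxx mulr1.
  congr (_ + _); rewrite natr_sum mulr_sumr -sumrN.
  rewrite [RHS](bigD1 i) //= ad_irr mulr0 oppr0 add0r.
  rewrite big_mkcond [RHS]big_mkcond; apply: eq_bigr => j _.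
  case: eqVneq => [->|ji]; first by rewrite andbF.
  rewrite andbT chiE placement_mxM lapE eq_sym (negPf ji) mulr0 subr0.
  by case: (j \in A); rewrite ?mulr1 ?mulr0 // mulrN.
rewrite !sumrB sumr_const -!mulr_sumr /value /degsum /inner !natr_sum.
rewrite -[al *+ _]mulr_natl; ring.
Qed.

(** The norm of the matrix is at most [2 n ^ 2 al], so the error is at most [12 n ^ 6 al ^ 2]. Of
    the factor [t ^ 16], six powers absorb [n ^ 6]; what remains is [12 t ^ 10 / 1024 ^ 2], below
    [ga / 4 = t ^ 10 / 16384]. *)
Lemma objective_sq (A : {set 'I_n}) : exists2 F : R,
  objective (I := I) A = Num.sqrt F & 0 <= F /\ `|F - value A| <= ga / 4.
Proof.
exists (\sum_k (iexpmx (mxM I) 1 *m chi A) k 0 ^+ 2); first by rewrite objectiveE.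
split; first by apply: sumr_ge0 => *; exact: sqr_ge0.
have n1 : 1 <= n%:R :> R by rewrite ler1n.
have t0 := ltW t_gt0; have nt0 : 0 <= n%:R * t by rewrite mulr_ge0.
have nal : n%:R ^+ 3 * al <= 1024^-1.
  rewrite alE; have : (n%:R * t) ^+ 3 * t ^+ 5 <= 1 * 1.
    have t1 : t <= 1 by apply: le_trans nt_le1; rewrite ler_peMl // ltW.
    by apply: ler_pM; [exact: exprn_ge0|exact: exprn_ge0|exact: exprn_ile1|
      exact: (exprn_ile1 5 t0 t1)].
  by rewrite exprMn -mulrA -exprD; lra.
rewrite -quadratic_form; apply: le_trans (iexpmx_sq_le _ _ _) _.
- by rewrite muln1.
- rewrite [X in X * _](_ : _ = n%:R); last by rewrite muln1.
  have := ler_wpM2l (ler0n R n) mxsum_le.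
  have -> : n%:R * (n%:R ^+ 2 * (2 * al)) = 2 * (n%:R ^+ 3 * al) by ring.
  by move: nal; lra.
- by move=> k; rewrite mxE normr_nat; case: (_ \in A); rewrite ?ler1n.
- rewrite [X in 3 * X ^+ 2](_ : _ = n%:R); last by rewrite muln1.
  have : mxsum (mxM I) ^+ 2 <= (n%:R ^+ 2 * (2 * al)) ^+ 2.
    have h0 : 0 <= n%:R ^+ 2 * (2 * al).
      by apply: mulr_ge0; [exact: exprn_ge0|exact: mulr_ge0 (ler0n _ _) (ltW al_gt0)].
    by rewrite lerXn2r ?nnegrE ?mxsum_ge0.
  move=> /(ler_wpM2l (_ : 0 <= 3 * n%:R ^+ 2)) h.
  apply: le_trans (h _) _; first by rewrite mulr_ge0 ?exprn_ge0.
  rewrite alE gaE.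
  have h1 : (n%:R * t) ^+ 6 * t ^+ 10 <= 1 * t ^+ 10.
    by rewrite ler_wpM2r ?exprn_ile1 ?exprn_ge0.
  have -> : 3 * n%:R ^+ 2 * (n%:R ^+ 2 * (2 * (t ^+ 8 / 1024))) ^+ 2 =
     (n%:R * t) ^+ 6 * t ^+ 10 * (12 / 1024 / 1024) by field.
  have := exprn_ge0 10 (ltW t_gt0); lra.
Qed.
(** The approximations cost [ga / 2] in all. An additional agent gains [1 - al], while the cut terms
    differ by at most [2 n ^ 2 ga <= al / 2]; at equal cardinality cut sizes are integers, and one
    edge is worth [ga]. The comparison is thus lexicographic. *)
Lemma objective_le (A A' : {set 'I_n}) :
  objective (I := I) A' <= objective (I := I) A ->
  (#|A'| <= #|A|)%N /\ (#|A'| = #|A| ->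
    degsum A' + inner A <= degsum A + inner A')%N.
Proof.
have [F -> [F0 FA]] := objective_sq A; have [F' -> [F0' FA']] := objective_sq A'.
rewrite ler_sqrt // => FF.
have vv : value A' <= value A + ga / 2.
  by move: FA FA'; rewrite !ler_norml => /andP[? ?] /andP[? ?]; lra.
have ga0 := ga_gt0; have al0 := al_gt0.
have bound (B : {set 'I_n}) : (degsum B)%:R <= n%:R ^+ 2 :> R /\
    (inner B)%:R <= n%:R ^+ 2 :> R.
  have le2 (f : 'I_n -> nat) : (forall i, f i <= n)%N ->
      (\sum_(i in B) f i)%N%:R <= n%:R ^+ 2 :> R.
    move=> fn; rewrite -natrX ler_nat; apply: (@leq_trans (\sum_(i < n) n)%N).
      by rewrite big_mkcond leq_sum // => i _; case: ifP.
    by rewrite sum_nat_const card_ord mulnn.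
  split; first exact: le2.
  apply: le2 => i; rewrite -[leqRHS]card_ord -sum1_card big_mkcond leq_sum //.
  by move=> j _; case: ifP => // _; case: (ad i j).
have al1 : al <= 1024^-1.
  rewrite alE; have : t ^+ 8 <= 1; last lra.
  have t0 := ltW t_gt0; apply: (exprn_ile1 8) => //.
  by apply: le_trans nt_le1; rewrite ler_peMl // ler1n.
split.
  rewrite leqNgt; apply/negP => AA'.
  have {AA'} : #|A|%:R + 1 <= #|A'|%:R :> R by rewrite natr1 ler_nat.
  move: vv (bound A) (bound A'); rewrite /value => vv [d e] [d' e'] AA'.
  have h1 : (#|A|%:R + 1) * (1 - al) <= #|A'|%:R * (1 - al).
    by rewrite ler_wpM2r //; lra.
  have i0 := ler0n R (inner A); have i0' := ler0n R (degsum A').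
  have j0 := ler0n R (inner A'); have j0' := ler0n R (degsum A).
  have h2 : ga * ((degsum A)%:R - (inner A)%:R) <= ga * n%:R ^+ 2.
    by rewrite ler_wpM2l //; lra.
  have h3 : - (ga * n%:R ^+ 2) <= ga * ((degsum A')%:R - (inner A')%:R).
    by rewrite -mulrN ler_wpM2l //; lra.
  have h4 : ga <= al / 4.
    by apply: le_trans ga_al1; rewrite ler_peMl ?ler1n // ltW.
  have := ga_al; lra.
move=> AA'; rewrite leqNgt; apply/negP => h.
have {h} : (degsum A)%:R + (inner A')%:R + 1 <= (degsum A')%:R + (inner A)%:R :> R.
  by rewrite -!natrD natr1 ler_nat.
move=> h; move: vv; rewrite /value AA'.
have : ga * 1 <= ga * ((degsum A')%:R - (inner A')%:R - ((degsum A)%:R - (inner A)%:R)).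
  by apply: ler_wpM2l; [exact: ltW|move: h; lra].
lra.
Qed.

Let tcE : tc I = 1. Proof. by rewrite /= rmorph1. Qed.

Lemma feasibleE (A : {set 'I_n}) :
  feasible (I := I) A <-> \sum_(i in A) cs i 0 <= om.
Proof.
have costE : \sum_(i in A) cost I i 0 <= budget I = (\sum_(i in A) cs i 0 <= om).
  rewrite -(ler_rat R) rmorph_sum /=; congr (_ <= _).
  by apply: eq_bigr => i _; rewrite mxE.
split=> [[_]|h]; first by rewrite costE.
split; last 2 first.
- by rewrite costE.
- move=> j; rewrite (_ : strategy I j 0 = fun=> 1); last first.
    by apply/funext => s; rewrite strategy1.
  rewrite tcE (@Rintegral_rev _ id (fun=> 1)) //.
  + by rewrite subr0 !mxE rmorph1.
  + by move=> s; exact: cst_continuous.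
- move=> i s _; rewrite /= rmorph1 /enorm /false_data.
  case: ifP => _.
    rewrite (eq_bigr (fun=> 1)) => [|k _]; last by rewrite mxE strategy1 expr1n.
    by rewrite sumr_const card_ord sqrtr1.
  rewrite big1 ?sqrtr0 // => k _.
  by rewrite mxE expr0n.
Qed.

Lemma placement_well_formed (eps : R) : 0 < eps ->
  (forall i j, connect (fun i j => ad i j) i j) -> (exists i j, ad i j) ->
  (forall i, 0 <= cs i 0) -> 0 <= om -> well_formed I eps.
Proof.
move=> eps0 conn [i0 [j0 ij]] cs0 om0.
have dE i : deg (I := I) i = nbrs i by [].
have dmax_le : (dmax I <= n)%N.
  by apply/bigmax_leqP => i _; rewrite dE.
have dmax_gt0 : (0 < dmax I)%N.
  apply: leq_trans (leq_bigmax i0); rewrite dE /nbrs card_gt0.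
  by apply/set0Pn; exists j0; rewrite inE.
have ga0 := ga_gt0; have al0 := al_gt0.
have al1 : al <= 1024^-1.
  rewrite alE; have : t ^+ 8 <= 1; last lra.
  have t0 := ltW t_gt0; apply: (exprn_ile1 8) => //.
  by apply: le_trans nt_le1; rewrite ler_peMl // ler1n.
have gan : ga * (dmax I)%:R < 1.
  apply: (@le_lt_trans _ _ (n%:R * ga)).
    by rewrite mulrC; apply: ler_wpM2r; [exact: ltW|rewrite ler_nat].
  by have := ga_al1; lra.
have ct i : {within `[0, tc I], continuous (strategy I i 0)}.
  rewrite (_ : strategy I i 0 = fun=> 1); last by apply/funext => s; rewrite strategy1.
  by apply: continuous_subspaceT => s; exact: cst_continuous.
split=> //=.
- by rewrite -/ga ga0 /= -[X in _ < X]mul1r ltr_pdivlMr ?ltr0n.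
- rewrite /controllable; apply/eqP; rewrite eqn_leq rank_leq_row /= lt0n mxrank_eq0.
  apply/negP => /eqP/(congr1 (fun Y => submxrow Y (ord0 : 'I_1))).
  rewrite mxrowK expr0 => /matrixP/(_ 0 0).
  rewrite -[1 *m _]/(1%:M *m _) mul1mx !mxE rmorphN rmorph1 => /eqP.
  by rewrite oppr_eq0 oner_eq0.
(* Entries of the Laplacian are at most [n] in absolute value, and [n * (ga * n)] stays below
   [al]. *)
- apply: (@hurwitz_dominant _ _ _ al (ga * n%:R)) => [k l|].
    rewrite -[k]mxtens_unindexK -[l]mxtens_unindexK.
    case: (mxtens_unindex k) (mxtens_unindex l) => i z [j z'].
    rewrite placement_mxM (can_eq (@mxtens_indexK n 1)) xpair_eqE.
    rewrite [z]ord1 [z']ord1 eqxx andbT subrK (normrM ga) (gtr0_norm ga_gt0).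
    apply: ler_wpM2l; first exact: ltW.
    rewrite lapE; case: ifP => _; first by rewrite normr_nat ler_nat.
    rewrite normrN normr_nat; case: (ad i j) => //=; by rewrite ler1n.
  rewrite [X in X * _](_ : _ = n%:R); last by rewrite muln1.
  have := ga_al; rewrite expr2; have -> : n%:R * n%:R * ga = n%:R * (ga * n%:R) by ring.
  lra.
- by move=> i; rewrite mxE ler0q.
- by rewrite ler0q.
- by rewrite rmorph1.
(* The free motion stays at 0, so time 0 belongs to the set and the infimum is at most 0. *)
- rewrite rmorph1; apply: (@le_lt_trans _ _ 0) => //.
  apply: ge_inf; first by exists 0 => x [].
  split=> // s _; rewrite /free_state (_ : x0 I = 0).
    rewrite mulmx0 /enorm big1 ?sqrtr0 ?ltW // => k _.
    by rewrite mxE expr0n.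
  by apply/matrixP => k l; rewrite !mxE rmorph0.
- by move=> i; apply: continuous_compact_integrable; [exact: segment_compact|exact: ct].
Qed.

End Placement.

Local Close Scope classical_set_scope.

(** * From tableaux to placements *)

Section Optimal.
Variables (R : realType) (n : nat) (ad : 'M[bool]_n) (good : pred 'I_n).
Variables (a0 : 'I_n) (n0 X : nat).
Hypotheses (n_gt0 : (0 < n)%N) (ad_sym : symmetric (fun i j => ad i j)).
Hypotheses (ad_irr : irreflexive (fun i j => ad i j)) (Xn : (X < n)%N).
Hypothesis good_deg : forall i, good i -> (nbrs ad i + (i == a0) = n0)%N.

(** A single bad agent costs [n], which already exceeds the budget [X < n]. *)
Let cs : 'cV[rat]_n := \col_i (if good i then 1 else n)%:R.
Let I := real_instance R (placement ad cs X%:R).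

Definition independent (A : {set 'I_n}) : Prop :=
  {in A, forall i, good i} /\ {in A &, forall i j, ~~ ad i j}.

Lemma feasible_good (A : {set 'I_n}) :
  feasible (I := I) A <-> {in A, forall i, good i} /\ (#|A| <= X)%N.
Proof.
rewrite feasibleE (eq_bigr (fun i => (if good i then 1 else n)%:R)); last first.
  by move=> i _; rewrite mxE.
rewrite -natr_sum ler_nat; split=> [h|[g AX]]; last first.
  by rewrite (eq_bigr (fun=> 1%N)) ?sum1_card // => i /g ->.
have g : {in A, forall i, good i}.
  move=> i iA; apply: contraTT Xn => ig; rewrite -leqNgt (leq_trans _ h) //.
  by rewrite (bigD1 i) //= (negPf ig) leq_addr.
split=> //; move: h; rewrite (eq_bigr (fun=> 1%N)) ?sum1_card // => i /g -> //.
Qed.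

Lemma degsum_good (A : {set 'I_n}) : {in A, forall i, good i} ->
  (degsum ad A + (a0 \in A) = #|A| * n0)%N.
Proof.
move=> g; rewrite -sum_nat_const -(eq_bigr _ (fun i (iA : i \in A) => good_deg (g i iA))).
rewrite big_split /=; congr (_ + _)%N.
rewrite big_mkcond (bigD1 a0) //= eqxx big1 => [|i /negPf ->]; last by case: ifP.
by rewrite addn0; case: ifP.
Qed.

Lemma inner_independent (A : {set 'I_n}) :
  {in A &, forall i j, ~~ ad i j} -> inner ad A = 0%N.
Proof.
move=> ind; apply: big1 => i iA; apply: big1 => j jA.
by rewrite (negPf (ind i j iA jA)).
Qed.

(** By symmetry every edge contributes in both orders, so a single edge would give at least 2. *)
Lemma inner_le1 (A : {set 'I_n}) : (inner ad A <= 1)%N ->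
  {in A &, forall i j, ~~ ad i j}.
Proof.
move=> le1 i j iA jA; apply: contraTN le1 => ij; rewrite -ltnNge.
have ji : j != i by apply: contraTneq ij => ->; rewrite ad_irr.
rewrite /inner (bigD1 i) //= (bigD1 j) //= ij.
rewrite [X in (_ + X)%N](bigD1 j) ?jA //= [X in (_ + (X + _))%N](bigD1 i) //=.
have -> : ad j i by have /= -> := ad_sym j i.
lia.
Qed.

Lemma optimal_exists : exists A, optimal (I := I) A.
Proof.
pose P : pred {set 'I_n} := fun A => `[< feasible (I := I) A >].
have f0 : P finset.set0.
  by apply/asboolP/feasible_good; rewrite cards0; split=> // i; rewrite inE.
case: (@arg_maxP _ _ _ finset.set0 P (objective (I := I)) f0) => A /asboolP fA AP.
exists A; split; first exact: fA.
by move=> A' fA'; apply: AP; apply/asboolP.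
Qed.

(** Against an independent [A'] of size [X], optimality gives [degsum A' + inner A <= degsum A], and
    each [degsum] is [X * n0], less 1 if the set contains [a0]. So [inner A <= 1], hence no edge at
    all; if [A'] avoids [a0], no room is left for [a0] in [A] either. *)
Lemma optimal_independent (A A1 : {set 'I_n}) :
  optimal (I := I) A -> independent A1 -> #|A1| = X ->
  [/\ independent A, #|A| = X &
    forall A0, independent A0 -> #|A0| = X -> a0 \notin A0 -> a0 \notin A].
Proof.
move=> [fA opt] [g1 i1] c1.
have [gA cA] := (feasible_good A).1 fA.
have feas A' : independent A' -> #|A'| = X -> feasible (I := I) A'.
  by move=> [g' _] c'; apply/feasible_good; rewrite c'.
have cmp A' : independent A' -> #|A'| = X ->
    #|A| = X /\ (degsum ad A' + inner ad A <= degsum ad A)%N.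
  move=> iA' c'; have [le1 le2] := objective_le n_gt0 ad_irr (opt _ (feas _ iA' c')).
  have AX : #|A| = X by apply/eqP; rewrite eqn_leq cA -{1}c'.
  split=> //; have := le2 (etrans c' (esym AX)).
  by rewrite (inner_independent iA'.2) addn0.
have [AX le1] := cmp A1 (conj g1 i1) c1.
have dA := degsum_good gA.
split=> //.
  split=> //; apply: inner_le1.
  have := degsum_good g1; rewrite c1 -AX -dA; case: (a0 \in A) (a0 \in A1) => [] []; lia.
move=> A0 ind0 c0 a0A0; have [_] := cmp A0 ind0 c0.
have := degsum_good ind0.1; rewrite (negPf a0A0) c0 -AX -dA.
by case: (a0 \in A) => //; lia.
Qed.

End Optimal.

Local Close Scope ring_scope.
Local Open Scope nat_scope.

Lemma sum_pair_bool (T : finType) (F : T * bool -> nat) :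
  \sum_v F v = \sum_d (F (d, true) + F (d, false)).
Proof.
rewrite (eq_bigr (fun v => F (v.1, v.2))); last by case.
rewrite -(pair_bigA _ (fun d s => F (d, s))) /=.
by apply: eq_bigr => d _; rewrite big_bool.
Qed.

(** * The conflict graph with fillers *)

Section Agents.
Variables (M : machine) (noquery : oracle_free M).
Variables (H : nat) (w : bits).
Hypothesis H_gt0 : 0 < H.

Let D := option (cell M).

(* A vertex [(d, true)] can be compromised at cost 1 if [d] is allowed; the
   [(d, false)] are fillers that make all degrees equal, except that the
   escape lacks one neighbour.  The escape comes first, so that it is
   agent 0 when placed in row 0 and column 0. *)
Definition vals : seq (D * bool) :=
  (None, true) :: [seq v <- enum {: D * bool} | v != (None, true)].

Definition nvals : nat := size vals.

Lemma vals_uniq : uniq vals.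
Proof. by rewrite /= mem_filter eqxx /= filter_uniq // enum_uniq. Qed.

Lemma mem_vals v : v \in vals.
Proof. by rewrite inE mem_filter mem_enum andbT orbN. Qed.

Definition valn (e : nat) : D * bool := nth (None, true) vals e.

(** Seen from [(d, true)], each position and value [d'] supplies exactly one neighbour, [(d', true)]
    or its filler. The exception is [None], which is not joined to its own filler. *)
Definition adjacent (cy ci : nat) (p q : D * bool) : bool :=
  match p.2, q.2 with
  | true, true => conflict cy ci p.1 q.1
  | false, false => ~~ [&& cy == 0, ci == 0 & p.1 == q.1]
  | _, _ => ~~ conflict cy ci p.1 q.1 &&
            ~~ [&& cy == 0, ci == 0, p.1 == None & q.1 == None]
  end.

Definition rown (k : nat) : nat := (k %/ nvals) %/ H.
Definition coln (k : nat) : nat := (k %/ nvals) %% H.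

Definition adjn (k l : nat) : bool :=
  adjacent (diff_class (rown k) (rown l)) (diff_class (coln k) (coln l))
    (valn (k %% nvals)) (valn (l %% nvals)).

Definition goodn (k : nat) : bool :=
  (valn (k %% nvals)).2 &&
  allowed (rown k == 0) (coln k == 0) (input_at H w (rown k) (coln k))
    (valn (k %% nvals)).1.

Definition nagts : nat := H * H * nvals.

Definition adjm : 'M[bool]_nagts := \matrix_(i, j) adjn i j.

Definition index_val (v : D * bool) : 'I_nvals :=
  Ordinal (etrans (index_mem v vals) (mem_vals v)).

Definition agent (y i : 'I_H) (v : D * bool) : 'I_nagts :=
  mxtens_index (mxtens_index (y, i), index_val v).

Let nvals_gt0 : 0 < nvals. Proof. by []. Qed.

Lemma agentE y i v : agent y i v = (y * H + i) * nvals + index v vals :> nat.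
Proof. by []. Qed.

Lemma agent_div y i v : agent y i v %/ nvals = y * H + i.
Proof.
by rewrite agentE divnMDl // [_ %/ nvals]divn_small ?addn0 // index_mem mem_vals.
Qed.

Lemma agent_row y i v : rown (agent y i v) = y.
Proof. by rewrite /rown agent_div divnMDl // divn_small // addn0. Qed.

Lemma agent_col y i v : coln (agent y i v) = i.
Proof. by rewrite /coln agent_div modnMDl modn_small. Qed.

Lemma agent_val y i v : valn (agent y i v %% nvals) = v.
Proof.
rewrite agentE modnMDl modn_small ?index_mem ?mem_vals // /valn nth_index //.
exact: mem_vals.
Qed.

Lemma agentP (k : 'I_nagts) : exists y i v, k = agent y i v.
Proof.
case e1: (mxtens_unindex k) => [p e]; case e2: (mxtens_unindex p) => [y i].
exists y, i, (valn e); rewrite /agent -[k]mxtens_unindexK e1 -[p]mxtens_unindexK e2.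
congr (mxtens_index (_, _)); apply/val_inj.
by rewrite -[RHS]/(index (nth (None, true) vals e) vals) index_uniq ?vals_uniq //.
Qed.

Lemma agent_inj y i v y' i' v' : agent y i v = agent y' i' v' ->
  [/\ y = y', i = i' & v = v'].
Proof.
move=> e; split; first by apply/val_inj; rewrite /= -(agent_row y i v) e agent_row.
  by apply/val_inj; rewrite /= -(agent_col y i v) e agent_col.
by rewrite -(agent_val y i v) e agent_val.
Qed.

Lemma adjm_agent y i v y' i' v' : adjm (agent y i v) (agent y' i' v') =
  adjacent (diff_class y y') (diff_class i i') v v'.
Proof. by rewrite mxE /adjn !agent_row !agent_col !agent_val. Qed.

Lemma diff_class_lt4 a b : diff_class a b < 4.
Proof. by rewrite /diff_class; do 3?case: ifP. Qed.

Lemma diff_class_eq0 a b : (diff_class a b == 0) = (a == b).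
Proof. by rewrite /diff_class; case: (a == b); case: (a == b + 1); case: (b == a + 1). Qed.

Lemma adjm_sym : symmetric (fun i j => adjm i j).
Proof.
move=> k l; have [y [i [[d s] ->]]] := agentP k; have [y' [i' [[d' s'] ->]]] := agentP l.
rewrite !adjm_agent /adjacent /= (diff_class_swap y y') (diff_class_swap i i').
have c0 a b : (swap_class (diff_class a b) == 0) = (diff_class a b == 0).
  by rewrite -diff_class_swap !diff_class_eq0 eq_sym.
rewrite conflict_sym ?diff_class_lt4 // !c0.
by case: s s' => [] []; rewrite // ?(eq_sym d d') // (andbC (d == None)).
Qed.

Lemma adjm_irr : irreflexive (fun i j => adjm i j).
Proof.
move=> k; have [y [i [[d [] ->]]]] := agentP k;
  rewrite adjm_agent /adjacent /= !diff_classxx ?conflictxx ?eqxx //.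
Qed.

Let hub : 'I_nagts := agent (Ordinal H_gt0) (Ordinal H_gt0) (None, false).
Definition agent0 : 'I_nagts := agent (Ordinal H_gt0) (Ordinal H_gt0) (None, true).

Lemma agent0E : agent0 = 0 :> nat.
Proof. by []. Qed.

Lemma adjm_filler y i d y' i' d' : agent y i (d, false) != agent y' i' (d', false) ->
  adjm (agent y i (d, false)) (agent y' i' (d', false)).
Proof.
move=> ne; rewrite adjm_agent /adjacent /= !diff_class_eq0; apply: contra ne.
by move=> /and3P[/eqP/val_inj -> /eqP/val_inj -> /eqP ->].
Qed.

Let some_cell : cell M := ((true, (start M, idle (start M) [ffun=> None])),
  ([ffun=> None], [ffun=> None])).

(** Fillers form a clique, and the vertex of a cell is joined to its own filler. The vertex of
    [None] is reached through a cell of the same position, with which it conflicts. *)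
Lemma adjm_connected i j : connect (fun i j => adjm i j) i j.
Proof.
have csym : connect_sym (fun i j => adjm i j).
  by apply: sym_connect_sym => u v; exact: adjm_sym.
suff c k : connect (fun i j => adjm i j) k hub.
  by apply: connect_trans (c i) _; rewrite csym.
have cf y x d : connect (fun i j => adjm i j) (agent y x (d, false)) hub.
  have [->|ne] := eqVneq (agent y x (d, false)) hub; first exact: connect0.
  exact/connect1/adjm_filler.
have cs y x v : connect (fun i j => adjm i j) (agent y x (Some v, true)) hub.
  apply: connect_trans (cf y x (Some v)); apply: connect1.
  by rewrite adjm_agent /adjacent /= !diff_classxx eqxx.
have [y [x [[[v|] []] ->]]] := agentP k; rewrite ?cf ?cs //.
apply: connect_trans (cs y x some_cell); apply: connect1.
by rewrite adjm_agent /adjacent /= !diff_classxx.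
Qed.

Lemma adjm_edge : exists i j, adjm i j.
Proof.
exists hub, (agent (Ordinal H_gt0) (Ordinal H_gt0) (Some some_cell, false)).
by apply/adjm_filler/eqP => /agent_inj[].
Qed.

Lemma sum_agents (F : 'I_nagts -> nat) :
  \sum_k F k = \sum_y \sum_i \sum_(v : D * bool) F (agent y i v).
Proof.
have bij : bijective (fun p : ('I_H * 'I_H) * (D * bool) => agent p.1.1 p.1.2 p.2).
  apply: inj_card_bij.
    by move=> [[y i] v] [[y' i'] v'] /agent_inj[/= -> -> ->].
  rewrite !card_prod !card_ord /nagts leq_mul //.
  rewrite /nvals -(card_uniqP vals_uniq) -card_prod; exact: max_card.
rewrite (reindex _ (onW_bij _ bij)) /=.
by rewrite pair_bigA /= pair_bigA.
Qed.

Lemma good_degree (k : 'I_nagts) : goodn k ->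
  nbrs adjm k + (k == agent0) = H * H * #|{: D}|.
Proof.
have [y [i [[d s] ->]]] := agentP k.
rewrite /goodn agent_row agent_col agent_val /= => /andP[-> /= al].
have k0 : (agent y i (d, true) == agent0) = (d == None).
  apply/eqP/eqP => [/agent_inj[_ _ []]//|dN]; move: al; rewrite dN /= => /andP[y0 i0].
  by congr (agent _ _ _); apply/val_inj/eqP.
rewrite k0 /nbrs -sum1_card big_mkcond sum_agents.
have -> : H * H * #|{: D}| = \sum_(y' < H) \sum_(i' < H) #|{: D}|.
  by rewrite !sum_nat_const !card_ord mulnA.
(* The missing neighbour is written as a sum over positions, then over values, so that the two sides
   can be compared term by term. *)
have -> : (d == None : nat) =
    \sum_(y' < H) \sum_(i' < H) [&& y == y', i == i' & d == None].
  rewrite (bigD1 y) //= (bigD1 i) //= !eqxx /= !big1 ?addn0 //.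
    by move=> y' /negPf ny; apply: big1 => i' _; rewrite eq_sym ny.
  by move=> i' /negPf ni; rewrite eq_sym ni.
rewrite -big_split; apply: eq_bigr => y' _; rewrite -big_split; apply: eq_bigr => i' _.
rewrite /= sum_pair_bool.
have -> : ([&& y == y', i == i' & d == None] : nat) =
    \sum_(d' : D) [&& y == y', i == i', d == None & d' == None].
  rewrite (bigD1 None) //= eqxx andbT big1 ?addn0 // => d' /negPf ->.
  by rewrite !andbF.
rewrite -big_split -sum1_card /=; apply: eq_bigr => d' _.
rewrite !inE !adjm_agent /adjacent /= !diff_class_eq0 -[y == y']val_eqE -[i == i']val_eqE /=.
case: (boolP [&& y == y' :> nat, i == i' :> nat, d == None & d' == None]) => [|ns].
  move=> /and4P[/eqP/val_inj <- /eqP/val_inj <- /eqP-> /eqP->].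
  by rewrite !diff_classxx.
by rewrite andbT; case: (conflict _ _ _ _).
Qed.

Local Notation goodp := (fun k : 'I_nagts => goodn k).

Lemma solution_independent (asg : nat -> nat -> option (cell M)) :
  solution H w asg -> exists A : {set 'I_nagts},
  [/\ independent adjm goodp A, #|A| = H * H &
      (agent0 \in A) = (asg 0 0 == None)].
Proof.
move=> [alw nconf].
pose f (p : 'I_H * 'I_H) := agent p.1 p.2 (asg p.1 p.2, true).
exists [set f p | p in [set: 'I_H * 'I_H]]; split.
- split=> [k /imsetP[[y i] _ ->]|k l /imsetP[[y i] _ ->] /imsetP[[y' i'] _ ->]].
    by rewrite /f /goodn agent_row agent_col agent_val /= alw.
  by rewrite adjm_agent /adjacent /= nconf.
- rewrite card_imset ?cardsT ?card_prod ?card_ord //.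
  by move=> [y i] [y' i'] /agent_inj[/= -> ->].
- apply/imsetP/eqP => [[[y i] _] /agent_inj[/= <- <- [<-]] //|e].
  by exists (Ordinal H_gt0, Ordinal H_gt0); rewrite ?inE // /f /= e.
Qed.

(** Different values at one position conflict, so [pos] is injective on [A]; with [H * H] elements
    it is onto, and every cell receives exactly one value. *)
Lemma independent_solution (A : {set 'I_nagts}) :
  independent adjm goodp A -> #|A| = H * H ->
  exists2 asg : nat -> nat -> option (cell M),
    solution H w asg & (agent0 \in A) = (asg 0 0 == None).
Proof.
move=> [gA iA] cA.
pose pos (k : 'I_nagts) : 'I_H * 'I_H := mxtens_unindex (mxtens_unindex k).1.
have posE y i v : pos (agent y i v) = (y, i) by rewrite /pos !mxtens_indexK.
have pos_inj : {in A &, injective pos}.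
  move=> k l; have [y [i [[d s] ->]]] := agentP k; have [y' [i' [[d' s'] ->]]] := agentP l.
  move=> kA lA; rewrite !posE => -[yy ii]; subst y' i'.
  have := gA _ kA; have := gA _ lA; rewrite /goodn !agent_val /=.
  move=> /andP[s'1 _] /andP[s1 _]; rewrite s'1 s1 in kA lA *.
  have := iA _ _ kA lA; rewrite adjm_agent /adjacent /= !diff_classxx conflict00 negbK.
  by move=> /eqP ->.
have full : [set pos k | k in A] = [set: 'I_H * 'I_H].
  apply/eqP; rewrite eqEcard finset.subsetT card_in_imset // cA cardsT card_prod.
  by rewrite !card_ord leqnn.
have ex (y i : 'I_H) : exists d, agent y i (d, true) \in A.
  have : (y, i) \in [set pos k | k in A] by rewrite full inE.
  move=> /imsetP[k kA]; have [y' [i' [[d s] e]]] := agentP k.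
  rewrite e posE => -[-> ->]; exists d; rewrite e in kA.
  by have := gA _ kA; rewrite /goodn agent_val /= => /andP[<-].
pose asg (y i : nat) : option (cell M) :=
  match insub y, insub i with
  | Some y', Some i' => xchoose (ex y' i')
  | _, _ => None
  end.
have asgP (y i : 'I_H) : agent y i (asg y i, true) \in A.
  by rewrite /asg !valK; exact: (xchooseP (ex y i)).
have asg_uniq (y i : 'I_H) d : agent y i (d, true) \in A -> d = asg y i.
  move=> dA; have := pos_inj _ _ dA (asgP y i); rewrite !posE.
  by move=> /(_ erefl) /agent_inj[_ _ []].
exists asg; last first.
  apply/idP/eqP => [/asg_uniq <- //|e].
  by have := asgP (Ordinal H_gt0) (Ordinal H_gt0); rewrite /= e.
split=> [y i yH iH|y i y' i' yH iH yH' iH'].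
  have := gA _ (asgP (Ordinal yH) (Ordinal iH)).
  by rewrite /goodn agent_row agent_col agent_val.
apply/negbTE.
have := iA _ _ (asgP (Ordinal yH) (Ordinal iH)) (asgP (Ordinal yH') (Ordinal iH')).
by rewrite adjm_agent.
Qed.

Lemma independent_accepts (A : {set 'I_nagts}) :
  independent adjm goodp A -> #|A| = H * H -> agent0 \notin A ->
  accepts_within no_oracle H.-1 (init M w).
Proof.
move=> iA cA; have [asg [alw nconf] ->] := independent_solution iA cA => a00.
(* [None] is allowed only in row 0, column 0, and there it would put [agent0] into [A]. *)
have some y i : y < H -> i < H -> asg y i = Some (odflt some_cell (asg y i)).
  move=> yH iH; have := alw _ _ yH iH; case e : (asg y i) => [v|] //=.
  by move=> /andP[/eqP y0 /eqP i0]; move: e a00; rewrite y0 i0 => ->.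
apply: (sound noquery (asg := fun y i => odflt some_cell (asg y i)) H_gt0).
split=> *; first by rewrite -some //; exact: alw.
by rewrite -!some //; exact: nconf.
Qed.

Lemma nagts_gt0 : 0 < nagts.
Proof. by rewrite !muln_gt0 H_gt0. Qed.

Lemma budget_lt : H * H < nagts.
Proof.
rewrite /nagts -{1}[H * H]muln1 ltn_pmul2l ?muln_gt0 ?H_gt0 //.
have : size ([:: (None, true); (None, false)] : seq (D * bool)) <= size vals.
  by apply: uniq_leq_size => // v _; exact: mem_vals.
by [].
Qed.

Definition attack_instance : rat_instance :=
  placement adjm (\col_i (if goodn i then 1 else nagts)%:R)%R (H * H)%:R%R.

Lemma attack_instance_correct (R : realType) (A : {set 'I_nagts}) :
  optimal (I := real_instance R attack_instance) A ->
  accepts_within no_oracle H.-1 (init M w) <-> agent0 \notin A.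
Proof.
move=> opt.
have [asg1 [sol1 _]] := escape noquery w H_gt0.
have [A1 [ind1 card1 _]] := solution_independent sol1.
have [indA cA best] := optimal_independent (R := R) (a0 := agent0)
  nagts_gt0 adjm_sym adjm_irr budget_lt good_degree opt ind1 card1.
split=> [acc|]; last exact: independent_accepts.
have [asg sol] := complete noquery H_gt0 acc.
have [A0 [ind0 card0 e0]] := solution_independent sol.
by apply: best ind0 card0 _; rewrite e0.
Qed.

Lemma attack_instance_optimal (R : realType) :
  exists A : {set 'I_nagts}, optimal (I := real_instance R attack_instance) A.
Proof. by apply: optimal_exists; exact: budget_lt. Qed.

Lemma attack_instance_well_formed (R : realType) (eps : R) : (0 < eps)%R ->
  well_formed (real_instance R attack_instance) eps.
Proof.
move=> eps0; apply: placement_well_formed => //.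
- exact: nagts_gt0.
- exact: adjm_sym.
- exact: adjm_irr.
- exact: adjm_connected.
- exact: adjm_edge.
- by move=> i; rewrite mxE ler0n.
Qed.

End Agents.

(** * Printing the instance *)

(** Agents are numbered in mixed radix, so a loop over agents becomes nested loops over row, column
    and value. *)
Lemma flatten_iota_mul (T : Type) (F : nat -> seq T) a b :
  flatten [seq F k | k <- iota 0 (a * b)] =
  flatten [seq flatten [seq F (x * b + z) | z <- iota 0 b] | x <- iota 0 a].
Proof.
elim: a => // a IH; rewrite mulSn addnC iotaD map_cat flatten_cat IH.
rewrite -[a.+1]addn1 iotaD map_cat flatten_cat /= cats0 add0n; congr (_ ++ _).
by rewrite -[X in iota X]addn0 iotaDl -map_comp.
Qed.

Lemma enc_mx_nat (T : Type) (e : T -> bits) k l (F : nat -> nat -> T) :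
  enc_mx e (\matrix_(i < k, j < l) F i j)%R =
  flatten [seq flatten [seq e (F i j) | j <- iota 0 l] | i <- iota 0 k].
Proof.
rewrite /enc_mx -[in RHS](val_enum_ord k) -map_comp; congr flatten.
apply: eq_map => i /=; rewrite -[in RHS](val_enum_ord l) -map_comp; congr flatten.
by apply: eq_map => j /=; rewrite mxE.
Qed.

Lemma enc_mx_const (T : Type) (e : T -> bits) k l (c : T) :
  enc_mx e (const_mx c : 'M[T]_(k, l)) =
  flatten [seq flatten [seq e c | _ <- iota 0 l] | _ <- iota 0 k].
Proof.
rewrite -(enc_mx_nat e k l (fun _ _ => c)); congr enc_mx.
by apply/matrixP => i j; rewrite !mxE.
Qed.

Lemma enc_rat_nat (n : nat) : enc_rat n%:R%R = enc_int n ++ enc_int 1.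
Proof. by rewrite /enc_rat -[n%:R%R]/(n%:Q%R) numq_int denq_int. Qed.

Lemma num_den_pow2 a : numq (2 ^+ a)^-1%R = 1%Z /\ denq (2 ^+ a)^-1%R = Posz (2 ^ a).
Proof.
have e : ((2 ^+ a)^-1 = (1%:~R / (Posz (2 ^ a))%:~R) :> rat)%R.
  by rewrite mul1r -natrX.
rewrite e; split; [rewrite coprimeq_num|rewrite coprimeq_den]; rewrite ?coprime1n //.
  by rewrite gtr0_sg ?mul1r // ltz_nat expn_gt0.
by rewrite eqz_nat expn_eq0.
Qed.

Lemma enc_rat_pow2 a :
  enc_rat (2 ^+ a)^-1%R = false :: enc_nat 1 ++ false :: enc_nat (2 ^ a).
Proof. by have [n d] := num_den_pow2 a; rewrite /enc_rat n d. Qed.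

Lemma enc_rat_opp_pow2 a :
  enc_rat (- (2 ^+ a)^-1)%R = true :: enc_nat 0 ++ false :: enc_nat (2 ^ a).
Proof. by have [n d] := num_den_pow2 a; rewrite /enc_rat numqN denqN n d. Qed.

(** The digits are [a] zeros and a one: a loop of length [a] prints a number too large to be held in
    unary in a register. *)
Lemma enc_nat_pow2 a : enc_nat (2 ^ a) =
  flatten [seq [:: true; false] | _ <- iota 0 a] ++ [:: true; true; false].
Proof.
rewrite /enc_nat; have -> : digits (2 ^ a) = nseq a false ++ [:: true].
  rewrite /digits trunc_expnK // -[a.+1]addn1 iotaD map_cat /= divnn expn_gt0 /=.
  congr (_ ++ _); transitivity [seq false | _ <- iota 0 a].
    apply/eq_in_map => i; rewrite mem_iota /= => ia.
    by rewrite -expnB ?(ltnW ia) // oddX; lia.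
  by elim: a 0 => //= a IH m; rewrite IH.
rewrite /enc_seq map_cat flatten_cat -catA; congr (_ ++ _).
by elim: a 0 => //= a IH m; rewrite (IH m.+1).
Qed.

Fixpoint ecats (l : seq emitter) : emitter :=
  if l is c :: l' then ECat c (ecats l') else EBits [::].

Lemma out_ecats l w rho : out (ecats l) w rho = flatten [seq out c w rho | c <- l].
Proof. by elim: l => //= c l ->. Qed.

Lemma scoped_ecats l r : scoped (ecats l) r = all (fun c => scoped c r) l.
Proof. by elim: l => //= c l ->. Qed.

Definition ecls (a b : nat) (f : nat -> emitter) : emitter :=
  EIfEq a b 0 (f 0) (EIfEq a b 1 (f 1) (EIfEq b a 1 (f 2) (f 3))).

Lemma out_ecls a b f w rho :
  out (ecls a b f) w rho = out (f (diff_class (nth 0 rho a) (nth 0 rho b))) w rho.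
Proof. by rewrite /= addn0 /diff_class; do 3?case: ifP. Qed.

Lemma scoped_ecls a b f r : a < r -> b < r -> (forall c, scoped (f c) r) ->
  scoped (ecls a b f) r.
Proof. by move=> ar br wff; rewrite /= ar br !wff. Qed.

Definition epow2 (a : nat) : emitter :=
  ECat (EFor a (EBits [:: true; false])) (EBits [:: true; true; false]).

Lemma out_epow2 a w rho : out (epow2 a) w rho = enc_nat (2 ^ nth 0 rho a).
Proof. by rewrite enc_nat_pow2. Qed.

Lemma nth_rcons4 (r : seq nat) l y i y' i' : size r = l ->
  let r' := rcons (rcons (rcons (rcons r y) i) y') i' in
  [/\ nth 0 r' l = y, nth 0 r' (l + 1) = i, nth 0 r' (l + 2) = y' &
      nth 0 r' (l + 3) = i'].
Proof.
move=> <- r'; have -> : r' = r ++ [:: y; i; y'; i'] by rewrite /r' -!cats1 -!catA.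
have nthD k : nth 0 (r ++ [:: y; i; y'; i']) (size r + k) = nth 0 [:: y; i; y'; i'] k.
  by rewrite nth_cat ltnNge leq_addr addKn.
by have := nthD 0; rewrite addn0 !nthD.
Qed.

(** [K] successive squarings raise the value of register [r] to the power [2 ^ K]. *)
Fixpoint squares (K r : nat) (c : emitter) : emitter :=
  if K is K'.+1 then ELet r r 0 (squares K' r.+1 c) else c.

Lemma out_squares K r c w rho : size rho = r.+1 -> exists rho',
  [/\ size rho' = (r + K).+1, nth 0 rho' (r + K) = iter K (fun x => x * x) (nth 0 rho r),
      forall j, j < r -> nth 0 rho' j = nth 0 rho j
    & out (squares K r c) w rho = out c w rho'].
Proof.
elim: K r rho => [|K IH] r rho sz; first by exists rho; rewrite addn0.
have [|rho' [s' n' p' o']] := IH r.+1 (rcons rho (nth 0 rho r * nth 0 rho r + 0)).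
  by rewrite size_rcons sz.
exists rho'; split.
- by rewrite s' addnS.
- rewrite -addSnnS n' iterSr; congr (iter _ _ _).
  by rewrite nth_rcons sz ltnn eqxx addn0.
- by move=> j jr; rewrite p' ?nth_rcons ?sz; last exact: ltnW; rewrite ltnS ltnW.
- by rewrite /= o'.
Qed.

Lemma scoped_squares K r c : scoped (squares K r c) r.+1 = scoped c (r + K).+1.
Proof. by elim: K r => [|K IH] r /=; rewrite ?addn0 // ltnSn IH addSnnS. Qed.

(** * The emitter of the attack instance *)

Section Program.
Variables (M : machine) (K : nat).

Let Q := nvals M.
(** Register numbers as bound in [program]: the side [H], then [H * H], the number of values per
    position, the number [N] of agents, and the exponents of [alpha] and [gamma]. [l] is the first
    register free for loop indices. *)
Let rH := K + 2.
Let rX := rH + 1.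
Let rQ := rH + 2.
Let rN := rH + 3.
Let rA := rH + 5.
Let rB := rH + 7.
Let l := rH + 8.

(** Positions are compared at run time, in registers [l] to [l + 3]; the values [e] and [e'] are
    unrolled when the emitter is built, so each leaf is one constant bit. *)
Definition eadj (e e' : nat) : emitter :=
  ecls l (l + 2) (fun cy => ecls (l + 1) (l + 3) (fun ci =>
    EBits [:: adjacent cy ci (valn M e) (valn M e')])).

Definition erat (r : nat) : emitter :=
  ECat (EBits [:: false]) (ECat (ENat r) (EBits (enc_int 1))).

(** All run-time tests precede the leaf, so [allowed] is evaluated when the emitter is built. *)
Definition ecost_leaf (e : nat) (y0 i0 : bool) (inp : option symbol) : emitter :=
  if (valn M e).2 && allowed y0 i0 inp (valn M e).1
  then EBits (enc_rat 1%:R%R) else erat rN.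

Definition ecost_input (e : nat) (y0 i0 : bool) : emitter :=
  EIfEq rH l 1
    (EIn (l + 1) (ecost_leaf e y0 i0 (Some None))
       (ecost_leaf e y0 i0 (Some (Some false)))
       (ecost_leaf e y0 i0 (Some (Some true))))
    (ecost_leaf e y0 i0 None).

Definition ecost_col (e : nat) (y0 : bool) : emitter :=
  EIfEq (l + 1) 1 0 (ecost_input e y0 true) (ecost_input e y0 false).

Definition ecost (e : nat) : emitter :=
  EIfEq l 1 0 (ecost_col e true) (ecost_col e false).

Lemma scoped_ecost e : scoped (ecost e) l.+2.
Proof.
have leaf y0 i0 inp : scoped (ecost_leaf e y0 i0 inp) l.+2.
  by rewrite /ecost_leaf; case: ifP => //= _; rewrite /l /rN; lia.
have ifE a b m c d : scoped (EIfEq a b m c d) l.+2 =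
    [&& a < l.+2, b < l.+2, scoped c l.+2 & scoped d l.+2] by [].
have inE' a c0 c1 c2 : scoped (EIn a c0 c1 c2) l.+2 =
    [&& a < l.+2, scoped c0 l.+2, scoped c1 l.+2 & scoped c2 l.+2] by [].
rewrite /ecost /ecost_col /ecost_input !ifE !inE' !leaf !andbT /l /rH; lia.
Qed.

Definition eagents (f : nat -> emitter) : emitter :=
  EFor rH (EFor rH (ecats [seq f e | e <- iota 0 Q])).

Definition body : emitter := ecats [:: ENat rN; EBits (enc_nat 1);
  eagents (fun e => eagents (eadj e));
  EBits (true :: enc_nat 0 ++ [:: false]); epow2 rA;
  EBits (enc_rat (-1)%R);
  EBits (false :: enc_nat 1 ++ [:: false]); epow2 rB;
  EFor rN (EBits (enc_rat 0%R));
  eagents ecost; erat rX; EBits (enc_rat 1%R); EBits (enc_rat 1%R);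
  EBits (enc_poly 1%R); EBits (enc_rat 1%R)].

(** Register 1 holds 0, so [ELet 1 1 c] binds the constant [c]. *)
Definition program : emitter :=
  ELet 0 0 2 (squares K 2 (ELet rH rH 0 (ELet 1 1 Q (ELet rX rQ 0
    (ELet 1 1 8 (ELet rN (rH + 4) 10 (ELet 1 1 10 (ELet rN (rH + 6) 12 body)))))))).

Definition side (n : nat) : nat := iter K (fun x => x * x) (n * n + 2).

Lemma scoped_body : scoped body l.
Proof.
rewrite /body scoped_ecats.
have agents f r : rH < r -> (forall e, scoped (f e) r.+2) -> scoped (eagents f) r.
  move=> rr wff; rewrite /eagents; move: (iota 0 Q) => s /=.
  rewrite rr (ltn_trans rr (ltnSn r)) /= scoped_ecats.
  by rewrite all_map; apply/allP => e _; exact: wff.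
have adj : scoped (eagents (fun e => eagents (eadj e))) l.
  apply: (agents) => [|e]; first by rewrite /l; lia.
  apply: (agents) => [|e']; first by rewrite /l; lia.
  rewrite -[l.+2.+2]addn4.
  have lt4 j : j < 4 -> l + j < l + 4 by rewrite ltn_add2l.
  have l4 : l < l + 4 by rewrite -[X in X < _]addn0 lt4.
  apply: scoped_ecls => [||cy]; [exact: l4|exact: lt4|].
  by apply: scoped_ecls => [||ci]; [exact: lt4|exact: lt4|].
have costs : scoped (eagents ecost) l.
  by apply: (agents) => [|e]; [rewrite /l; lia|exact: scoped_ecost].
have allE (a : pred emitter) c s : all a (c :: s) = a c && all a s by [].
rewrite !allE adj costs /= /rN /rA /rB /rX /l; lia.
Qed.

Lemma scoped_program : scoped program 2.
Proof.
have letE a b m c r : scoped (ELet a b m c) r = [&& a < r, b < r & scoped c r.+1] by [].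
rewrite /program letE scoped_squares !letE.
rewrite (_ : (2 + K).+1.+1.+1.+1.+1.+1.+1.+1 = l) ?scoped_body; last by rewrite /l /rH; lia.
rewrite /rX /rQ /rN /rH; lia.
Qed.

Variable w : bits.
Let n := size w.
Let H := side n.

Lemma side_gt0 m : 0 < side m.
Proof.
rewrite /side; elim: K => [|k IH]; first by rewrite addn2.
by rewrite iterS muln_gt0 IH.
Qed.

Let N := nagts M H.

Section Registers.
Variable rho : seq nat.
Hypotheses (szr : size rho = l) (rho1 : nth 0 rho 1 = 0) (rhoH : nth 0 rho rH = H).
Hypotheses (rhoX : nth 0 rho rX = H * H) (rhoN : nth 0 rho rN = N).
Hypotheses (rhoA : nth 0 rho rA = 8 * N + 10) (rhoB : nth 0 rho rB = 10 * N + 12).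

Lemma out_eagents f r' : size r' >= l -> nth 0 r' rH = H ->
  out (eagents f) w r' = flatten [seq flatten [seq flatten
    [seq out (f e) w (rcons (rcons r' y) i) | e <- iota 0 Q] | i <- iota 0 H] | y <- iota 0 H].
Proof.
move=> sz rH'; rewrite /eagents /= rH'; congr flatten; apply: eq_map => y.
rewrite nth_rcons (_ : rH < size r') ?rH'; last by rewrite /l in sz; lia.
by congr flatten; apply: eq_map => i; rewrite out_ecats -map_comp.
Qed.

Lemma flatten_agents (F : nat -> bits) : flatten [seq F k | k <- iota 0 N] =
  flatten [seq flatten [seq flatten
    [seq F ((y * H + i) * Q + e) | e <- iota 0 Q] | i <- iota 0 H] | y <- iota 0 H].
Proof. by rewrite /N /nagts flatten_iota_mul flatten_iota_mul. Qed.

Lemma N_gt0 : 0 < N.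
Proof. by apply: nagts_gt0; exact: side_gt0. Qed.

Lemma row_of y i e : i < H -> e < Q -> rown M H ((y * H + i) * Q + e) = y.
Proof.
move=> iH eQ; rewrite /rown divnMDl // [e %/ _]divn_small // addn0.
by rewrite divnMDl ?side_gt0 // divn_small ?addn0.
Qed.

Lemma col_of y i e : i < H -> e < Q -> coln M H ((y * H + i) * Q + e) = i.
Proof.
move=> iH eQ; rewrite /coln divnMDl // [e %/ _]divn_small // addn0.
by rewrite modnMDl modn_small.
Qed.

Lemma val_of y i e : e < Q -> ((y * H + i) * Q + e) %% nvals M = e.
Proof. by move=> eQ; rewrite modnMDl modn_small. Qed.

Lemma mem_iota0 i m : (i \in iota 0 m) = (i < m).
Proof. by rewrite mem_iota add0n. Qed.

Lemma eq_flatten (T : eqType) (F G : T -> bits) s : {in s, F =1 G} ->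
  flatten [seq F x | x <- s] = flatten [seq G x | x <- s].
Proof. by move=> /eq_in_map ->. Qed.

Lemma rH_lt : rH < l.
Proof. by rewrite /l addnS ltnS leq_addr. Qed.

Lemma nth_rcons2 y i j : j < l -> nth 0 (rcons (rcons rho y) i) j = nth 0 rho j.
Proof. by move=> jl; rewrite !nth_rcons size_rcons szr ltnS (ltnW jl) jl. Qed.

Lemma out_adj : out (eagents (fun e => eagents (eadj e))) w rho =
  enc_mx enc_bool (adjm M H).
Proof.
rewrite enc_mx_nat out_eagents ?szr // flatten_agents.
apply: eq_flatten => y _; apply: eq_flatten => i; rewrite mem_iota0 => iH.
apply: eq_flatten => e; rewrite mem_iota0 => eQ.
have szr' : size (rcons (rcons rho y) i) = l + 2 by rewrite !size_rcons szr addn2.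
rewrite out_eagents; last by rewrite nth_rcons2 ?rH_lt.
  rewrite flatten_agents.
  apply: eq_flatten => y' _; apply: eq_flatten => i'; rewrite mem_iota0 => iH'.
  apply: eq_flatten => e'; rewrite mem_iota0 => eQ'.
  rewrite /eadj !out_ecls /adjn !row_of ?col_of ?val_of //.
  set r' := rcons (rcons rho y) i in szr' *.
  have [n0 n1 n2 n3] := nth_rcons4 y i y' i' szr.
  by rewrite n0 n1 n2 n3.
by rewrite szr' leq_addr.
Qed.

Lemma out_erat r r' : 0 < nth 0 r' r -> out (erat r) w r' = enc_rat (nth 0 r' r)%:R%R.
Proof. by move=> r0; rewrite enc_rat_nat /= bin_digits // -catA. Qed.

Lemma out_cost : out (eagents ecost) w rho =
  enc_mx enc_rat (\col_(i < N) (if goodn M H w i then 1 else N)%:R : 'cV_N)%R.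
Proof.
rewrite (enc_mx_nat enc_rat N 1 (fun i _ => (if goodn M H w i then 1 else N)%:R%R)).
under [in RHS]eq_map do rewrite /= cats0.
rewrite out_eagents ?szr // flatten_agents.
apply: eq_flatten => y _; apply: eq_flatten => i; rewrite mem_iota0 => iH.
apply: eq_flatten => e; rewrite mem_iota0 => eQ.
rewrite /goodn row_of ?col_of ?val_of //.
set r' := rcons (rcons rho y) i.
have yE : nth 0 r' l = y by rewrite /r' !nth_rcons size_rcons szr ltnS leqnn ltnn eqxx.
have iE : nth 0 r' (l + 1) = i by rewrite /r' !nth_rcons size_rcons szr addn1 ltnn eqxx.
have oldE j : j < l -> nth 0 r' j = nth 0 rho j by exact: nth_rcons2.
have leafE y0 i0 inp : out (ecost_leaf e y0 i0 inp) w r' = enc_rat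
    (if (valn M e).2 && allowed y0 i0 inp (valn M e).1 then 1 else N)%:R%R.
  rewrite /ecost_leaf; case: ifP => // _.
  by rewrite out_erat oldE ?rhoN ?N_gt0 // /rN /l; lia.
have ifE a b m c d : out (EIfEq a b m c d) w r' =
    if nth 0 r' a == nth 0 r' b + m then out c w r' else out d w r' by [].
have inE' a c0 c1 c2 : out (EIn a c0 c1 c2) w r' =
    if drop (nth 0 r' a) w is b :: _ then if b then out c2 w r' else out c1 w r'
    else out c0 w r' by [].
have onE : onth w i = ohead (drop i w).
  by elim: (w) i {iH r' yE iE oldE leafE ifE inE'} => [|b v IH] [|i] //=.
rewrite /ecost /ecost_col /ecost_input !ifE !inE' !leafE yE iE.
rewrite (oldE 1) ?(oldE rH) ?rho1 ?rhoH ?addn0 /input_at ?onE //; try (rewrite /l /rH; lia).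
case: (y == 0); case: (i == 0); case: (H == y + 1) => //;
  by case: (drop i w) => [|[] v].
Qed.

Lemma encode_attack_instance : encode (attack_instance M H w) =
  enc_nat N ++ enc_nat 1 ++ enc_mx enc_bool (adjm M H) ++
  enc_rat (- alpha N)%R ++ enc_rat (-1)%R ++ enc_rat (gamma N) ++
  flatten [seq enc_rat 0%R | _ <- iota 0 N] ++
  enc_mx enc_rat (\col_(i < N) (if goodn M H w i then 1 else N)%:R : 'cV_N)%R ++
  enc_rat (H * H)%:R%R ++ enc_rat 1%R ++ enc_rat 1%R ++ enc_poly 1%R ++ enc_rat 1%R.
Proof.
have one (T : Type) (e : T -> bits) (c : T) : enc_mx e (const_mx c : 'M[T]_(1, 1)) = e c.
  by rewrite enc_mx_const /= !cats0.
have zero : enc_mx enc_rat (const_mx 0%R : 'cV[rat]_(N * 1)) =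
    flatten [seq enc_rat 0%R | _ <- iota 0 N].
  rewrite enc_mx_const muln1; congr flatten; exact: eq_map.
transitivity (enc_nat N ++ enc_nat 1 ++ enc_mx enc_bool (adjm M H) ++
  enc_mx enc_rat (const_mx (- alpha N)%R : 'M[rat]_(1, 1)) ++
  enc_mx enc_rat (const_mx (-1)%R : 'M[rat]_(1, 1)) ++ enc_rat (gamma N) ++
  enc_mx enc_rat (const_mx 0%R : 'cV[rat]_(N * 1)) ++
  enc_mx enc_rat (\col_(i < N) (if goodn M H w i then 1 else N)%:R : 'cV_N)%R ++
  enc_rat (H * H)%:R%R ++ enc_rat 1%R ++
  enc_mx enc_rat (const_mx 1%R : 'M[rat]_(1, 1)) ++
  enc_mx enc_poly (const_mx 1%R : 'M[{poly rat}]_(1, 1)) ++ enc_rat 1%R).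
  by [].
by rewrite zero !one.
Qed.

Lemma out_body : out body w rho = encode (attack_instance M H w).
Proof.
have catE c s : out (ecats (c :: s)) w rho = out c w rho ++ out (ecats s) w rho by [].
have nilE : out (ecats [::]) w rho = [::] by [].
have bitsE x : out (EBits x) w rho = x by [].
have natE r : out (ENat r) w rho = enc_seq enc_bool (bin (nth 0 rho r)) by [].
have forE r x : out (EFor r (EBits x)) w rho =
  flatten [seq x | _ <- iota 0 (nth 0 rho r)] by [].
rewrite /body !catE nilE cats0 !bitsE natE forE out_adj out_cost !out_epow2.
rewrite out_erat ?rhoX; last by rewrite muln_gt0 side_gt0.
rewrite rhoN rhoA rhoB bin_digits ?N_gt0 // encode_attack_instance.
by rewrite /alpha /gamma enc_rat_pow2 enc_rat_opp_pow2 /= -!catA.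
Qed.

End Registers.

Lemma out_program : out program w [:: n; 0] = encode (attack_instance M H w).
Proof.
rewrite /program [LHS]/=; set c := ELet rH rH 0 _.
have [rho [sz h old ->]] := @out_squares K 2 c w [:: n; 0; n * n + 2] erefl.
have {}h : nth 0 rho rH = H by rewrite /rH addnC h.
have {}sz : size rho = rX by rewrite sz /rX /rH addn1 addnC.
have rho1 s : nth 0 (rho ++ s) 1 = 0.
  by rewrite nth_cat sz /rX addn1 /rH addn2 old.
have rhoH s : nth 0 (rho ++ s) rH = H by rewrite nth_cat sz /rX addn1 ltnSn.
have nthD s j : nth 0 (rho ++ s) (rX + j) = nth 0 s j.
  by rewrite nth_cat sz ltnNge leq_addr addKn.
have letE a b m d s : out (ELet a b m d) w (rho ++ s) =
    out d w (rho ++ rcons s (nth 0 (rho ++ s) a * nth 0 (rho ++ s) b + m)).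
  by rewrite -rcons_cat.
have [e0 e1 e2] : [/\ rX = rX + 0, rQ = rX + 1 & rN = rX + 2].
  by rewrite /rQ /rN /rX -!addnA.
have [e3 e4 e5 e6] : [/\ rH + 4 = rX + 3, rA = rX + 4, rH + 6 = rX + 5 & rB = rX + 6].
  by rewrite /rA /rB /rX -!addnA.
rewrite /c -[rho]cats0 letE !rhoH [rcons _ _]/= letE rho1 [rcons _ _]/=.
rewrite letE {1}e0 e1 !nthD [rcons _ _]/= letE rho1 [rcons _ _]/=.
rewrite letE e3 {1}e2 !nthD [rcons _ _]/= letE rho1 [rcons _ _]/=.
rewrite letE e5 {1}e2 !nthD [rcons _ _]/=.
apply: out_body.
- by rewrite size_cat sz /l /rX -addnA.
- exact: rho1.
- exact: rhoH.
- by rewrite e0 nthD /= addn0.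
- by rewrite e2 nthD /= !addn0 mul0n.
- by rewrite e4 nthD /= !addn0 mul0n [8 * _]mulnC.
- by rewrite e6 nthD /= !addn0 mul0n [10 * _]mulnC.
Qed.

End Program.

(** * The size of the tableau, and the reduction *)

Lemma polyb_horner (p : {poly nat}) : polyb (fun x => p.[x]%R).
Proof.
rewrite /horner; elim: (polyseq p) => [|a s IH]; first exact: polyb_cst.
by apply: (@polyb_le _ (fun x => horner_rec s x * x + a)) => //; polyb_tac.
Qed.

(** From [p + 1 <= (x + 2) ^ K], using [x + 2 <= x * x + 2] for the base and [K <= 2 ^ K] for the
    exponent. *)
Lemma side_bound (p : {poly nat}) : exists K, forall x, p.[x]%R < side K x.
Proof.
have [K pK] := polybD (polyb_horner p) (polyb_cst 1).
exists K => x; have := pK x; rewrite addn1 => /leq_trans; apply.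
rewrite /side; have base : x + 2 <= x * x + 2.
  by rewrite leq_add2r; case: x {pK} => // x; rewrite leq_pmulr.
have it k y : iter k (fun x => x * x) y = y ^ 2 ^ k.
  by elim: k => //= k ->; rewrite -expnD expnS mul2n addnn.
rewrite it; apply: (@leq_trans ((x * x + 2) ^ K)); first by case: (K) => // k; rewrite leq_exp2r.
by rewrite leq_pexp2l ?addn2 // ltnW // ltn_expl.
Qed.

(** Once all computations have ended, more time changes nothing; hence the tableau may have more
    rows than the time bound asks for. *)
Lemma halts_accepts (M : machine) orc n m (c : config M) :
  halts_within orc n c -> n <= m ->
  accepts_within orc m c = accepts_within orc n c.
Proof.
elim: n m c => [|n IH] [|m] c //=; first by move=> /nilP ->.
move=> h nm; congr (_ || _); elim: (Defs.next orc c) h => //= c' s IHs /andP[h hs].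
by rewrite IH // IHs.
Qed.

Lemma encode_set_head k (a : 'I_k) (A : {set 'I_k}) : a = 0 :> nat ->
  exists s, encode_set A = (a \in A) :: s.
Proof.
move=> a0; rewrite /encode_set; have := val_enum_ord k.
case: k a A a0 => [|k] a A a0; first by case: (a).
case: (enum _) => [|b s] //= [b0 _]; exists [seq i \in A | i <- s].
by congr ((_ \in A) :: _); apply/val_inj; rewrite [LHS]b0 [RHS]a0.
Qed.

Local Open Scope ring_scope.

Theorem lemma4 (R : realType) (eps : R) (eps_gt0 : 0 < eps) :
  NP_hard (attack_placement eps).
Proof.
move=> L [M [p [noq dec]]].
have [K pK] := side_bound p.
pose inst w := attack_instance M (side K (size w)) w.
have printedE w : printed (program M K) w = encode (inst w) by exact: out_program.
apply: (@turing_reducible_printed (program M K)); first exact: scoped_program.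
  move=> w; have [A opt] := attack_instance_optimal M w (side_gt0 K (size w)) R.
  exists (encode_set A); exists (inst w); split=> //; last by exists A.
  by apply: attack_instance_well_formed => //; exact: side_gt0.
(* A correct answer belongs to some instance with this encoding; injectivity makes it the printed
   one. *)
move=> w y; rewrite printedE => -[I [/encode_inj eI _ [A -> opt]]].
move: A opt; rewrite -eI => A opt {I eI}.
have [hlt ->] := dec w.
rewrite -(halts_accepts hlt (_ : _ <= (side K (size w)).-1)%N); last first.
  by rewrite -ltnS prednK ?pK // side_gt0.
rewrite (attack_instance_correct noq (side_gt0 K (size w)) opt).
have [s ->] := encode_set_head A (agent0E M (side_gt0 K (size w))).
by split=> [/negPf ->|[y' []] ->]; first exists s.
Qed.
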